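(* Let $G$ be a second countable locally compact Hausdorff groupoid with a fixed left Haar system $\lambda=\{\lambda^u\}_{u\in G^0}$, and let $(\Phi,\Psi)$ be a complementary pair of $N$-functions with $\Phi\in\Delta_2$. Suppose $E_0^\Phi\subseteq E^1$. Then the bilinear map $F:C_c(G)\times C_c(G)\to C_c(G)$, $F(f,g)=f*g$, is bounded with respect to the norm $\|\cdot\|_\Phi^0$, i.e. there is a constant $C>0$ with $\|f*g\|^0_\Phi\le C\|f\|^0_\Phi\|g\|^0_\Phi$ for all $f,g\in C_c(G)$, and hence $F$ extends to a bounded bilinear map $E_0^\Phi\times E_0^\Phi\to E_0^\Phi$. Moreover, if $G$ is a commutative group bundle (i.e. $r=d$ and each $G^u$ is an abelian group), this convolution is commutative.
   Context: $G^0$ is the unit space, $r(x)=xx^{-1}$, $d(x)=x^{-1}x$, $G^u=r^{-1}(u)$. A left Haar system is a family of positive Radon measures $\lambda^u$ with support $G^u$, such that $u\mapsto\int f\,d\lambda^u$ is continuous for every $f\in C_c(G)$ and $\int f(xy)\,d\lambda^{d(x)}(y)=\int f(y)\,d\lambda^{r(x)}(y)$ for all $x\in G$, $f\in C_c(G)$. A Young function is an even convex $\Phi:\mathbb R\to[0,\infty]$ with $\Phi(0)=0$ and $\lim_{x\to\infty}\Phi(x)=\infty$; an $N$-function is a continuous Young function with $\Phi(x)=0$ iff $x=0$, $\lim_{x\to0}\Phi(x)/x=0$ and $\lim_{x\to\infty}\Phi(x)/x=\infty$. The complementary function is $\Psi(y)=\sup\{x|y|-\Phi(x):x\ge0\}$.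 $\Phi\in\Delta_2$ means: there is $k>0$ with $\Phi(2x)\le k\Phi(x)$ for all $x\ge0$ if $G$ is non-compact, resp. for all $x\ge x_0$ for some $x_0>0$ if $G$ is compact. For $u\in G^0$, $L^\Phi(G^u)$ is the space of measurable $f:G^u\to\mathbb C$ with $\int_{G^u}\Phi(\alpha|f|)d\lambda^u<\infty$ for some $\alpha>0$, with gauge norm $\|f\|^0_\Phi=\inf\{k>0:\int_{G^u}\Phi(|f|/k)d\lambda^u\le1\}$. For $f\in C_c(G)$ write $f^u=f|_{G^u}$. A section $\xi=(\xi^u)_{u\in G^0}$ with $\xi^u\in L^\Phi(G^u)$ is continuous if for every $u_0\in G^0$ and $\varepsilon>0$ there exist $f\in C_c(G)$ and a neighbourhood $V$ of $u_0$ with $\|\xi^v-f^v\|^0_\Phi<\varepsilon$ for all $v\in V$. $E_0^\Phi$ is the Banach space of continuous sections $\xi$ such that $u\mapsto\|\xi^u\|^0_\Phi$ vanishes at infinity, normed by $\|\xi\|^0_\Phi=\sup_u\|\xi^u\|^0_\Phi$; $C_c(G)$ is regarded as a (dense) subspace via $f\mapsto(f^u)_u$. Analogously, $E^1$ is the Banach space of sections $\xi^u\in L^1(G^u,\lambda^u)$ which are locally close to $C_c(G)$ in the $L^1$-norm and with $u\mapsto\|\xi^u\|_1$ vanishing at infinity, with norm $\|\xi\|_1=\sup_u\int|\xi^u|d\lambda^u$. $E_0^\Phi\subseteq E^1$ means every element of $E_0^\Phi$ is an element of $E^1$. Convolution on $C_c(G)$: $f*g(x)=\int_{G^{r(x)}}f(y)g(y^{-1}x)\,d\lambda^{r(x)}(y)$.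 *)

(* Defs.v *)
From HB Require Import structures.
From mathcomp Require Import all_boot all_order all_algebra.
From mathcomp Require Import all_classical all_reals all_analysis.
From mathcomp Require Import complex.

Set Implicit Arguments.
Unset Strict Implicit.
Unset Printing Implicit Defensive.

Import Order.TTheory GRing.Theory Num.Theory.
Import numFieldNormedType.Exports.
Local Open Scope classical_set_scope.
Local Open Scope ring_scope.

Notation Borel T := (g_sigma_algebraType (@open T)).

(* Groupoids (Renault's axioms), with composable pairs [comp x y]       *)
Section Groupoid.
Variables (T : Type) (comp : T -> T -> Prop) (mul : T -> T -> T) (inv : T -> T).

Definition is_groupoid : Prop :=
  [/\ (forall x, inv (inv x) = x),
      (forall x y z, comp x y -> comp y z ->
         comp (mul x y) z /\ comp x (mul y z) /\
         mul (mul x y) z = mul x (mul y z)),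
      (forall x, comp (inv x) x),
      (forall x y, comp x y -> mul (inv x) (mul x y) = y) &
      (forall x y, comp y x -> mul (mul y x) (inv x) = y)].

Definition gr (x : T) := mul x (inv x).
Definition gd (x : T) := mul (inv x) x.
Definition G0 : set T := range gr.
Definition Gu (u : T) : set T := gr @^-1` [set u].

Definition comm_group_bundle : Prop :=
  (forall x, gr x = gd x) /\
  (forall x y, gr x = gr y -> mul x y = mul y x).
End Groupoid.

Definition is_topological_groupoid (T : ptopologicalType)
    (comp : T -> T -> Prop) (mul : T -> T -> T) (inv : T -> T) : Prop :=
  is_groupoid comp mul inv /\ continuous inv /\
  {within [set p : T * T | comp p.1 p.2], continuous (fun p => mul p.1 p.2)}.

Definition locally_compact_space (T : ptopologicalType) : Prop :=
  forall x : T, exists2 K : set T, compact K & nbhs x K.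

Section Analysis.
Variables (R : realType) (T : ptopologicalType).
Local Notation C := R[i].
Local Notation cre := (@complex.Re R).
Local Notation cim := (@complex.Im R).

Definition msupport (mu : {measure set (Borel T) -> \bar R}) : set T :=
  [set x | forall U : set T, open U -> U x -> (0 < mu U)%E].

Definition Cc (f : T -> R) : Prop :=
  continuous f /\ exists2 K : set T, compact K & forall x, ~ K x -> f x = 0.

Definition CcC (f : T -> C) : Prop :=
  Cc (fun x => cre (f x)) /\ Cc (fun x => cim (f x)).

Definition cmeasurable (D : set T) (f : T -> C) : Prop :=
  @measurable_fun _ _ (Borel T) R D (fun x => cre (f x)) /\
  @measurable_fun _ _ (Borel T) R D (fun x => cim (f x)).

Definition cintegral (mu : {measure set (Borel T) -> \bar R}) (D : set T)
    (h : T -> C) : C :=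
  @complex.Complex R (Rintegral mu D (fun x => cre (h x))) (Rintegral mu D (fun x => cim (h x))).

Variables (comp : T -> T -> Prop) (mul : T -> T -> T) (inv : T -> T).
Local Notation r := (gr mul inv).
Local Notation d := (gd mul inv).
Local Notation GO := (G0 mul inv).
Local Notation Gf := (Gu mul inv).

Definition left_haar_system (lam : T -> {measure set (Borel T) -> \bar R}) : Prop :=
  [/\ (* positive Radon measures: locally finite Borel measures *)
      (forall u, GO u -> forall K : set T, compact K -> (lam u K < +oo)%E),
      (forall u, GO u -> msupport (lam u) = Gf u),
      (forall f, Cc f ->
         {within GO, continuous (fun u => Rintegral (lam u) setT f)}) &
      (forall x f, Cc f ->
         Rintegral (lam (d x)) setT (fun y => f (mul x y)) =
         Rintegral (lam (r x)) setT f)].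

Definition gconv (lam : T -> {measure set (Borel T) -> \bar R}) (f g : T -> C)
  : T -> C :=
  fun x => cintegral (lam (r x)) (Gf (r x)) (fun y => f y * g (mul (inv y) x)).

Definition young_function (Phi : R -> R) : Prop :=
  [/\ (forall x, Phi (- x) = Phi x),
      (forall x y t, 0 <= t <= 1 ->
         Phi (t * x + (1 - t) * y) <= t * Phi x + (1 - t) * Phi y),
      Phi 0 = 0 &
      Phi x @[x --> +oo] --> +oo].

Definition N_function (Phi : R -> R) : Prop :=
  [/\ young_function Phi, continuous Phi,
      (forall x, Phi x = 0 <-> x = 0),
      Phi x / x @[x --> 0^'] --> 0 &
      Phi x / x @[x --> +oo] --> +oo].

Definition complementary (Phi : R -> R) (y : R) : R :=
  sup [set x * `|y| - Phi x | x in [set x : R | 0 <= x]].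

Definition Delta2 (Phi : R -> R) : Prop :=
  exists2 k : R, 0 < k &
   (compact [set: T] ->
      exists2 x0 : R, 0 < x0 & forall x, x0 <= x -> Phi (2 * x) <= k * Phi x) /\
   (~ compact [set: T] -> forall x, 0 <= x -> Phi (2 * x) <= k * Phi x).

Variables (lam : T -> {measure set (Borel T) -> \bar R}) (Phi : R -> R).

Definition in_LPhi (u : T) (f : T -> C) : Prop :=
  cmeasurable (Gf u) f /\
  exists2 a : R, 0 < a &
    (\int[lam u]_(x in Gf u) (Phi (a * (@Normc.normc R (f x))))%:E < +oo)%E.

Definition gauge_norm (u : T) (f : T -> C) : R :=
  inf [set k : R | 0 < k /\
        (\int[lam u]_(x in Gf u) (Phi ((@Normc.normc R (f x)) / k))%:E <= 1)%E].

Definition in_L1 (u : T) (f : T -> C) : Prop :=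
  cmeasurable (Gf u) f /\
  (\int[lam u]_(x in Gf u) ((@Normc.normc R (f x)))%:E < +oo)%E.

Definition L1_norm (u : T) (f : T -> C) : R :=
  fine (\int[lam u]_(x in Gf u) ((@Normc.normc R (f x)))%:E).

(* sections: xi u is (a representative of) xi^u *)
Definition gsection := T -> T -> C.
Definition of_Cc (f : T -> C) : gsection := fun _ => f.

Definition vanish_at_infinity (nu : T -> R) : Prop :=
  forall eps : R, 0 < eps ->
    exists2 K : set T, compact K /\ K `<=` GO &
      forall u, GO u -> ~ K u -> nu u < eps.

Definition E0Phi (xi : gsection) : Prop :=
  [/\ (forall u, GO u -> in_LPhi u (xi u)),
      (forall u0, GO u0 -> forall eps : R, 0 < eps ->
         exists f, CcC f /\ exists2 V : set T, nbhs u0 V &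
           forall v, GO v -> V v -> gauge_norm v (xi v - f) < eps) &
      vanish_at_infinity (fun u => gauge_norm u (xi u))].

Definition E1 (xi : gsection) : Prop :=
  [/\ (forall u, GO u -> in_L1 u (xi u)),
      (forall u0, GO u0 -> forall eps : R, 0 < eps ->
         exists f, CcC f /\ exists2 V : set T, nbhs u0 V &
           forall v, GO v -> V v -> L1_norm v (xi v - f) < eps) &
      vanish_at_infinity (fun u => L1_norm u (xi u))].

Definition sec_norm (xi : gsection) : R :=
  sup [set gauge_norm u (xi u) | u in GO].

Definition sec_eq (xi eta : gsection) : Prop :=
  forall u, GO u -> (lam u).-negligible [set x | Gf u x /\ xi u x <> eta u x].

Definition sec_add (xi eta : gsection) : gsection := fun u x => xi u x + eta u x.
Definition sec_scale (a : C) (xi : gsection) : gsection := fun u x => a * xi u x.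

End Analysis.

(* Main.v *)
(* Left invariance shows that the fibre of [f * g] over [u] is an average of left
   translates of [g], weighted by [|f|] on [G^u]. Jensen's inequality and Tonelli's
   theorem then give [||f * g||_Phi <= (sup_u ||f^u||_1) ||g||_Phi]. The inclusion of
   [E0] in [E1] makes the [L1]-norm dominated by the gauge norm: otherwise a sum of
   rescaled [|f_n|] would converge in [E0] and have unbounded [L1]-norms. The product
   of two sections is the limit of products of approximants, since [C_c(G)] is dense
   in [E0] and the gauge norm is complete. In a commutative group bundle the Haar
   measures are invariant under inversion, whence [f * g = g * f]. *)
Require Import Defs.
From HB Require Import structures.
From mathcomp Require Import all_boot all_order all_algebra.
From mathcomp Require Import finmap.
From mathcomp Require Import all_classical all_reals all_analysis.
From mathcomp Require Import measurable_realfun complex.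
From mathcomp Require Import ring lra.
Set Implicit Arguments.
Unset Strict Implicit.
Unset Printing Implicit Defensive.
Import Order.TTheory GRing.Theory Num.Theory.
Import numFieldNormedType.Exports.
Local Open Scope classical_set_scope.
Local Open Scope ring_scope.

(** * Extension of compactly supported functions *)

(** [mul x y] is arbitrary off the composable pairs, so a kernel such as [f y * g (mul (inv y) x)]
    is under control only on the closed set [r x = r y] of [T * T]. It is therefore replaced by a
    function of [Cc] on all of [T * T] that agrees with it there. This one extension yields
    integrability, continuity of the convolution, and the joint measurability behind Tonelli's
    theorem.

    Second countability enters through a countable base: complements of fibres are null, Haar
    measures are sigma-finite, and continuous functions on [T * T] are measurable for the product of
    the Borel sigma-algebras.

    The inclusion of [E0] in [E1] is a bare inclusion of sets, from which a constant must be
    extracted; the contradiction works with moduli, so that nothing cancels and every summand stays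
    below the limit.

    Gauge limits are determined only up to null sets on each fibre. The product of sections is
    therefore chosen by an approximation property, and its identities hold almost everywhere. *)

Lemma within_eq_continuous (X Y : topologicalType) (A : set X) (f g : X -> Y) :
  (forall x, A x -> f x = g x) ->
  {within A, continuous f} -> {within A, continuous g}.
Proof.
move=> fg; apply: (@subspace_eq_continuous X A Y) => x /set_mem; exact: fg.
Qed.

Section LocallyCompact.
Variables (R : realType) (X : ptopologicalType).
Hypothesis lcX : locally_compact_space X.
Hypothesis hX : hausdorff_space X.

Let lc_setT : locally_compact [set: X].
Proof.
move=> x _; rewrite withinET; have [K cK xK] := lcX x.
by exists K => //; split => //; exact: compact_closed.
Qed.

Lemma compact_open_nbhd (K : set X) : compact K ->
  exists U C : set X, [/\ open U, compact C, K `<=` U & U `<=` C].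
Proof.
move=> cptK; have cK : cover_compact K by rewrite -compact_cover.
have ex : forall x : X, exists k : set X, compact k /\ nbhs x k.
  by move=> x; have [k] := lcX x; exists k.
have [k kP] := choice ex.
have [|x Kx|D' _ KD] := cK X K (fun x => (k x)^°).
- by move=> i _; exact: open_interior.
- by exists x => //; exact: (kP x).2.
exists (\bigcup_(i in [set` D']) (k i)^°), (\bigcup_(i in [set` D']) k i).
split => //.
- by apply: bigcup_open => i _; exact: open_interior.
- by rewrite bigcup_fset; apply: bigsetU_compact => i _; exact: (kP i).1.
- apply: subset_bigcup => i _; exact: interior_subset.
Qed.

(** A locally compact Hausdorff space need not be normal, but its one-point compactification is, so
    Tietze's theorem is applied there. The value [0] is prescribed outside [U], at infinity
    included; this agrees with [f], which vanishes on [A] off [K], and gives the extension compact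
    support. [A] is cut to [C] because infinity may adhere to [A]. *)
Lemma Cc_extension (A K : set X) (f : X -> R) : closed A -> compact K ->
  {within A, continuous f} -> (forall x, A x -> ~ K x -> f x = 0) ->
  exists2 h : X -> R, Cc h & {in A, h =1 f}.
Proof.
move=> clA cK cf f0.
have [U [C [oU cC KU UC]]] := compact_open_nbhd cK.
pose O := one_point_compactification X.
have hO : hausdorff_space O by exact: one_point_compactification_hausdorff.
have nO : normal_space O.
  by apply: compact_normal => //; exact: one_point_compactification_compact.
have cAC : compact (A `&` C).
  by rewrite setIC; apply: compact_closedI.
pose B1 : set O := Some @` (A `&` C).
pose B2 : set O := ~` (Some @` U).
have cB1 : closed B1.
  apply: compact_closed => //; apply: continuous_compact => //.
  apply: continuous_subspaceT; exact: one_point_compactification_some_continuous.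
have cB2 : closed B2.
  by apply: open_closedC; exact: one_point_compactification_open_some.
pose f1 : O -> R^o := fun o => if o is Some x then (f \_ A) x else 0.
have f10 x : B2 x -> f1 x = 0.
  case: x => //= x nUx; rewrite /patch; case: ifPn => //.
  rewrite inE => Ax; apply: f0 => //; apply: contra_not nUx => /KU Ux.
  by exists x.
have cf1 : {within B1 `|` B2, continuous f1}.
  apply: withinU_continuous => //.
    apply/subspace_continuousP => _ [x [Ax Cx] <-] /=.
    have f1A y : A y -> f1 (Some y) = f y by move=> Ay; rewrite /f1 /patch mem_set.
    have /subspace_continuousP/(_ x Ax) cfx := cf.
    move=> W; rewrite /from_subspace f1A// => /cfx fW.
    have {}fW : nbhs x (fun y => A y -> W (f y)) := fW.
    change (nbhs x (fun y => B1 (Some y) -> W (f1 (Some y)))).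
    apply: filterS fW => y Wy [z [Az Cz] [zy]]; move: Az Cz; rewrite zy => Ay Cy.
    by rewrite f1A//; exact: Wy.
  apply: (@within_eq_continuous _ _ _ (cst 0)); last exact: cst_continuous.
  by move=> x /f10 ->.
have [M M0 fM] : exists2 M : R, 0 < M & forall x, A x -> `|f x| <= M.
  have : compact (f @` (A `&` C)).
    apply: continuous_compact => //.
    by apply: continuous_subspaceW cf; exact: subIsetl.
  move=> /compact_bounded [N [_ /(_ (`|N| + 1))]].
  rewrite (le_lt_trans (ler_norm _)) ?ltrDl// => /(_ isT) NP.
  exists (`|N| + 1); first by rewrite ltr_pwDr.
  move=> x Ax; have [Cx|nCx] := pselect (C x).
    by apply: NP; exists x.
  rewrite f0 ?normr0 ?addr_ge0// => Kx; apply: nCx; exact/UC/KU.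
have [|g [gE cg gM]] := @continuous_bounded_extension O R nO _ (closedU cB1 cB2) f1 M M0 cf1.
  move=> [x|] _ /=; last by rewrite normr0 ltW.
  by rewrite /patch; case: ifPn => [/set_mem/fM|]//; rewrite normr0 ltW.
exists (fun x => g (Some x)).
  split.
    move=> x; apply: (@continuous_comp X O R^o Some g x); last exact: cg.
    exact: one_point_compactification_some_continuous.
  exists C => // x nCx; have B2x : B2 (Some x).
    by move=> [y Uy [yx]]; apply: nCx; rewrite -yx; exact: UC.
  by rewrite -gE ?f10// inE; right.
move=> x; rewrite inE => Ax.
have [Ux|nUx] := pselect (U x).
  rewrite -gE ?inE /= /patch ?mem_set//; left; exists x => //; split => //.
  exact: UC.
have B2x : B2 (Some x) by move=> [y Uy [yx]]; apply: nUx; rewrite -yx.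
rewrite -gE ?inE; last by right.
by rewrite f10// f0// => /KU.
Qed.

(** The indicator of [K] is continuous on the union of [K] and the complement of [V], being constant
    on each of two disjoint closed pieces. Its extension [h] is forced into [[0, 1]] by [min 1 |h|],
    which leaves the values [0] and [1] alone. *)
Lemma Cc_bump (K V : set X) : compact K -> open V -> K `<=` V ->
  exists h : X -> R, [/\ Cc h, forall x, 0 <= h x <= 1,
    forall x, K x -> h x = 1 & forall x, ~ V x -> h x = 0].
Proof.
move=> cK oV KV.
have clK : closed K by exact: compact_closed.
have clKV : closed (K `|` ~` V) by apply: closedU => //; exact: open_closedC.
have cKV : {within K `|` ~` V, continuous (\1_K : X -> R)}.
  apply: withinU_continuous => //; first exact: open_closedC.
    apply: (@within_eq_continuous X R K (cst 1) (\1_K)); last exact: cst_continuous.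
    by move=> x Kx; rewrite indicE mem_set.
  apply: (@within_eq_continuous X R _ (cst 0) (\1_K)); last exact: cst_continuous.
  by move=> x Vx; rewrite indicE memNset// => /KV.
have K0 x : (K `|` ~` V) x -> ~ K x -> \1_K x = 0 :> R.
  by move=> _ nKx; rewrite indicE memNset.
have [h [ch [C cC hC]] hE] := Cc_extension clKV cK cKV K0.
exists (fun x => Num.min 1 `|h x|); split.
- split.
    move=> x; apply: (@continuous_min R X (cst 1) (fun x => `|h x|)); first exact: cst_continuous.
    by apply: continuous_comp; [exact: ch|exact: norm_continuous].
  by exists C => // x /hC ->; rewrite normr0 min_r.
- by move=> x; rewrite le_min ler01 normr_ge0 ge_min lexx.
- move=> x Kx; rewrite hE ?indicE ?mem_set ?normr1 ?minxx//; left => //.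
- move=> x nVx; rewrite hE ?indicE; last by rewrite inE; right.
  by rewrite memNset ?normr0 ?min_r// => /KV.
Qed.

End LocallyCompact.

Lemma countable_bigcup_measurable d (T : measurableType d) (I : Type)
    (D : set I) (F : I -> set T) : countable D ->
  (forall i, D i -> measurable (F i)) -> measurable (\bigcup_(i in D) F i).
Proof.
move=> /pfcard_geP[->|[f]] mF; first by rewrite bigcup_set0.
have -> : \bigcup_(i in D) F i = \bigcup_(n in f @^-1` D) F (f n).
  apply/seteqP; split => [x [i Di Fx]|x [n Dn Fx]]; last by exists (f n).
  by have [n _ fn] := 'surj_f Di; exists n; rewrite /= fn.
by apply: bigcup_measurable => n Dn; exact: mF.
Qed.

(** * Measurability of continuous functions in second countable spaces *)

Section SecondCountable.
Variables (R : realType) (T : ptopologicalType).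

Lemma open_Borel (A : set T) : open A -> @measurable _ (Borel T) A.
Proof. by move=> oA; apply: sub_sigma_algebra. Qed.

Lemma closed_Borel (A : set T) : closed A -> @measurable _ (Borel T) A.
Proof. by move=> cA; rewrite -(setCK A); apply: measurableC; apply: open_Borel; exact: closed_openC. Qed.

Lemma continuous_Borel (D : set T) (f : T -> R) : continuous f ->
  @measurable_fun _ _ (Borel T) R D f.
Proof.
move=> cf; apply: (@measurable_funS _ _ (Borel T) R setT) => //.
apply: (measurability _ (RGenOpens.measurableE R)).
move=> _ [_ [a [b ->] <-]]; rewrite setTI; apply: open_Borel.
by apply: open_comp; [move=> x _; exact: cf|exact: interval_open].
Qed.

Hypothesis scT : @second_countable T.

(** The source carries the product of the Borel sigma-algebras, in general smaller than the Borel
    sigma-algebra of the product topology. A countable base makes every open set of [T * T] a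
    countable union of open rectangles. *)
Lemma continuous_Borel2 (f : T * T -> R) : continuous f ->
  @measurable_fun _ _ (Borel T * Borel T)%type R setT f.
Proof.
move=> cf.
have [B cB [Bo Bn]] := scT.
apply: (measurability _ (RGenOpens.measurableE R)).
move=> _ [_ [a [b ->] <-]]; rewrite setTI.
have : open (f @^-1` `]a, b[).
  by apply: open_comp; [move=> x _; exact: cf|exact: interval_open].
move: (f @^-1` _) => O oO.
have -> : O = \bigcup_(p in (B `*` B) `&` [set p | p.1 `*` p.2 `<=` O]) (p.1 `*` p.2).
  apply/seteqP; split; last by move=> x [p [_ pO]]; exact: pO.
  move=> [x y] Oxy.
  have : nbhs (x, y) O by exact: open_nbhs_nbhs.
  move=> [[P Q] /= [xP yQ] PQ].
  have [U [BU Ux] UP] := Bn x _ xP.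
  have [V [BV Vy] VQ] := Bn y _ yQ.
  exists (U, V) => //=; split => //= -[x' y'] /= [Ux' Vy']; apply: PQ.
  by split => /=; [exact: UP|exact: VQ].
apply: countable_bigcup_measurable.
  apply: (@sub_countable _ _ _ (B `*` B)); last exact: countableX.
  by apply: subset_card_le => ? [].
move=> [P Q] [[/= BP BQ] _]; apply: measurableX; apply: open_Borel; exact: Bo.
Qed.

End SecondCountable.

(** * Topological groupoids *)

Section CcAlgebra.
Variables (R : realType) (T : ptopologicalType).
Implicit Types f g : T -> R.

Lemma Cc_comp2 (phi : R -> R -> R) f g : continuous (fun p : R * R => phi p.1 p.2) ->
  phi 0 0 = 0 -> Cc f -> Cc g -> Cc (fun x => phi (f x) (g x)).
Proof.
move=> cphi phi0 [cf [K cK fK]] [cg [L cL gL]]; split.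
  move=> x; have cfg : {for x, continuous (fun x => (f x, g x))}.
    by apply: (cvg_pair (cf x) (cg x)).
  exact: (continuous_comp cfg (cphi _)).
exists (K `|` L); first exact: compactU.
by move=> x /not_orP[/fK -> /gL ->].
Qed.

Lemma Cc_comp (phi : R -> R) f : continuous phi -> phi 0 = 0 -> Cc f -> Cc (phi \o f).
Proof.
move=> cphi phi0 [cf [K cK fK]]; split.
  by move=> x; apply: continuous_comp; [exact: cf|exact: cphi].
by exists K => // x /fK /= ->.
Qed.

Lemma Cc0 : Cc (fun _ : T => 0 : R).
Proof. by split; [exact: cst_continuous|exists set0 => //; exact: compact0]. Qed.

Lemma CcD f g : Cc f -> Cc g -> Cc (fun x => f x + g x).
Proof.
apply: (@Cc_comp2 +%R); last by rewrite addr0.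
by move=> p; apply: cvgD; [exact: cvg_fst|exact: cvg_snd].
Qed.

Lemma CcZ (a : R) f : Cc f -> Cc (fun x => a * f x).
Proof.
apply: (@Cc_comp ( *%R a)); last by rewrite mulr0.
by move=> x; apply: cvgM; [exact: cvg_cst|exact: cvg_id].
Qed.

Lemma CcN f : Cc f -> Cc (fun x => - f x).
Proof. by move=> /(CcZ (-1)); congr Cc; apply/funext => x; rewrite mulN1r. Qed.

Lemma CcB f g : Cc f -> Cc g -> Cc (fun x => f x - g x).
Proof. by move=> cf /CcN; exact: CcD. Qed.

Lemma Cc_norm f : Cc f -> Cc (fun x => `|f x|).
Proof. by apply: (@Cc_comp Num.norm); [exact: norm_continuous|exact: normr0]. Qed.

Lemma CcMl f g : continuous f -> Cc g -> Cc (fun x => f x * g x).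
Proof.
move=> cf [cg [K cK gK]]; split; last by exists K => // x /gK ->; rewrite mulr0.
by move=> x; apply: cvgM; [exact: cf|exact: cg].
Qed.

Lemma Cc_bounded f : Cc f -> exists2 M : R, 0 < M & forall x, `|f x| <= M.
Proof.
move=> [cf [K cK fK]].
have : compact (f @` K).
  by apply: continuous_compact => //; exact: continuous_subspaceT.
move=> /compact_bounded [N [_ /(_ (`|N| + 1))]].
rewrite (le_lt_trans (ler_norm _)) ?ltrDl// => /(_ isT) NP.
exists (`|N| + 1); first by rewrite ltr_pwDr.
move=> x; have [Kx|/fK ->] := pselect (K x); first by apply: NP; exists x.
by rewrite normr0 addr_ge0.
Qed.

End CcAlgebra.

Section GroupoidAlgebra.
Variables (T : Type) (comp : T -> T -> Prop) (mul : T -> T -> T) (inv : T -> T).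
Hypothesis hG : is_groupoid comp mul inv.
Local Notation r := (gr mul inv).
Local Notation d := (gd mul inv).
Local Notation GO := (G0 mul inv).
Local Notation Gf := (Gu mul inv).

Let invK x : inv (inv x) = x. Proof. by case: hG. Qed.
Let mulA x y z : comp x y -> comp y z ->
  comp (mul x y) z /\ comp x (mul y z) /\ mul (mul x y) z = mul x (mul y z).
Proof. by case: hG => _ + _ _ _; exact. Qed.
Let compV x : comp (inv x) x. Proof. by case: hG. Qed.
Let mulVK x y : comp x y -> mul (inv x) (mul x y) = y.
Proof. by case: hG => _ _ _ + _; exact. Qed.
Let mulKV x y : comp y x -> mul (mul y x) (inv x) = y.
Proof. by case: hG => _ _ _ _; exact. Qed.

Lemma comp_inv x : comp x (inv x).
Proof. by rewrite -{1}(invK x). Qed.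

Lemma grpd_invK x : inv (inv x) = x. Proof. exact: invK. Qed.

Lemma gd_comp x y : comp x y -> mul (d x) y = y.
Proof. by move=> xy; have [_ [_ ->]] := mulA (compV x) xy; exact: mulVK. Qed.

Lemma gr_comp x y : comp x y -> mul x (r y) = x.
Proof. by move=> xy; have [_ [_ <-]] := mulA xy (comp_inv y); exact: mulKV. Qed.

Lemma mul_grx x : mul (r x) x = x.
Proof. by have [_ [_ ->]] := mulA (comp_inv x) (compV x); have := gr_comp (comp_inv x); rewrite /gr invK. Qed.

Lemma mul_xgd x : mul x (d x) = x.
Proof. by have := gr_comp (comp_inv x); rewrite /gr /gd invK. Qed.

Lemma comp_xgd x : comp x (d x).
Proof. by have [_ []] := mulA (comp_inv x) (compV x). Qed.

Lemma comp_grx x : comp (r x) x.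
Proof. by have [] := mulA (comp_inv x) (compV x). Qed.

(** For composable [x] and [y], the product of [d x] and [r y] collapses in two ways, to [r y] and
    to [d x]. Conversely, [d x = r y] composes with [x] on its left and with [y] on its right, and
    associativity glues the two. Composability becomes an equation between continuous maps. *)
Lemma compP x y : comp x y <-> d x = r y.
Proof.
split => [xy|dr]; last first.
  have yc := comp_grx y; have xc := comp_xgd x.
  have := mulA xc; rewrite {1}dr => /(_ _ yc) [+ _].
  by rewrite mul_xgd.
have [c1 [_ e1]] := mulA (compV x) xy.
have [_ [_ e2]] := mulA c1 (comp_inv y).
have [_ [c3 e3]] := mulA xy (comp_inv y).
move: e2; rewrite gd_comp// -/(r y) => ->.
have [_ [_ e4]] := mulA (compV x) c3.
by rewrite e4 -e3 mulKV.
Qed.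

Lemma gr_inv x : r (inv x) = d x. Proof. by rewrite /gr invK. Qed.

Lemma gd_inv x : d (inv x) = r x. Proof. by rewrite /gd invK. Qed.

Lemma gr_mul x y : d x = r y -> r (mul x y) = r x.
Proof.
move=> /compP xy; have [_ [/compP <- _]] := mulA (comp_grx x) xy.
by have /compP := comp_grx x.
Qed.

Lemma gr_gr x : r (r x) = r x.
Proof. by rewrite {2}/gr gr_mul// gr_inv. Qed.

Lemma gd_mul x y : d x = r y -> d (mul x y) = d y.
Proof.
move=> /[dup] dxy /compP xy; have [c _] := mulA xy (comp_inv y).
by have /compP -> := c; rewrite gr_inv.
Qed.

Lemma mulVxy x y : d x = r y -> mul (inv x) (mul x y) = y.
Proof. by move=> /compP; exact: mulVK. Qed.

Lemma mulxVy x y : r x = r y -> mul x (mul (inv x) y) = y.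
Proof. by move=> xy; have := @mulVxy (inv x) y; rewrite gd_inv invK; exact. Qed.

Lemma mulxyV x y : d x = r y -> mul (mul x y) (inv y) = x.
Proof. by move=> /compP; exact: mulKV. Qed.

Lemma grpd_mulA x y z : d x = r y -> d y = r z ->
  mul (mul x y) z = mul x (mul y z).
Proof. by move=> /compP xy /compP yz; have [_ [_]] := mulA xy yz. Qed.

Lemma inv_mul x y : d x = r y -> inv (mul x y) = mul (inv y) (inv x).
Proof.
move=> xy.
have cxy : comp x y by apply/compP.
have dxy := gd_mul xy; have rxy := gr_mul xy.
have e1 : mul (inv (mul x y)) (mul x y) = d y by rewrite -dxy.
have e2 := @grpd_mulA (inv (mul x y)) (mul x y) (inv y).
have e3 := @grpd_mulA (inv (mul x y)) x (inv x).
rewrite mulxyV// in e2; rewrite -/(d (mul x y)) dxy in e2.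
have {}e2 : mul (inv (mul x y)) x = inv y.
  by rewrite -e2 ?gd_inv ?gr_inv// -{1}[d y]/(d y) -gr_inv mul_grx.
rewrite e2 in e3; rewrite e3 ?gd_inv ?gr_inv//.
by rewrite -/(r x) -rxy -gd_inv mul_xgd.
Qed.

Lemma GO_gr x : GO (r x). Proof. by exists x. Qed.

Lemma GO_gd x : GO (d x). Proof. by exists (inv x); rewrite ?gr_inv. Qed.

Lemma GO_id u : GO u -> r u = u. Proof. by move=> [x _ <-]; exact: gr_gr. Qed.
End GroupoidAlgebra.

Section GroupoidTopology.
Variables (T : ptopologicalType).
Variables (comp : T -> T -> Prop) (mul : T -> T -> T) (inv : T -> T).
Hypothesis hT : hausdorff_space T.
Hypothesis hG : is_topological_groupoid comp mul inv.
Local Notation r := (gr mul inv).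
Local Notation d := (gd mul inv).
Local Notation GO := (G0 mul inv).
Local Notation Gf := (Gu mul inv).

Let hgr : is_groupoid comp mul inv := proj1 hG.
Lemma inv_continuous : continuous inv. Proof. by case: hG => _ []. Qed.

(** [mul] is continuous relative to the composable pairs, so the factors must eventually be
    composable. The filter is arbitrary because the lemma also serves for neighbourhoods within a
    closed subset of [T * T]. *)
Lemma mul_cvg (S : Type) (F : set_system S) (FF : Filter F) (f g : S -> T) x y :
  d x = r y -> (\forall z \near F, d (f z) = r (g z)) ->
  f @ F --> x -> g @ F --> y -> (fun z => mul (f z) (g z)) @ F --> mul x y.
Proof.
move=> /(compP hgr) xy Ffg fx gy.
have [_ [_ /subspace_continuousP cm]] := hG.
have {}cm := cm (x, y) xy.
move=> W /cm fW.
have {}fW : nbhs (x, y) (fun p : T * T => comp p.1 p.2 -> W (mul p.1 p.2)) := fW.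
have fg : (fun z => (f z, g z)) @ F --> (x, y) by exact: cvg_pair.
have {}fW := fg _ fW.
have {}fW : F (fun z => comp (f z) (g z) -> W (mul (f z) (g z))) := fW.
have : F (fun z => W (mul (f z) (g z))).
  by apply: filterS2 fW Ffg => z + /(compP hgr).
by [].
Qed.

Lemma gr_continuous : continuous r.
Proof.
move=> x; apply: mul_cvg; first by rewrite (gr_inv hgr).
- by near=> z; rewrite (gr_inv hgr).
- exact: cvg_id.
- exact: inv_continuous.
Unshelve. all: by end_near. Qed.

Lemma gd_continuous : continuous d.
Proof.
have -> : d = r \o inv by apply/funext => x /=; rewrite (gr_inv hgr).
by move=> x; apply: continuous_comp; [exact: inv_continuous|exact: gr_continuous].
Qed.

Lemma closed_eq (S : topologicalType) (f g : S -> T) :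
  continuous f -> continuous g -> closed [set x | f x = g x].
Proof.
move=> cf cg x clx; apply: hT => U V Ux Vx.
have fU : nbhs x (f @^-1` U) := cf x _ Ux.
have gV : nbhs x (g @^-1` V) by rewrite /= in Vx *; exact: (cg x _ Vx).
have [y [/= fg [Uy Vy]]] := clx _ (filterI fU gV).
by exists (f y); split => //; rewrite fg.
Qed.

Lemma Gu_closed u : closed (Gf u).
Proof. by apply: closed_eq; [exact: gr_continuous|exact: cst_continuous]. Qed.

Lemma composable_closed : closed [set p : T * T | d p.1 = r p.2].
Proof.
apply: (@closed_eq _ (fun p => d p.1) (fun p => r p.2)).
- by move=> p; apply: (@continuous_comp _ _ _ fst d); [exact: cvg_fst|exact: gd_continuous].
- by move=> p; apply: (@continuous_comp _ _ _ snd r); [exact: cvg_snd|exact: gr_continuous].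
Qed.

Lemma same_range_closed : closed [set p : T * T | r p.1 = r p.2].
Proof.
apply: (@closed_eq _ (fun p => r p.1) (fun p => r p.2)).
- by move=> p; apply: (@continuous_comp _ _ _ fst r); [exact: cvg_fst|exact: gr_continuous].
- by move=> p; apply: (@continuous_comp _ _ _ snd r); [exact: cvg_snd|exact: gr_continuous].
Qed.

Lemma mul_compact (K L : set T) : compact K -> compact L ->
  exists2 M : set T, compact M & forall x y, d x = r y -> K x -> L y -> M (mul x y).
Proof.
move=> cK cL.
pose D := (K `*` L) `&` [set p : T * T | d p.1 = r p.2].
exists ((fun p => mul p.1 p.2) @` D); last by move=> x y xy Kx Ly; exists (x, y).
apply: continuous_compact.
  have [_ [_ cm]] := hG.
  by apply: continuous_subspaceW cm => p [_ /(compP hgr)].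
by apply: compact_closedI; [exact: compact_setX|exact: composable_closed].
Qed.

Lemma gr_compact (K : set T) : compact K -> compact (r @` K) /\ r @` K `<=` GO.
Proof.
move=> cK; split; last by move=> _ [x _ <-]; exists x.
apply: continuous_compact => //; apply: continuous_subspaceT; exact: gr_continuous.
Qed.

End GroupoidTopology.

(** * Haar systems *)

Section NullComplement.
Local Open Scope ereal_scope.
Context d (T : measurableType d) (R : realType) (mu : {measure set T -> \bar R}).
Import HBNNSimple.

(** For every nonnegative [f] the integral is the supremum of the integrals of simple functions
    below it. Cutting a simple function to [D] alters it only on a null set, so both suprema agree.
    Integrals over a fibre and over [T] can then be exchanged freely, inner integrals included. *)
Lemma nnintegral_null_setC (D : set T) (f : T -> \bar R) : measurable D ->
  mu (~` D) = 0 -> (forall x, 0 <= f x) ->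
  \int[mu]_(x in D) f x = \int[mu]_x f x.
Proof.
move=> mD D0 f0; rewrite integral_mkcond.
rewrite !ge0_integralTE//; last by move=> x; rewrite /patch; case: ifPn.
apply/eqP; rewrite eq_le; apply/andP; split; apply: ge_ereal_sup => _ [h hf <-].
  apply: ereal_sup_ubound; exists h => //= x; apply: (le_trans (hf x)).
  by rewrite /patch; case: ifPn.
apply: ereal_sup_ubound; exists (proj_nnsfun h mD).
  move=> x /=; rewrite /patch mindicE; case: ifPn => xD.
    by rewrite mulr1; exact: hf.
  by rewrite mulr0.
rewrite -!integralT_nnsfun.
have mC : measurable (~` D) by exact: measurableC.
apply/esym; rewrite -[in LHS](setUv D) ge0_integral_setU//; last 3 first.
- by apply: measurable_funTS; exact/measurable_EFinP.
- by move=> x _; rewrite lee_fin.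
- by apply/eqP; rewrite setICr.
rewrite (null_set_integral mC)// ?adde0; last first.
  by apply/measurable_funTS/measurable_EFinP.
rewrite [in LHS]integral_mkcond; apply: eq_integral => x _.
rewrite /= mindicE /patch; case: ifPn => _; first by rewrite mulr1.
by rewrite mulr0.
Qed.

Lemma nnintegral_le (D : set T) (f g : T -> \bar R) :
  (forall x, D x -> 0 <= f x) -> (forall x, D x -> f x <= g x) ->
  \int[mu]_(x in D) f x <= \int[mu]_(x in D) g x.
Proof.
move=> f0 fg; rewrite !(integral_mkcond D).
have g0 x : D x -> 0 <= g x by move=> Dx; apply: le_trans (fg x Dx); exact: f0.
rewrite !ge0_integralTE; last 2 first.
- by move=> x; rewrite /patch; case: ifPn => [/set_mem/g0|].
- by move=> x; rewrite /patch; case: ifPn => [/set_mem/f0|].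
apply: ge_ereal_sup => _ [h hf <-]; apply: ereal_sup_ubound; exists h => //= x.
apply: (le_trans (hf x)); rewrite /patch.
by case: ifPn => [/set_mem/fg|].
Qed.

Lemma integral_null_setC (D : set T) (f : T -> \bar R) : measurable D ->
  mu (~` D) = 0 -> \int[mu]_(x in D) f x = \int[mu]_x f x.
Proof.
by move=> mD D0; rewrite integralE [RHS]integralE; congr (_ - _);
  apply: nnintegral_null_setC.
Qed.

Lemma countable_bigcup_null (I : Type) (D : set I) (F : I -> set T) :
  countable D -> (forall i, D i -> measurable (F i)) ->
  (forall i, D i -> mu (F i) = 0) -> mu (\bigcup_(i in D) F i) = 0.
Proof.
move=> cD mF F0.
have mU : measurable (\bigcup_(i in D) F i) by exact: countable_bigcup_measurable.
move/pfcard_geP : cD => [D0|[f]]; first by rewrite D0 bigcup_set0 measure0.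
apply: measure_negligible => //.
have -> : \bigcup_(i in D) F i = \bigcup_n F (f n).
  apply/seteqP; split => [x [i Di Fx]|x [n _ Fx]].
    by have [n _ fn] := 'surj_f Di; exists n; rewrite ?fn.
  by exists (f n) => //; exact: funS.
apply: negligible_bigcup => n; have Dn : D (f n) by exact: funS.
by apply/negligibleP; [exact: mF|exact: F0].
Qed.

End NullComplement.

Section Haar.
Variables (R : realType) (T : ptopologicalType).
Variables (comp : T -> T -> Prop) (mul : T -> T -> T) (inv : T -> T).
Variable (lam : T -> {measure set (Borel T) -> \bar R}).
Hypothesis scT : @second_countable T.
Hypothesis lcT : locally_compact_space T.
Hypothesis hT : hausdorff_space T.
Hypothesis hG : is_topological_groupoid comp mul inv.
Hypothesis hL : left_haar_system mul inv lam.
Local Notation r := (gr mul inv).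
Local Notation d := (gd mul inv).
Local Notation GO := (G0 mul inv).
Local Notation Gf := (Gu mul inv).

Let hgr : is_groupoid comp mul inv := proj1 hG.

Lemma Gu_measurable u : @measurable _ (Borel T) (Gf u).
Proof. by apply: closed_Borel; exact: (@Gu_closed _ _ _ _ hT hG u). Qed.

(** A point outside the support has an open null neighbourhood. Taking these neighbourhoods in the
    countable base covers the complement of the fibre by countably many null sets. *)
Lemma haar_null u : GO u -> lam u (~` Gf u) = 0%E.
Proof.
move=> uO; have [B cB [Bo Bn]] := scT.
have [_ /(_ u uO) supp _ _] := hL.
pose D := B `&` [set V | lam u V = 0%E].
have -> : ~` Gf u = ~` Gf u `&` \bigcup_(V in D) V.
  apply/seteqP; split => x; last by case.
  move=> xu; split => //; move: (xu); rewrite -supp => /existsNP[U].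
  move=> /not_implyP[oU] /not_implyP[Ux] /negP.
  rewrite -leNgt => U0.
  have [V [BV Vx] VU] := Bn x U (open_nbhs_nbhs (conj oU Ux)).
  exists V => //; split => //=; apply/eqP; rewrite eq_le measure_ge0 andbT.
  apply: le_trans U0; apply: le_measure; rewrite ?inE//; apply: open_Borel => //.
  exact: Bo.
have cD : countable D.
  by apply: (@sub_countable _ _ _ B) => //; apply: subset_card_le => ? [].
have mD V : D V -> @measurable _ (Borel T) V.
  by move=> [BV _]; apply: open_Borel; exact: Bo.
apply/eqP; rewrite eq_le measure_ge0 andbT.
rewrite -(@countable_bigcup_null _ _ _ (lam u) _ D (fun V => V) cD mD); last by move=> V [].
apply: le_measure; rewrite ?inE//.
- apply: measurableI; first by apply: measurableC; exact: Gu_measurable.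
  exact: countable_bigcup_measurable.
- exact: countable_bigcup_measurable.
Qed.

Lemma haar_setT u (f : T -> \bar R) : GO u ->
  (\int[lam u]_(x in Gf u) f x = \int[lam u]_x f x)%E.
Proof.
move=> uO; apply: integral_null_setC; [exact: Gu_measurable|exact: haar_null].
Qed.

Lemma haar_RsetT u (f : T -> R) : GO u ->
  Rintegral (lam u) (Gf u) f = Rintegral (lam u) setT f.
Proof. by move=> uO; rewrite /Rintegral haar_setT. Qed.

Lemma compact_Borel (K : set T) : compact K -> @measurable _ (Borel T) K.
Proof. by move=> cK; apply: closed_Borel; exact: compact_closed. Qed.

Lemma Cc_integrable u (D : set T) (h : T -> R) : @measurable _ (Borel T) D ->
  GO u -> Cc h -> (lam u).-integrable D (EFin \o h).
Proof.
move=> mD uO ch; have [cth [K cK hK]] := ch.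
have mK := compact_Borel cK.
apply: (@integrableS _ _ _ _ setT) => //.
have [M M0 hM] := Cc_bounded ch.
have -> : EFin \o h = (EFin \o h) \_ K.
  apply/funext => x; rewrite /patch; case: ifPn => // /negP.
  by rewrite inE => /hK /= ->.
apply/(integrable_mkcond _ mK).
apply: (@measurable_bounded_integrable _ _ _ (lam u) h K mK) => //.
- by have [/(_ u uO K cK)] := hL.
- exact: continuous_Borel.
- exists M; split; first exact: num_real.
  by move=> x Mx y _; apply: (le_trans (hM y)); exact: ltW.
Qed.

(** Off the fibre over [u], a translate or a convolution kernel depends on arbitrary values of
    [mul]. Only its agreement on [Gf u] with a function of [Cc] is recorded, which suffices for
    integrals over the fibre. *)
Definition CcOn (u : T) (k : T -> R) :=
  exists2 h : T -> R, Cc h & forall y, Gf u y -> h y = k y.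

Lemma Cc_CcOn u h : Cc h -> CcOn u h. Proof. by move=> ch; exists h. Qed.

Lemma CcOn_comp2 (phi : R -> R -> R) u k l :
  continuous (fun p : R * R => phi p.1 p.2) -> phi 0 0 = 0 ->
  CcOn u k -> CcOn u l -> CcOn u (fun x => phi (k x) (l x)).
Proof.
move=> cphi phi0 [h ch hk] [g cg gl]; exists (fun x => phi (h x) (g x)).
  exact: Cc_comp2.
by move=> y Gy; rewrite hk// gl.
Qed.

Lemma CcOn_measurable u k : CcOn u k -> @measurable_fun _ _ (Borel T) R (Gf u) k.
Proof.
move=> [h [ch _] hk]; apply: (@eq_measurable_fun _ _ (Borel T) R _ h).
  by move=> x /set_mem; exact: hk.
exact: continuous_Borel.
Qed.

Lemma CcOn_integrable u k : GO u -> CcOn u k ->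
  (lam u).-integrable (Gf u) (EFin \o k).
Proof.
move=> uO [h ch hk]; apply: (@eq_integrable _ _ _ _ _ (Gu_measurable u) (EFin \o h)).
  by move=> x /set_mem Gx /=; rewrite hk.
by apply: Cc_integrable => //; exact: Gu_measurable.
Qed.

Lemma haar_invariant x (k : T -> R) : CcOn (r x) k ->
  Rintegral (lam (d x)) (Gf (d x)) (fun y => k (mul x y)) =
  Rintegral (lam (r x)) (Gf (r x)) k.
Proof.
move=> [h ch hk]; have [_ _ _ /(_ x h ch)] := hL.
rewrite -(haar_RsetT _ (GO_gd hgr x)) -(haar_RsetT _ (GO_gr mul inv x)).
rewrite (@eq_Rintegral _ (Borel T) R (lam (r x)) (Gf (r x)) h k); last by move=> y /set_mem/hk.
move=> <-; apply: eq_Rintegral => y /set_mem yd; rewrite hk// /Gu/=.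
by rewrite (gr_mul hgr)//; rewrite yd.
Qed.

(** A bump function [h] equal to [1] on [K] has integral at least [lam v K]. That integral is
    continuous in [v], hence bounded on the compact image of [C] under [r], and it vanishes at the
    other units, whose fibres miss [C]. *)
Lemma haar_compact_bounded (K : set T) : compact K ->
  exists2 B : R, 0 < B & forall v, GO v -> (lam v K <= B%:E)%E.
Proof.
move=> cK; have [U [C [oU cC KU UC]]] := compact_open_nbhd lcT cK.
have [h [ch h01 h1 hU]] := Cc_bump R lcT hT cK oU KU.
have [_ _ /(_ h ch) cI _] := hL.
have [cL LO] := gr_compact hG cC.
have : compact ((fun u => Rintegral (lam u) setT h) @` (r @` C)).
  by apply: continuous_compact => //; exact: continuous_subspaceW cI.
move=> /compact_bounded [N [_ /(_ (`|N| + 1))]].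
rewrite (le_lt_trans (ler_norm _)) ?ltrDl// => /(_ isT) NP.
exists (`|N| + 1); first by rewrite ltr_pwDr.
move=> v vO.
have ih := Cc_integrable measurableT vO ch.
have le1 : (lam v K <= (Rintegral (lam v) setT h)%:E)%E.
  rewrite /Rintegral fineK; last exact: integrable_fin_num.
  rewrite -[lam v K]mul1e -integral_cst; last exact: compact_Borel.
  rewrite integral_mkcond; apply: ge0_le_integral => //.
  - by move=> x Dx; rewrite /patch; case: ifPn.
  - by apply/(measurable_restrictT _ (compact_Borel cK)); exact: measurable_cst.
  - exact: measurable_int ih.
  - move=> x Dx; rewrite /patch; case: ifPn => [/set_mem/h1 ->|_]//.
    by rewrite lee_fin; case/andP: (h01 x).
apply: (le_trans le1); rewrite lee_fin.
have [vC|vC] := pselect ((r @` C) v).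
  by apply: (le_trans (ler_norm _)); apply: NP; exists v.
rewrite -haar_RsetT// (@eq_Rintegral _ (Borel T) R (lam v) (Gf v) (cst 0) h).
  by rewrite /Rintegral integral0 addr_ge0.
move=> y /set_mem yv; apply: hU => /UC Cy; apply: vC; exists y => //.
Qed.

End Haar.

(** * The gauge norm *)

Section YoungFunction.
Variables (R : realType) (Phi : R -> R).
Hypothesis hPhi : N_function Phi.

Lemma Phi_continuous : continuous Phi. Proof. by case: hPhi. Qed.

Lemma Phi_convex x y t : 0 <= t <= 1 ->
  Phi (t * x + (1 - t) * y) <= t * Phi x + (1 - t) * Phi y.
Proof. by case: hPhi => -[_ + _ _] _ _ _ _; exact. Qed.

Lemma Phi0 : Phi 0 = 0. Proof. by case: hPhi => -[]. Qed.

Lemma Phi_ge0 x : 0 <= Phi x.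
Proof.
have [[even _ _ _] _ _ _ _] := hPhi.
have := @Phi_convex x (- x) (1/2).
rewrite even (_ : 1/2 * x + _ = 0); last by lra.
by rewrite Phi0 => H; have := H ltac:(lra); lra.
Qed.

Lemma Phi_scale x t : 0 <= t <= 1 -> Phi (t * x) <= t * Phi x.
Proof.
move=> t01; have := @Phi_convex x 0 t t01.
by rewrite Phi0 !mulr0 !addr0.
Qed.

Lemma Phi_mono x y : 0 <= x -> x <= y -> Phi x <= Phi y.
Proof.
move=> x0 xy; have [y0|y0] := leP y 0; first by have -> : x = y by lra.
have -> : x = (x / y) * y by rewrite divfK// gt_eqF.
have t1 : x / y <= 1 by rewrite ler_pdivrMr// mul1r.
have t0 : 0 <= x / y by rewrite divr_ge0// ltW.
apply: (le_trans (Phi_scale _ _)); first by rewrite t0.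
by rewrite ler_piMl// Phi_ge0.
Qed.

Lemma Phi_large M : exists2 A, 0 < A & forall x, A <= x -> M <= Phi x.
Proof.
have [[_ _ _ /cvgryPge/(_ M) [A [_ hA]]] _ _ _ _] := hPhi.
exists (`|A| + 1); first by rewrite ltr_pwDr.
by move=> x Ax; apply: hA; rewrite (lt_le_trans _ Ax)// ltr_pwDr// ler_norm.
Qed.

Lemma Phi_slopes m t t' : t < m -> m < t' ->
  (Phi m - Phi t) / (m - t) <= (Phi t' - Phi m) / (t' - m).
Proof.
move=> tm mt'.
have tt' : t < t' by exact: lt_trans mt'.
rewrite ler_pdivrMr ?subr_gt0// mulrAC ler_pdivlMr ?subr_gt0//.
have s1 : (t' - m) / (t' - t) <= 1 by rewrite ler_pdivrMr ?subr_gt0// mul1r; lra.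
have s0 : 0 <= (t' - m) / (t' - t) by apply: divr_ge0; lra.
have := @Phi_convex t t' ((t' - m) / (t' - t)).
have nz : t' - t != 0 by rewrite gt_eqF// subr_gt0.
have -> : (t' - m) / (t' - t) * t + (1 - (t' - m) / (t' - t)) * t' = m by field.
rewrite s0 s1 => /(_ isT).
have -> : (t' - m) / (t' - t) * Phi t + (1 - (t' - m) / (t' - t)) * Phi t' =
   ((t' - m) * Phi t + (m - t) * Phi t') / (t' - t) by field.
rewrite ler_pdivlMr ?subr_gt0// => H.
nra.
Qed.

(** [Phi] need not be differentiable at [m], and the left derivative serves as slope: it is the
    supremum of the chord slopes to the left, bounded above by every chord slope to the right. *)
Lemma Phi_subgradient m : exists s, forall t, Phi m + s * (t - m) <= Phi t.
Proof.
pose S := [set (Phi m - Phi t) / (m - t) | t in [set t | t < m]].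
have Sub t' : m < t' -> ubound S ((Phi t' - Phi m) / (t' - m)).
  by move=> mt' _ [t /= tm <-]; exact: Phi_slopes.
have S0 : S !=set0 by exists ((Phi m - Phi (m - 1)) / (m - (m - 1))); exists (m - 1) => //=; lra.
have hS : has_ubound S by exists ((Phi (m + 1) - Phi m) / (m + 1 - m)); apply: Sub; lra.
exists (sup S) => t; have [tm|mt|->] := ltgtP t m; last by lra.
- have : (Phi m - Phi t) / (m - t) <= sup S by apply: ub_le_sup => //; exists t.
  by rewrite ler_pdivrMr ?subr_gt0//; lra.
- have : sup S <= (Phi t - Phi m) / (t - m) by apply: ge_sup => //; exact: Sub.
  by rewrite ler_pdivlMr ?subr_gt0//; lra.
Qed.

End YoungFunction.

Section Gauge.
Variables (R : realType) (Phi : R -> R).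
Hypothesis hPhi : N_function Phi.
Context d (X : measurableType d) (mu : {measure set X -> \bar R}) (D : set X).
Hypothesis mD : measurable D.
Local Notation normc := (@Normc.normc R).
Local Notation cre := (@complex.Re R).
Local Notation cim := (@complex.Im R).

Definition modular (w : X -> R) (k : R) :=
  (\int[mu]_(x in D) (Phi (w x / k))%:E <= 1)%E.

Definition gauge (f : X -> R[i]) : R :=
  inf [set k : R | 0 < k /\ modular (normc \o f) k].

Definition cmeas (f : X -> R[i]) :=
  measurable_fun D (cre \o f) /\ measurable_fun D (cim \o f).

Definition inLPhi (f : X -> R[i]) :=
  cmeas f /\ exists2 a : R, 0 < a &
    (\int[mu]_(x in D) (Phi (a * normc (f x)))%:E < +oo)%E.

Lemma normc_ge0 z : 0 <= normc z. Proof. by case: z => a b; exact: sqrtr_ge0. Qed.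

Lemma normc_def2 z : normc z = Num.sqrt (cre z ^+ 2 + cim z ^+ 2).
Proof. by case: z. Qed.

Lemma cre_le_normc z : `|cre z| <= normc z.
Proof. by rewrite normc_def2 -sqrtr_sqr ler_sqrt ?addr_ge0 ?sqr_ge0// lerDl sqr_ge0. Qed.

Lemma cim_le_normc z : `|cim z| <= normc z.
Proof. by rewrite normc_def2 -sqrtr_sqr ler_sqrt ?addr_ge0 ?sqr_ge0// lerDr sqr_ge0. Qed.

Lemma creD (z w : R[i]) : cre (z + w) = cre z + cre w. Proof. by case: z; case: w. Qed.
Lemma cimD (z w : R[i]) : cim (z + w) = cim z + cim w. Proof. by case: z; case: w. Qed.
Lemma creN (z : R[i]) : cre (- z) = - cre z. Proof. by case: z. Qed.
Lemma cimN (z : R[i]) : cim (- z) = - cim z. Proof. by case: z. Qed.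
Lemma creM (z w : R[i]) : cre (z * w) = cre z * cre w - cim z * cim w.
Proof. by case: z; case: w. Qed.
Lemma cimM (z w : R[i]) : cim (z * w) = cre z * cim w + cim z * cre w.
Proof. by case: z => a b; case: w. Qed.

Lemma normcD z w : normc (z + w) <= normc z + normc w.
Proof. exact: le_normcD. Qed.

Lemma normcB_sym z w : normc (z - w) = normc (w - z).
Proof. by rewrite -normcN opprB. Qed.

Lemma cmeasD f g : cmeas f -> cmeas g -> cmeas (fun x => f x + g x).
Proof.
move=> [rf cf] [rg cg]; split.
  rewrite (_ : _ \o _ = (cre \o f) \+ (cre \o g)); first exact: measurable_funD.
  by apply/funext => x /=; rewrite creD.
rewrite (_ : _ \o _ = (cim \o f) \+ (cim \o g)); first exact: measurable_funD.
by apply/funext => x /=; rewrite cimD.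
Qed.

Lemma cmeasZ a f : cmeas f -> cmeas (fun x => a * f x).
Proof.
move=> [rf cf]; split.
  rewrite (_ : _ \o _ = (fun x => cre a * cre (f x)) \- (fun x => cim a * cim (f x))).
    by apply: measurable_funB; apply: measurable_funM => //; exact: measurable_cst.
  by apply/funext => x /=; rewrite creM.
rewrite (_ : _ \o _ = (fun x => cre a * cim (f x)) \+ (fun x => cim a * cre (f x))).
  by apply: measurable_funD; apply: measurable_funM => //; exact: measurable_cst.
by apply/funext => x /=; rewrite cimM.
Qed.

Lemma cmeasB f g : cmeas f -> cmeas g -> cmeas (fun x => f x - g x).
Proof.
move=> mf /(cmeasZ (-1)) mg; have := cmeasD mf mg.
by congr cmeas; apply/funext => x; rewrite mulN1r.
Qed.

Lemma cmeas_normc f : cmeas f -> measurable_fun D (normc \o f).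
Proof.
move=> [rf cf].
rewrite (_ : _ \o _ = Num.sqrt \o ((fun x => cre (f x) ^+ 2) \+ (fun x => cim (f x) ^+ 2))).
  apply: measurableT_comp.
    by apply: continuous_measurable_fun; exact: sqrt_continuous.
  by apply: measurable_funD; apply: measurable_funX.
by apply/funext => x /=; rewrite normc_def2.
Qed.

Lemma modular_measurable (w : X -> R) c : measurable_fun D w ->
  measurable_fun D (fun x => (Phi (w x * c))%:E).
Proof.
move=> mw; apply/measurable_EFinP.
apply: (measurableT_comp (f := Phi)).
  by apply: continuous_measurable_fun; exact: Phi_continuous.
by apply: measurable_funM => //; exact: measurable_cst.
Qed.

Lemma modular_le (v w : X -> R) k l : measurable_fun D v -> measurable_fun D w ->
  (forall x, D x -> 0 <= v x / k <= w x / l) -> modular w l -> modular v k.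
Proof.
move=> mv mw vw; apply: le_trans; apply: ge0_le_integral => //.
- by move=> x Dx; rewrite lee_fin Phi_ge0.
- exact: modular_measurable.
- exact: modular_measurable.
- by move=> x /vw /andP[h1 h2]; rewrite lee_fin Phi_mono.
Qed.

Lemma modular_widen (w : X -> R) k l : measurable_fun D w ->
  (forall x, D x -> 0 <= w x) -> 0 < k -> k <= l -> modular w k -> modular w l.
Proof.
move=> mw w0 k0 kl; have l0 := lt_le_trans k0 kl.
apply: modular_le => // x Dx; apply/andP; split; first by apply: divr_ge0; [exact: w0|exact: ltW].
by rewrite ler_wpM2l ?w0// lef_pV2.
Qed.

(** [(v + w) / (k + l)] is the convex combination of [v / k] and [w / l] with weights [k / (k + l)]
    and [l / (k + l)]. This is the triangle inequality of the gauge before infima are taken. *)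
Lemma modularD (v w : X -> R) k l : measurable_fun D v -> measurable_fun D w ->
  0 < k -> 0 < l -> modular v k -> modular w l ->
  modular (fun x => v x + w x) (k + l).
Proof.
move=> mv mw k0 l0 vk wl; rewrite /modular.
have kl0 : 0 < k + l by exact: addr_gt0.
pose t := k / (k + l).
have t0 : 0 <= t by rewrite divr_ge0 ?ltW.
have t1 : 0 <= 1 - t by rewrite subr_ge0 ler_pdivrMr// mul1r lerDl ltW.
have mv' := modular_measurable k^-1 mv.
have mw' := modular_measurable l^-1 mw.
apply: (@le_trans _ _ (\int[mu]_(x in D)
    (t%:E * (Phi (v x / k))%:E + (1 - t)%:E * (Phi (w x / l))%:E))%E).
  apply: ge0_le_integral => //.
  - by move=> x Dx; rewrite lee_fin Phi_ge0.
  - by apply: modular_measurable; exact: measurable_funD.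
  - by apply: emeasurable_funD; apply: emeasurable_funM => //; exact: measurable_cst.
  - move=> x Dx; rewrite -!EFinM -EFinD lee_fin.
    have -> : (v x + w x) / (k + l) = t * (v x / k) + (1 - t) * (w x / l).
      by rewrite /t; field; rewrite !gt_eqF.
    by apply: Phi_convex; rewrite // t0 -subr_ge0.
rewrite ge0_integralD//.
- rewrite !ge0_integralZl_EFin//; try by move=> x Dx; rewrite lee_fin Phi_ge0.
  have -> : (1 = t%:E * 1 + (1 - t)%:E * 1 :> \bar R)%E.
    by rewrite !mule1 -EFinD; congr EFin; lra.
  by apply: leeD; apply: lee_wpmul2l.
- by move=> x Dx; rewrite mule_ge0// lee_fin Phi_ge0.
- by apply: emeasurable_funM => //; exact: measurable_cst.
- by move=> x Dx; rewrite mule_ge0// lee_fin Phi_ge0.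
- by apply: emeasurable_funM => //; exact: measurable_cst.
Qed.

Lemma inLPhiP f : inLPhi f <-> cmeas f /\ exists2 k, 0 < k & modular (normc \o f) k.
Proof.
split => -[mf]; last first.
  move=> [k k0 fk]; split => //; exists k^-1; first by rewrite invr_gt0.
  apply: le_lt_trans (ltry 1); apply: le_trans fk.
  by under eq_integral do rewrite mulrC.
move=> [a a0 fa]; split => //.
have mn := cmeas_normc mf.
set I := (\int[mu]_(x in D) _)%E in fa.
have I0 : (0 <= I)%E by apply: integral_ge0 => x Dx; rewrite lee_fin Phi_ge0.
have Ifin : I \is a fin_num by rewrite ge0_fin_numE.
(* As [M] is at least [1], convexity gives [Phi (y / M) <= Phi y / M]; as [M] exceeds the integral,
   the quotient of the two is at most [1]. *)
pose M := fine I + 1.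
have fI : 0 <= fine I by rewrite fine_ge0.
have M1 : 1 <= M by rewrite /M; lra.
have M0 : 0 < M by lra.
exists (M / a); first exact: divr_gt0.
rewrite /modular.
apply: (@le_trans _ _ (\int[mu]_(x in D) (M^-1%:E * (Phi (a * normc (f x)))%:E))%E).
  apply: ge0_le_integral => //.
  - by move=> x Dx; rewrite lee_fin Phi_ge0.
  - exact: modular_measurable.
  - apply: emeasurable_funM => //.
    under eq_fun do rewrite mulrC.
    exact: modular_measurable.
  - move=> x Dx; rewrite -EFinM lee_fin.
    have -> : normc (f x) / (M / a) = M^-1 * (a * normc (f x)) by field; rewrite !gt_eqF.
    by apply: Phi_scale; rewrite // invr_ge0 ltW//= invf_le1.
rewrite ge0_integralZl_EFin//.
- rewrite -/I -(fineK Ifin) -EFinM lee_fin mulrC ler_pdivrMr// mul1r /M; lra.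
- by move=> x Dx; rewrite lee_fin Phi_ge0.
- under eq_fun do rewrite mulrC.
  exact: modular_measurable.
- by rewrite invr_ge0 ltW.
Qed.

Lemma gauge_ge0 f : 0 <= gauge f.
Proof.
have [h|h] := pselect ([set k : R | 0 < k /\ modular (normc \o f) k] !=set0).
  by apply: lb_le_inf => // k [/ltW].
by rewrite /gauge inf_out// => -[].
Qed.

Lemma gauge_le f k : 0 < k -> modular (normc \o f) k -> gauge f <= k.
Proof. by move=> k0 fk; apply: ge_inf => //; exists 0 => l [/ltW]. Qed.

(** Membership guarantees an admissible [k]: the infimum of an empty set is [0] by convention, so a
    small value of [gauge f] alone would say nothing. Admissible values are closed upwards, hence
    everything above the infimum is admissible. *)
Lemma gauge_lt f k : inLPhi f -> gauge f < k -> 0 < k /\ modular (normc \o f) k.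
Proof.
move=> /inLPhiP[mf [l l0 fl]] /inf_lt [|k' [k'0 fk'] k'k]; first by exists l.
have k0 := lt_trans k'0 k'k; split => //.
apply: modular_widen fk' => //; [exact: cmeas_normc| |exact: ltW].
by move=> x _; exact: normc_ge0.
Qed.

Lemma inLPhiD f g : inLPhi f -> inLPhi g -> inLPhi (fun x => f x + g x).
Proof.
move=> /inLPhiP[mf [k k0 fk]] /inLPhiP[mg [l l0 gl]]; apply/inLPhiP.
split; first exact: cmeasD.
exists (k + l); first exact: addr_gt0.
have mf' := cmeas_normc mf; have mg' := cmeas_normc mg.
apply: modular_le (modularD mf' mg' k0 l0 fk gl).
- by apply: cmeas_normc; exact: cmeasD.
- exact: measurable_funD.
- move=> x _ /=; apply/andP; split.
    by apply: divr_ge0; [exact: normc_ge0|rewrite addr_ge0// ltW].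
  by rewrite ler_wpM2r ?normcD// invr_ge0 addr_ge0 ?ltW.
Qed.

Lemma gaugeD f g : inLPhi f -> inLPhi g ->
  gauge (fun x => f x + g x) <= gauge f + gauge g.
Proof.
move=> fL gL; have := inLPhiD fL gL; have [mf _] := fL; have [mg _] := gL.
move=> [mfg _].
apply/ler_addgt0Pr => e e0.
have e2 : 0 < e / 2 by exact: divr_gt0.
have [k0 fk] := gauge_lt fL (ltr_pwDr e2 (lexx (gauge f))).
have [l0 gl] := gauge_lt gL (ltr_pwDr e2 (lexx (gauge g))).
have mf' := cmeas_normc mf; have mg' := cmeas_normc mg.
have -> : gauge f + gauge g + e = (gauge f + e / 2) + (gauge g + e / 2) by field.
apply: gauge_le; first exact: addr_gt0.
apply: modular_le (modularD mf' mg' k0 l0 fk gl).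
- exact: cmeas_normc.
- exact: measurable_funD.
- move=> x _ /=; apply/andP; split.
    by apply: divr_ge0; [exact: normc_ge0|rewrite addr_ge0// ltW].
  by rewrite ler_wpM2r ?normcD// invr_ge0 addr_ge0 ?ltW.
Qed.

Lemma inLPhi_le f g c : 0 <= c -> cmeas f -> inLPhi g ->
  (forall x, D x -> normc (f x) <= c * normc (g x)) ->
  inLPhi f /\ gauge f <= c * gauge g.
Proof.
move=> c0 mf gL fg; have [mg _] := gL.
have mf' := cmeas_normc mf; have mg' := cmeas_normc mg.
have H k e : 0 < k -> 0 < e -> modular (normc \o g) k -> modular (normc \o f) (c * k + e).
  move=> k0 e0; have ck : 0 < c * k + e by rewrite ltr_wpDl// mulr_ge0// ltW.
  apply: modular_le => // x Dx /=; apply/andP; split.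
    by apply: divr_ge0; [exact: normc_ge0|exact: ltW].
  rewrite ler_pdivrMr// mulrAC ler_pdivlMr//.
  apply: (@le_trans _ _ (c * normc (g x) * k)); first by rewrite ler_wpM2r ?fg ?ltW.
  by rewrite mulrDr; have := normc_ge0 (g x); nra.
split.
  move/inLPhiP : gL => [_ [k k0 gk]]; apply/inLPhiP; split => //.
  exists (c * k + 1); first by rewrite ltr_wpDl// mulr_ge0// ltW.
  exact: H.
apply/ler_addgt0Pr => e e0.
have e2 : 0 < e / (c + 1) by apply: divr_gt0 => //; lra.
have [k0 gk] := gauge_lt gL (ltr_pwDr e2 (lexx (gauge g))).
have -> : c * gauge g + e = c * (gauge g + e / (c + 1)) + e / (c + 1).
  by field; rewrite gt_eqF//; lra.
apply: gauge_le; last exact: H.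
by rewrite ltr_wpDl// mulr_ge0// ltW.
Qed.

Lemma inLPhiZ a f : inLPhi f ->
  inLPhi (fun x => a * f x) /\ gauge (fun x => a * f x) <= normc a * gauge f.
Proof.
move=> fL; apply: inLPhi_le => //; first exact: normc_ge0.
- by apply: cmeasZ; case: fL.
- by move=> x _; rewrite Normc.normcM.
Qed.

Lemma inLPhiB f g : inLPhi f -> inLPhi g -> inLPhi (fun x => f x - g x).
Proof.
move=> fL /(inLPhiZ (-1))[gL _]; have := inLPhiD fL gL.
by congr inLPhi; apply/funext => x; rewrite mulN1r.
Qed.

Lemma gaugeB f g : inLPhi f -> inLPhi g ->
  gauge (fun x => f x - g x) <= gauge f + gauge g.
Proof.
move=> fL gL; have [ngL ng] := inLPhiZ (-1) gL.
have -> : (fun x => f x - g x) = (fun x => f x + (-1) * g x).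
  by apply/funext => x; rewrite mulN1r.
apply: (le_trans (gaugeD fL ngL)); rewrite lerD2l.
by move: ng; rewrite normcN Normc.normc1 mul1r.
Qed.

Lemma gauge_eq (f g : X -> R[i]) : (forall x, D x -> f x = g x) -> gauge f = gauge g.
Proof.
move=> fg; have e k : modular (normc \o f) k = modular (normc \o g) k.
  rewrite /modular; suff -> : (\int[mu]_(x in D) (Phi ((normc \o f) x / k))%:E =
      \int[mu]_(x in D) (Phi ((normc \o g) x / k))%:E)%E by [].
  by apply: eq_integral => x /set_mem /fg /= ->.
by rewrite /gauge; under eq_fun do rewrite e.
Qed.

Lemma gaugeBC f g : gauge (fun x => f x - g x) = gauge (fun x => g x - f x).
Proof.
rewrite /gauge; congr inf; congr mkset; apply/funext => k; congr (_ /\ modular _ _).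
by apply/funext => x /=; rewrite normcB_sym.
Qed.

Lemma gauge_triangle f g h : inLPhi f -> inLPhi g -> inLPhi h ->
  gauge (fun x => f x - h x) <=
  gauge (fun x => f x - g x) + gauge (fun x => g x - h x).
Proof.
move=> fL gL hL; have := gaugeD (inLPhiB fL gL) (inLPhiB gL hL).
by under [fun x => f x - g x + _]eq_fun do rewrite addrA subrK.
Qed.

(** A Chebyshev estimate: take [A] with [Phi >= 1 / e] from [A] on. The gauge is below [c / A], so
    the integral of [Phi (A |f| / c)] is at most [1], and the set where [|f| >= c] has measure at
    most [e]. The set where [f] is nonzero is the union of these sets for [c = 1 / (n + 1)]. *)
Lemma gauge_eq0 f : inLPhi f -> gauge f <= 0 ->
  mu.-negligible [set x | D x /\ f x <> 0].
Proof.
move=> fL f0; have [mf _] := fL; have mn := cmeas_normc mf.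
have H c : 0 < c -> mu (D `&` [set x | c <= normc (f x)]) = 0%E.
  move=> c0.
  have mA : measurable (D `&` [set x | c <= normc (f x)]).
    by have := mn mD _ (measurable_itv `[c, +oo[); congr measurable;
      congr (_ `&` _); apply/seteqP; split => x /=; rewrite in_itv/= andbT.
  apply/eqP; rewrite eq_le measure_ge0 andbT.
  apply/lee_addgt0Pr => e e0; rewrite add0e.
  have [A A0 hA] := Phi_large hPhi e^-1.
  have [|k0 fk] := @gauge_lt f (c / A) fL.
    by apply: (le_lt_trans f0); exact: divr_gt0.
  have : ((e^-1)%:E * mu (D `&` [set x | (c <= normc (f x))%R]) <= 1)%E.
    rewrite -integral_cst//.
    apply: (@le_trans _ _ (\int[mu]_(x in D `&` [set x | (c <= normc (f x))%R])
        (Phi ((normc \o f) x / (c / A)))%:E)%E).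
      apply: ge0_le_integral => //.
      - by move=> x Dx; rewrite lee_fin invr_ge0 ltW.
      - by apply: (measurable_funS mD _ (modular_measurable _ mn)) => x [].
      - move=> x [Dx /= cx]; rewrite lee_fin; apply: hA.
        rewrite invf_div mulrA ler_pdivlMr//; nra.
    apply: le_trans fk; apply: ge0_subset_integral => //.
    - exact: modular_measurable.
    - by move=> x Dx; rewrite lee_fin Phi_ge0.
  by rewrite muleC lee_pdivrMr// mul1e.
pose F n := D `&` [set x | n.+1%:R^-1 <= normc (f x)].
have F0 n : mu.-negligible (F n).
  apply/negligibleP; last by apply: H; rewrite invr_gt0.
  have := mn mD _ (measurable_itv `[n.+1%:R^-1, +oo[); congr measurable.
  by congr (_ `&` _); apply/seteqP; split => x /=; rewrite in_itv/= andbT.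
apply: negligibleS (negligible_bigcup F0) => x [Dx fx0].
have nf0 : 0 < normc (f x).
  rewrite lt_neqAle normc_ge0 andbT eq_sym; apply/eqP.
  by move=> /Normc.eq0_normc.
have := ltr_add_invr nf0 => -[n]; rewrite add0r => hn.
by exists n => //; split => //=; exact: ltW.
Qed.

End Gauge.

(** * Completeness of the gauge norm *)

Section GaugeComplete.
Variables (R : realType) (Phi : R -> R).
Hypothesis hPhi : N_function Phi.
Context d (X : measurableType d) (mu : {measure set X -> \bar R}) (D : set X).
Hypothesis mD : measurable D.
Local Notation normc := (@Normc.normc R).
Local Notation cre := (@complex.Re R).
Local Notation cim := (@complex.Im R).
Local Notation hp n := ((2^-1 : R) ^+ n).

Let hp_gt0 n : 0 < hp n. Proof. by rewrite exprn_gt0// invr_gt0. Qed.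

(** The bounds [2 ^- i] for [i >= n] have total [2 * 2 ^- n], and the recursion closes exactly:
    [hp n + 2 * hp n.+1 = 2 * hp n]. One constant serves for every length [p]. *)
Lemma modular_sum (v : nat -> X -> R) n p :
  (forall i, measurable_fun D (v i)) ->
  (forall i, modular Phi mu D (v i) (hp i)) ->
  modular Phi mu D (fun x => \sum_(i < p) v (n + i)%N x) (2 * hp n).
Proof.
move=> mv vi; elim: p n => [|p IH] n.
  rewrite /modular; under eq_integral do rewrite big_ord0 mul0r (Phi0 hPhi).
  by rewrite integral0.
under [fun x => _]eq_fun do rewrite big_ord_recl addn0.
have -> : 2 * hp n = hp n + 2 * hp n.+1 by rewrite exprS; field.
apply: modularD => //.
- apply: measurable_sum => i; exact: mv.
- have := IH n.+1; congr modular; apply/funext => x.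
  by apply: eq_bigr => i _; rewrite addnS.
Qed.

Lemma cvg_abs_dominated (u v : nat -> R) M : (forall n, `|u n.+1 - u n| <= v n) ->
  (forall p, \sum_(i < p) v i <= M) -> cvgn u.
Proof.
move=> uv vM.
have cv : cvgn (series v).
  apply: nondecreasing_is_cvgn.
    apply/nondecreasing_seqP => n; rewrite !seriesEord /= big_ord_recr/= lerDl.
    exact: le_trans (uv n).
  by exists M => _ [n _ <-]; rewrite seriesEord; exact: vM.
have : cvgn (series (fun n => u n.+1 - u n)).
  apply: (@normed_cvg R R^o); apply: series_le_cvg cv => //= n.
  exact: le_trans (uv n).
have -> : series (fun n => u n.+1 - u n) = (fun n => u n - u 0%N).
  exact: telescopeK.
move=> cu.
have -> : u = (fun n => (u n - u 0%N) + u 0%N) by apply/funext => n; rewrite subrK.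
by apply: is_cvgD => //; exact: is_cvg_cst.
Qed.

Lemma normc_telescope (z : nat -> R[i]) n m :
  normc (z (n + m)%N - z n) <= \sum_(i < m) normc (z (n + i).+1 - z (n + i)%N).
Proof.
elim: m => [|m IH]; first by rewrite addn0 subrr big_ord0 Normc.normc0.
rewrite big_ord_recr/= addnS.
have -> : z (n + m).+1 - z n = (z (n + m)%N - z n) + (z (n + m).+1 - z (n + m)%N).
  by ring.
by apply: (le_trans (normcD _ _)); rewrite lerD2r.
Qed.

Lemma normc_cvg (z : nat -> R[i]) (w : R[i]) :
  (cre (z n) @[n --> \oo] --> cre w) -> (cim (z n) @[n --> \oo] --> cim w) ->
  normc (z n) @[n --> \oo] --> normc w.
Proof.
move=> cr ci; under eq_fun do rewrite normc_def2; rewrite normc_def2.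
apply: continuous_cvg; first exact: sqrt_continuous.
by apply: cvgD; apply: cvgM.
Qed.

(* The limit is only taken where the partial sums of the increments stay
   bounded; monotone convergence shows that this is a set of full measure. *)
Lemma gauge_complete (h : nat -> X -> R[i]) :
  (forall n, cmeas D (h n)) ->
  (forall n, modular Phi mu D (fun x => normc (h n.+1 x - h n x)) (hp n)) ->
  exists2 g, cmeas D g &
    forall n, modular Phi mu D (fun x => normc (g x - h n x)) (2 * hp n).
Proof.
move=> mh hh.
pose v n x := normc (h n.+1 x - h n x).
have mv n : measurable_fun D (v n) by apply: cmeas_normc; exact: cmeasB.
pose S p x := \sum_(i < p) v i x.
have mS p : measurable_fun D (S p) by exact: measurable_sum.
(* The divisor [2] is [2 * hp 0] in [modular_sum]: every [G p] has integral at most [1], and so has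
   the increasing limit [F]. *)
pose G p x := (Phi (S p x / 2))%:E.
have mG p : measurable_fun D (G p) by exact: modular_measurable.
have G0 p x : D x -> (0%:E <= G p x)%E by rewrite lee_fin (Phi_ge0 hPhi).
have S0 p x : 0 <= S p x by apply: sumr_ge0 => i _; exact: normc_ge0.
have Gnd x : D x -> {homo G^~ x : n m / (n <= m)%N >-> (n <= m)%E}.
  move=> _; apply/nondecreasing_seqP => n; rewrite lee_fin (Phi_mono hPhi)//.
    by rewrite divr_ge0.
  by rewrite ler_wpM2r// /S big_ord_recr/= lerDl normc_ge0.
have GS p : (\int[mu]_(x in D) G p x <= 1)%E.
  by have := @modular_sum v 0%N p mv hh; rewrite expr0 mulr1.
pose F x := limn (G^~ x).
have cG x : D x -> cvgn (G^~ x) by move=> Dx; apply: ereal_nondecreasing_is_cvgn; exact: Gnd.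
have mF : measurable_fun D F.
  by apply: (emeasurable_fun_cvg G) => // x Dx; exact: cG.
have F0 x : D x -> (0 <= F x)%E.
  by move=> Dx; apply: lime_ge; [exact: cG|apply: nearW => n; exact: G0].
have IF : (\int[mu]_(x in D) F x <= 1)%E.
  rewrite monotone_convergence//; apply: lime_le; last by apply: nearW => n; exact: GS.
  apply: ereal_nondecreasing_is_cvgn => m n mn; apply: ge0_le_integral => //.
  - by move=> x; exact: G0.
  - by move=> x Dx; exact: Gnd.
have iF : mu.-integrable D F.
  apply/integrableP; split => //; apply: le_lt_trans (ltry 1); apply: le_trans IF.
  apply: ge0_le_integral => //; first exact: measurableT_comp.
  by move=> x Dx; rewrite gee0_abs// F0.
pose A := D `&` [set x | (F x < +oo)%E].
have mA : measurable A.
  exact: emeasurable_fun_infty_o.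
have AD : A `<=` D by move=> x [].
pose N := D `\` A.
have mN : measurable N by exact: measurableD.
have N0 : mu N = 0%E.
  apply: measure_negligible => //; apply: negligibleS (integrable_ae mD iF) => x [Dx nA] /=.
  by move=> /(_ Dx) Fx; apply: nA; split => //=; rewrite ltey_eq Fx.
have SA x : A x -> exists M, forall p, S p x <= M.
  move=> [Dx /= Fx].
  have Ffin : F x \is a fin_num by rewrite ge0_fin_numE// F0.
  have [B B0 hB] := Phi_large hPhi (fine (F x) + 1).
  exists (B * 2) => p; rewrite -ler_pdivrMr// leNgt; apply/negP => /ltW /hB.
  have : (G p x <= F x)%E.
    rewrite /F (cvg_lim _ (ereal_nondecreasing_cvgn (Gnd x Dx))) //.
    by apply: ereal_sup_ubound; exists p.
  rewrite -(fineK Ffin) lee_fin; lra.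
have cr x : A x -> cvgn (fun n => cre (h n x)).
  move=> /SA[M SM]; apply: (@cvg_abs_dominated _ (v^~ x) M) => // n.
  by rewrite -creN -creD; exact: cre_le_normc.
have ci x : A x -> cvgn (fun n => cim (h n x)).
  move=> /SA[M SM]; apply: (@cvg_abs_dominated _ (v^~ x) M) => // n.
  by rewrite -cimN -cimD; exact: cim_le_normc.
pose g x : R[i] := if x \in A then
  Complex (limn (fun n => cre (h n x))) (limn (fun n => cim (h n x))) else 0.
have mrestr (f : X -> R) : measurable_fun D f -> measurable_fun D (f \_ A).
  move=> mf; apply/(measurable_restrict _ mA mD).
  by apply: (measurable_funS mD _ mf) => x [].
have mg : cmeas D g.
  split.
    apply: (measurable_fun_cvg (h := fun n => (cre \o h n) \_ A)).
      by move=> n; apply: mrestr; have [] := mh n.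
    move=> x Dx; rewrite /g /patch /=; case: ifPn => [/set_mem Ax|_]; last exact: cvg_cst.
    exact: cr.
  apply: (measurable_fun_cvg (h := fun n => (cim \o h n) \_ A)).
    by move=> n; apply: mrestr; have [] := mh n.
  move=> x Dx; rewrite /g /patch /=; case: ifPn => [/set_mem Ax|_]; last exact: cvg_cst.
  exact: ci.
exists g => // n; rewrite /modular.
have mgn m : measurable_fun D (fun x => (Phi (normc (h (n + m)%N x - h n x) / (2 * hp n)))%:E).
  by apply: modular_measurable => //; apply: cmeas_normc; exact: cmeasB.
have mgg : measurable_fun D (fun x => (Phi (normc (g x - h n x) / (2 * hp n)))%:E).
  by apply: modular_measurable => //; apply: cmeas_normc; exact: cmeasB.
rewrite (ge0_negligible_integral mN mD mgg _ N0); last first.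
  by move=> x _; rewrite lee_fin (Phi_ge0 hPhi).
have -> : D `\` N = A by rewrite /N setDD setIidr.
(* On [A] the integrand is the limit of those with [h (n + m)] in place of [g]. Fatou's lemma then
   bounds its integral by the lower limit of integrals that telescoping and [modular_sum] keep below
   [1]. *)
have -> : (\int[mu]_(x in A) (Phi (normc (g x - h n x) / (2 * hp n)))%:E =
  \int[mu]_(x in A) limn_einf (fun m => (Phi (normc (h (n + m)%N x - h n x) / (2 * hp n)))%:E))%E.
  apply: eq_integral => x /set_mem Ax; apply/esym.
  apply: (cvg_limn_einf_sup _).1; apply: cvg_EFin; first exact: nearW.
  apply: continuous_cvg; first exact: Phi_continuous.
  apply: cvgMl; apply: normc_cvg.
    under eq_fun do rewrite creD; rewrite creD; apply: cvgD; last exact: cvg_cst.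
    rewrite /g mem_set//=; under eq_fun do rewrite addnC.
    have cx : (fun k => cre (h k x)) @ \oo --> limn (fun k => cre (h k x)) by exact: cr.
    by rewrite -(cvg_shiftn n) in cx.
  under eq_fun do rewrite cimD; rewrite cimD; apply: cvgD; last exact: cvg_cst.
  rewrite /g mem_set//=; under eq_fun do rewrite addnC.
  have cx : (fun k => cim (h k x)) @ \oo --> limn (fun k => cim (h k x)) by exact: ci.
    by rewrite -(cvg_shiftn n) in cx.
apply: le_trans (fatou _ mA _ _) _.
- by move=> m; apply: measurable_funS (mgn m).
- by move=> m x _; rewrite lee_fin (Phi_ge0 hPhi).
have Hm m : (\int[mu]_(x in A) (Phi (normc (h (n + m)%N x - h n x) / (2 * hp n)))%:E <= 1)%E.
  apply: (@le_trans _ _ (\int[mu]_(x in D) (Phi (normc (h (n + m)%N x - h n x) / (2 * hp n)))%:E)%E).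
    by apply: ge0_subset_integral => // x _; rewrite lee_fin (Phi_ge0 hPhi).
  apply: (modular_le hPhi mD _ _ _ (modular_sum n m mv hh)) => //.
  - by apply: cmeas_normc; exact: cmeasB.
  - by apply: measurable_sum.
  - move=> x _; apply/andP; split.
      by apply: divr_ge0; [exact: normc_ge0|rewrite mulr_ge0// ltW].
    rewrite ler_wpM2r ?invr_ge0 ?mulr_ge0 ?(ltW (hp_gt0 _))//.
    exact: (@normc_telescope (h ^~ x)).
rewrite limn_einf_lim; apply: lime_le; first exact: is_cvg_einfs.
apply: nearW => m; apply: le_trans (Hm m); apply: ereal_inf_lbound.
by exists m => /=.
Qed.

End GaugeComplete.

(** * Convolution *)

(** Sigma-finiteness of Haar measures is a proposition proved at units only, so the structure that
    Tonelli's theorem expects is built on the spot from the hypothesis. *)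
Lemma sigma_finite_tonelli d (X : measurableType d) (R : realType)
    (mu : {measure set X -> \bar R}) (f : X * X -> \bar R) :
  sigma_finite setT mu -> measurable_fun setT f -> (forall x, 0 <= f x)%E ->
  (\int[mu]_x \int[mu]_y f (x, y) = \int[mu]_y \int[mu]_x f (x, y))%E.
Proof.
move=> sf mf f0.
pose H1 := @isSigmaFinite.Build _ _ _ mu sf.
pose H2 := @isSFinite.Build _ _ _ mu (sfinite_measure_sigma_finite sf).
pose mu' : {sigma_finite_measure set X -> \bar R} := HB.pack (Measure.sort mu) H1 H2.
exact: (@fubini_tonelli _ _ _ _ _ mu' mu' f mf f0).
Qed.

(* Makes [T * T] a [ptopologicalType]. *)
HB.saturate prod.

Section ProductTopology.
Variable T : ptopologicalType.

Lemma locally_compact_prod : locally_compact_space T -> locally_compact_space (T * T)%type.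
Proof.
move=> lcT [x y]; have [K cK xK] := lcT x; have [L cL yL] := lcT y.
exists (K `*` L); first exact: compact_setX.
by exists (K, L).
Qed.

Lemma hausdorff_prod : hausdorff_space T -> hausdorff_space (T * T)%type.
Proof.
move=> hT [x y] [x' y'] cl; congr pair.
  apply: hT => U V Ux Vx.
  have [||p [[p1 _] [p2 _]]] := cl (U `*` setT) (V `*` setT); last by exists p.1.
  - by exists (U, setT) => //; split => //; exact: filterT.
  - by exists (V, setT) => //; split => //; exact: filterT.
apply: hT => U V Ux Vx.
have [||p [[_ p1] [_ p2]]] := cl (setT `*` U) (setT `*` V); last by exists p.2.
- by exists (setT, U) => //; split => //; exact: filterT.
- by exists (setT, V) => //; split => //; exact: filterT.
Qed.

End ProductTopology.

Section Convolution.
Variables (R : realType) (T : ptopologicalType).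
Variables (comp : T -> T -> Prop) (mul : T -> T -> T) (inv : T -> T).
Variable (lam : T -> {measure set (Borel T) -> \bar R}).
Hypothesis scT : @second_countable T.
Hypothesis lcT : locally_compact_space T.
Hypothesis hT : hausdorff_space T.
Hypothesis hG : is_topological_groupoid comp mul inv.
Hypothesis hL : left_haar_system mul inv lam.
Local Notation r := (gr mul inv).
Local Notation d := (gd mul inv).
Local Notation GO := (G0 mul inv).
Local Notation Gf := (Gu mul inv).
Local Notation Ig u k := (Rintegral (lam u) (Gf u) k).
Local Notation CcOn := (CcOn mul inv).

Let hgr : is_groupoid comp mul inv := proj1 hG.
Let mGf u : @measurable _ (Borel T) (Gf u) := Gu_measurable hT hG u.
Let iCcOn u k : GO u -> CcOn u k -> (lam u).-integrable (Gf u) (EFin \o k) :=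
  @CcOn_integrable R T comp mul inv lam hT hG hL u k.

Lemma haar_sigma_finite u : GO u -> sigma_finite setT (lam u).
Proof.
move=> uO; have [B cB [Bo Bn]] := scT.
pose D := B `&` [set V | exists2 K, compact K & V `<=` K].
have cD : countable D.
  by apply: (@sub_countable _ _ _ B) => //; apply: subset_card_le => ? [].
have covD : setT = \bigcup_(V in D) V.
  apply/seteqP; split => // x _; have [K cK xK] := lcT x.
  by have [V [BV Vx] VK] := Bn x _ xK; exists V => //; split => //; exists K.
move/pfcard_geP : cD => [D0|[f]].
  by move: covD; rewrite D0 bigcup_set0 => /seteqP[/(_ point I)].
exists f; last first.
  move=> i; have [/Bo oV [K cK VK]] : D (f i) by exact: funS.
  split; first exact: open_Borel.
  have [/(_ u uO K cK) K1 _ _ _] := hL; apply: le_lt_trans K1.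
  by apply: le_measure; rewrite ?inE//; [exact: open_Borel|exact: compact_Borel].
rewrite [LHS]covD; apply/seteqP; split => [x [V DV Vx]|x [i _ fx]].
  by have [n _ fn] := 'surj_f DV; exists n; rewrite ?fn.
by exists (f i) => //; exact: funS.
Qed.

Lemma Ig_comb u (a b : R) (k l : T -> R) : GO u -> CcOn u k -> CcOn u l ->
  Ig u (fun y => a * k y + b * l y) = a * Ig u k + b * Ig u l.
Proof.
move=> uO ck cl.
have iZ c m : CcOn u m -> (lam u).-integrable (Gf u) (EFin \o (fun y => c * m y)).
  move=> cm; have := integrableZl (mGf u) c (iCcOn uO cm).
  by congr (_.-integrable _ _); apply/funext => y /=; rewrite EFinM.
rewrite RintegralD//; [|exact: iZ|exact: iZ].
by rewrite !RintegralZl//; exact: iCcOn.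
Qed.

Lemma Ig_le u (k l : T -> R) : GO u -> CcOn u k -> CcOn u l ->
  (forall y, Gf u y -> k y <= l y) -> Ig u k <= Ig u l.
Proof. by move=> uO ck cl kl; apply: le_Rintegral => //; exact: iCcOn. Qed.

Lemma Ig_EFin u (k : T -> R) : GO u -> CcOn u k ->
  (Ig u k)%:E = (\int[lam u]_(y in Gf u) (k y)%:E)%E.
Proof.
by move=> uO ck; rewrite /Rintegral fineK//; apply: integrable_fin_num => //; exact: iCcOn.
Qed.

Section Kernel.
(* [sigma] is the inversion for convolutions; the identity is also needed, in
   bundles of groups, to prove that Haar measures are invariant under inversion. *)
Variable sigma : T -> T.
Hypothesis csigma : continuous sigma.
Hypothesis gd_sigma : forall y, d (sigma y) = r y.

Lemma kernel_cvg (S : Type) (F : set_system S) (FF : Filter F) (a b : S -> T)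
    (f g : T -> R) x y : continuous f -> continuous g ->
  r x = r y -> (\forall z \near F, r (a z) = r (b z)) ->
  a @ F --> x -> b @ F --> y ->
  (fun z => f (b z) * g (mul (sigma (b z)) (a z))) @ F --> f y * g (mul (sigma y) x).
Proof.
move=> cf cg xy Fab ax byy; apply: cvgM.
  by apply: continuous_cvg => //; exact: cf.
apply: continuous_cvg; first exact: cg.
apply: (mul_cvg hG) => //.
- by rewrite gd_sigma.
- by apply: filterS Fab => z; rewrite gd_sigma.
- by apply: continuous_cvg => //; exact: csigma.
Qed.

(** Where both factors are nonzero, [y] lies in [K], and [x], the product of [inv (sigma y)] with an
    element of [L], lies in a compact [M]. The kernel is thus continuous and compactly supported on
    the closed set [r x = r y], and extends from there. *)
Lemma kernel_ext (f g : T -> R) : Cc f -> Cc g ->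
  exists2 H : T * T -> R, Cc H &
    forall x y, r x = r y -> H (x, y) = f y * g (mul (sigma y) x).
Proof.
move=> [cf [K cK fK]] [cg [L cL gL]].
have cK' : compact ((inv \o sigma) @` K).
  apply: continuous_compact => //; apply: continuous_subspaceT => x.
  by apply: continuous_comp; [exact: csigma|exact: (inv_continuous hG)].
have [M cM KLM] := mul_compact hT hG cK' cL.
pose P := [set p : T * T | r p.1 = r p.2].
pose k (p : T * T) := f p.2 * g (mul (sigma p.2) p.1).
have clP : closed P by exact: same_range_closed hG.
have ck : {within P, continuous k}.
  apply/subspace_continuousP => -[x y] /= xy; rewrite /from_subspace /=.
  apply: (@kernel_cvg _ (within P (nbhs (x, y))) _ fst snd) => //.
  - exact: withinT.
  - by apply: cvg_within_filter; exact: cvg_fst.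
  - by apply: cvg_within_filter; exact: cvg_snd.
have k0 p : P p -> ~ (M `*` K) p -> k p = 0.
  move=> Pp nMK; rewrite /k; have [Kp|/fK ->] := pselect (K p.2); last by rewrite mul0r.
  have [Lp|/gL ->] := pselect (L (mul (sigma p.2) p.1)); last by rewrite mulr0.
  exfalso; apply: nMK; split => //=.
  have sp : d (sigma p.2) = r p.1 by rewrite gd_sigma.
  rewrite -[p.1](mulVxy hgr sp); apply: KLM => //; last by exists p.2.
  by rewrite (gr_mul hgr)// (gd_inv hgr).
have [H cH HE] := Cc_extension (locally_compact_prod lcT) (hausdorff_prod hT)
  clP (compact_setX cM cK) ck k0.
by exists H => // x y xy; rewrite HE// inE.
Qed.

Lemma kernel_tonelli u (f g : T -> R) : GO u -> Cc f -> Cc g ->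
  (forall x, 0 <= f x) -> (forall x, 0 <= g x) ->
  (\int[lam u]_(x in Gf u) \int[lam u]_(y in Gf u) (f y * g (mul (sigma y) x))%:E =
   \int[lam u]_(y in Gf u) \int[lam u]_(x in Gf u) (f y * g (mul (sigma y) x))%:E)%E.
Proof.
move=> uO cf cg f0 g0; have [H cH HE] := kernel_ext cf cg.
(* The extension may be negative away from the pairs of equal range, hence the absolute value; on
   these pairs it changes nothing, the kernel being nonnegative. *)
have mH : @measurable_fun _ _ (Borel T * Borel T)%type _ setT (fun p => (`|H p|)%:E).
  by have [cn _] := Cc_norm cH; apply/measurable_EFinP; exact: continuous_Borel2.
have E x y : Gf u x -> Gf u y -> (f y * g (mul (sigma y) x))%:E = (`|H (x, y)|)%:E.
  by move=> ux uy; rewrite HE ?ger0_norm ?mulr_ge0//; rewrite ux uy.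
have := sigma_finite_tonelli (haar_sigma_finite uO) mH (fun p => normr_ge0 (H p)).
rewrite -[X in X = _ -> _](haar_setT scT hT hG hL _ uO).
rewrite -[X in _ = X -> _](haar_setT scT hT hG hL _ uO) => tE.
transitivity (\int[lam u]_(x in Gf u) \int[lam u]_y (`|H (x, y)|)%:E)%E.
  apply: eq_integral => x /set_mem ux; rewrite -(haar_setT scT hT hG hL _ uO).
  by apply: eq_integral => y /set_mem uy; exact: E.
rewrite tE; apply: eq_integral => y /set_mem uy; rewrite -(haar_setT scT hT hG hL _ uO).
by apply: eq_integral => x /set_mem ux; rewrite E.
Qed.

End Kernel.

Lemma Cc_slice1 (H : T * T -> R) x : Cc H -> Cc (fun y => H (x, y)).
Proof.
move=> [cH [K cK HK]]; split.
  move=> y; apply: (@continuous_comp _ _ _ (fun y => (x, y)) H); last exact: cH.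
  by apply: cvg_pair => //; exact: cvg_cst.
exists (snd @` K).
  by apply: continuous_compact => //; apply: continuous_subspaceT => p; exact: cvg_snd.
by move=> y nK; apply: HK => Kxy; apply: nK; exists (x, y).
Qed.

Lemma Cc_slice2 (H : T * T -> R) y : Cc H -> Cc (fun x => H (x, y)).
Proof.
move=> [cH [K cK HK]]; split.
  move=> x; apply: (@continuous_comp _ _ _ (fun x => (x, y)) H); last exact: cH.
  by apply: cvg_pair => //; exact: cvg_cst.
exists (fst @` K).
  by apply: continuous_compact => //; apply: continuous_subspaceT => p; exact: cvg_fst.
by move=> x nK; apply: HK => Kxy; apply: nK; exists (x, y).
Qed.

Definition rconv (f g : T -> R) (x : T) :=
  Ig (r x) (fun y => f y * g (mul (inv y) x)).

Lemma kernel_CcOn (f g : T -> R) x : Cc f -> Cc g ->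
  CcOn (r x) (fun y => f y * g (mul (inv y) x)).
Proof.
move=> cf cg; have [H cH HE] := kernel_ext (inv_continuous hG) (gd_inv hgr) cf cg.
exists (fun y => H (x, y)); first exact: Cc_slice1.
by move=> y yx; rewrite HE//; rewrite yx.
Qed.

(** A bump function equal to [1] at [y] turns the translate into the slice at [y] of an extended
    kernel. *)
Lemma translate_CcOn (g : T -> R) y : Cc g -> CcOn (r y) (fun x => g (mul (inv y) x)).
Proof.
move=> cg.
have [f [cf _ f1 _]] := Cc_bump R lcT hT (@compact_set1 _ y) (@openT T) (@subsetT _ _).
have [H cH HE] := kernel_ext (inv_continuous hG) (gd_inv hgr) cf cg.
exists (fun x => H (x, y)); first exact: Cc_slice2.
by move=> x xy; rewrite HE// f1// mul1r.
Qed.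

(** Both measure and integrand move with [x]. The integral of the fixed slice [H (x0, y)] is
    continuous because the Haar system is; passing to [H (x, y)] costs a uniform distance on the
    compact [L] times the uniform bound [B] of its measure. The extension [H] gives the fixed slice
    a meaning on fibres other than that of [x0]. *)
Lemma rconv_Cc (f g : T -> R) : Cc f -> Cc g -> Cc (rconv f g).
Proof.
move=> cf cg; have [H cH HE] := kernel_ext (inv_continuous hG) (gd_inv hgr) cf cg; split; last first.
  have [_ [K cK fK]] := cf; have [_ [L cL gL]] := cg.
  have [M cM KLM] := mul_compact hT hG cK cL.
  exists M => // x nM; rewrite /rconv.
  rewrite (@eq_Rintegral _ (Borel T) R (lam (r x)) (Gf (r x)) (cst 0)).
    by rewrite /Rintegral integral0.
  move=> y /set_mem yx /=.
  have [Ky|/fK ->] := pselect (K y); last by rewrite mul0r.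
  have [Ly|/gL ->] := pselect (L (mul (inv y) x)); last by rewrite mulr0.
  exfalso; apply: nM; rewrite -(mulxVy hgr yx); apply: KLM => //.
  by rewrite (gr_mul hgr) ?(gr_inv hgr)// (gd_inv hgr).
have convE x : rconv f g x = Rintegral (lam (r x)) setT (fun y => H (x, y)).
  rewrite -(haar_RsetT scT hT hG hL _ (GO_gr mul inv x)).
  by apply: eq_Rintegral => y /set_mem yx; rewrite HE//; rewrite yx.
have [ctH [K cK HK]] := cH.
pose L := snd @` K.
have cL : compact L.
  by apply: continuous_compact => //; apply: continuous_subspaceT => p; exact: cvg_snd.
have [B B0 hB] := haar_compact_bounded scT lcT hT hG hL cL.
move=> x0.
have c1 : (fun x => Rintegral (lam (r x)) setT (fun y => H (x0, y))) @ x0 -->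
          Rintegral (lam (r x0)) setT (fun y => H (x0, y)).
  have [_ _ /(_ _ (Cc_slice1 x0 cH)) /subspace_continuousP cI _] := hL.
  have {}cI := cI (r x0) (GO_gr mul inv x0).
  move=> W /cI; rewrite /from_subspace => W1.
  have {}W1 : nbhs (r x0) (fun u => GO u -> W (Rintegral (lam u) setT (fun y => H (x0, y)))) := W1.
  have {}W1 : nbhs x0 (fun x => GO (r x) -> W (Rintegral (lam (r x)) setT (fun y => H (x0, y)))).
    exact: (gr_continuous hG W1).
  have W2 : nbhs x0 (fun x => W (Rintegral (lam (r x)) setT (fun y => H (x0, y)))).
    by apply: filterS W1 => x; apply; exact: GO_gr.
  exact: W2.
apply/cvgrPdist_le => e e0.
have e1 : 0 < e / 2 by exact: divr_gt0.
have e2 : 0 < e / 2 / B by exact: divr_gt0.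
move/cvgrPdist_le : c1 => /(_ _ e1) c1.
have c2 : \forall x \near x0, L `<=` (fun y => `|H (x0, y) - H (x, y)| <= e / 2 / B).
  move/compact_near_coveringP : cL; apply => y Ly.
  have e3 : 0 < e / 2 / B / 2 by exact: divr_gt0.
  have h1 := ctH (x0, y); move/cvgrPdist_le : h1 => /(_ _ e3)[[U V] /= [Ux Vy] UV].
  exists (V, U) => //= -[y' x'] /= [Vy' Ux'].
  have h2 := UV (x', y') (conj Ux' Vy').
  have h3 := UV (x0, y') (conj (nbhs_singleton Ux) Vy').
  rewrite /= in h2 h3.
  have -> : H (x0, y') - H (x', y') = (H (x0, y) - H (x', y')) - (H (x0, y) - H (x0, y')) by lra.
  by apply: (le_trans (ler_normB _ _)); lra.
near=> x.
have xO := GO_gr mul inv x.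
have h1 : `|rconv f g x0 - Rintegral (lam (r x)) setT (fun y => H (x0, y))| <= e / 2.
  by rewrite convE; near: x.
have h2 : `|Rintegral (lam (r x)) setT (fun y => H (x0, y)) - rconv f g x| <= e / 2.
  rewrite convE.
  have i0 := Cc_integrable hT hL measurableT xO (Cc_slice1 x0 cH).
  have i1 := Cc_integrable hT hL measurableT xO (Cc_slice1 x cH).
  have cd := CcB (Cc_slice1 x0 cH) (Cc_slice1 x cH).
  have id := Cc_integrable hT hL measurableT xO cd.
  rewrite -RintegralB//; apply: (le_trans (le_normr_Rintegral _ _)) => //.
  rewrite -lee_fin /Rintegral fineK; last first.
    apply: integrable_fin_num => //.
    exact: (Cc_integrable hT hL measurableT xO (Cc_norm cd)).
  have mL := compact_Borel hT cL.
  apply: (@le_trans _ _ (\int[lam (r x)]_(y in L) (e / 2 / B)%:E)%E).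
    rewrite [leRHS]integral_mkcond; apply: ge0_le_integral => //.
    - have [cn _] := Cc_norm cd.
      by apply/measurable_EFinP; exact: continuous_Borel.
    - by apply/(measurable_restrictT _ mL); exact: measurable_cst.
    - move=> y _; rewrite /patch; case: ifPn => [/set_mem Ly|/negP nLy].
        by rewrite lee_fin; move: y Ly; near: x.
      have nK z : ~ K (z, y) by move=> Kz; apply: nLy; rewrite inE; exists (z, y).
      by rewrite !HK// subrr normr0.
  rewrite integral_cst//.
  apply: (@le_trans _ _ ((e / 2 / B)%:E * B%:E)%E).
    by apply: lee_wpmul2l; [rewrite lee_fin ltW|exact: hB].
  by rewrite -EFinM divfK// gt_eqF.
have -> : rconv f g x0 - rconv f g x =
  (rconv f g x0 - Rintegral (lam (r x)) setT (fun y => H (x0, y))) +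
  (Rintegral (lam (r x)) setT (fun y => H (x0, y)) - rconv f g x) by lra.
by apply: (le_trans (ler_normD _ _)); lra.
Unshelve. all: by end_near. Qed.

End Convolution.

(** * Norm estimate and bilinearity of the convolution *)

Section ConvolutionBound.
Variables (R : realType) (T : ptopologicalType).
Variables (comp : T -> T -> Prop) (mul : T -> T -> T) (inv : T -> T).
Variable (lam : T -> {measure set (Borel T) -> \bar R}).
Variable Phi : R -> R.
Hypothesis scT : @second_countable T.
Hypothesis lcT : locally_compact_space T.
Hypothesis hT : hausdorff_space T.
Hypothesis hG : is_topological_groupoid comp mul inv.
Hypothesis hL : left_haar_system mul inv lam.
Hypothesis hPhi : N_function Phi.
Local Notation r := (gr mul inv).
Local Notation d := (gd mul inv).
Local Notation GO := (G0 mul inv).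
Local Notation Gf := (Gu mul inv).
Local Notation Ig u k := (Rintegral (lam u) (Gf u) k).
Local Notation CcOn := (CcOn mul inv).
Local Notation rconv := (rconv mul inv lam).
Local Notation normc := (@Normc.normc R).
Local Notation cre := (@complex.Re R).
Local Notation cim := (@complex.Im R).
Local Notation gconv := (gconv mul inv lam).

Let hgr : is_groupoid comp mul inv := proj1 hG.
Let mGf u : @measurable _ (Borel T) (Gf u) := Gu_measurable hT hG u.
Let IgE u k := @Ig_EFin R T comp mul inv lam hT hG hL u k.
Let Igle u k l := @Ig_le R T comp mul inv lam hT hG hL u k l.
Let IgD u a b k l := @Ig_comb R T comp mul inv lam hT hG hL u a b k l.

Lemma eq_Ig u (k l : T -> R) : (forall y, Gf u y -> k y = l y) -> Ig u k = Ig u l.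
Proof. by move=> kl; apply: eq_Rintegral => y /set_mem /kl. Qed.

Lemma CcOn_comb u a b k l : CcOn u k -> CcOn u l ->
  CcOn u (fun y : T => a * k y + b * l y : R).
Proof.
apply: (CcOn_comp2 (phi := fun x y => a * x + b * y)); last by rewrite !mulr0 addr0.
by move=> p; apply: cvgD; apply: cvgMr; [exact: cvg_fst|exact: cvg_snd].
Qed.

Lemma translate_Ig (g : T -> R) y : Cc g ->
  Ig (r y) (fun x => g (mul (inv y) x)) = Ig (d y) g.
Proof.
move=> cg; rewrite -(haar_invariant scT hT hG hL (translate_CcOn lcT hT hG y cg)).
by apply: eq_Ig => z yz; rewrite (mulVxy hgr)//.
Qed.

(** The supporting line of [Phi] at [m] is integrated against the weight [p]. The mass of [p] may
    fall short of [1]; the defect has the right sign because at [0] the line lies below [Phi 0 = 0],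
    that is, [Phi m - s * m <= 0]. *)
Lemma jensen_Ig u (p q pq pPq : T -> R) : GO u ->
  CcOn u p -> CcOn u pq -> CcOn u pPq ->
  (forall y, Gf u y -> 0 <= p y) -> Ig u p <= 1 ->
  (forall y, Gf u y -> pq y = p y * q y) ->
  (forall y, Gf u y -> pPq y = p y * Phi (q y)) ->
  Phi (Ig u pq) <= Ig u pPq.
Proof.
move=> uO cp cpq cpP p0 p1 pqE pPqE.
set m := Ig u pq.
have [s sP] := Phi_subgradient hPhi m.
have H0 : Phi m <= s * m by have := sP 0; rewrite (Phi0 hPhi); lra.
have H1 : (Phi m - s * m) * Ig u p + s * m <= Ig u pPq.
  rewrite -IgD//; apply: Igle => //; first exact: CcOn_comb.
  move=> y uy; rewrite pqE// pPqE//.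
  have := sP (q y); have := p0 y uy; move: (p y) (q y) (Phi (q y)) => P Q PQ.
  nra.
by apply: le_trans H1; nra.
Qed.

(** Divided by [a], the weight [f] has mass at most [1], so Jensen bounds the integrand by the
    convolution of [p] with [G]. In the swapped integral, translation by [inv y] carries the fibre
    over [u] to the fibre over [d y], which is why the bound on [g] is required at all units. *)
Lemma rconv_modular (f g : T -> R) u a b : GO u -> Cc f -> Cc g ->
  (forall x, 0 <= f x) -> (forall x, 0 <= g x) -> 0 < a -> 0 < b ->
  Ig u f <= a -> (forall v, GO v -> modular Phi (lam v) (Gf v) g b) ->
  modular Phi (lam u) (Gf u) (rconv f g) (a * b).
Proof.
move=> uO cf cg f0 g0 a0 b0 fa gb.
pose p x := a^-1 * f x.
pose G x := Phi (g x / b).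
have cp : Cc p by exact: CcZ.
have cG : Cc G.
  apply: (Cc_comp (phi := fun x => Phi (x / b))) cg.
    move=> x; have cx : {for x, continuous (fun y : R => y / b)}.
      by apply: cvgMl; exact: cvg_id.
    exact: (@continuous_comp R R R (fun y => y / b) Phi x cx (@Phi_continuous R Phi hPhi _)).
  by rewrite mul0r (Phi0 hPhi).
have p0 x : 0 <= p x by rewrite mulr_ge0// invr_ge0 ltW.
have G0 x : 0 <= G x by exact: Phi_ge0.
have p1 : Ig u p <= 1.
  have -> : Ig u p = a^-1 * Ig u f.
    have := @IgD u a^-1 0 f f uO (Cc_CcOn _ _ _ cf) (Cc_CcOn _ _ _ cf).
    rewrite mul0r addr0 => <-; apply: eq_Ig => y _.
    by rewrite mul0r addr0.
  by rewrite mulrC ler_pdivrMr// mul1r.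
rewrite /modular; apply: (@le_trans _ _ (\int[lam u]_(x in Gf u) (rconv p G x)%:E)%E).
  have [crc _] := rconv_Cc scT lcT hT hG hL cf cg.
  have [crp _] := rconv_Cc scT lcT hT hG hL cp cG.
  apply: ge0_le_integral => //.
  - by move=> x _; rewrite lee_fin (Phi_ge0 hPhi).
  - by apply: (modular_measurable hPhi); exact: continuous_Borel.
  - by apply/measurable_EFinP; exact: continuous_Borel.
  move=> x ux; rewrite lee_fin.
  have k1 := kernel_CcOn lcT hT hG x cf cg.
  have k2 := kernel_CcOn lcT hT hG x cp cG.
  rewrite /rconv ux in k1 k2 *.
  have -> : Ig u (fun y => f y * g (mul (inv y) x)) / (a * b) =
      Ig u (fun y => (a * b)^-1 * (f y * g (mul (inv y) x)) + 0 * (f y * g (mul (inv y) x))).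
    by rewrite IgD// mul0r addr0 mulrC.
  apply: (@jensen_Ig u p (fun y => g (mul (inv y) x) / b)) => //.
  - exact: Cc_CcOn.
  - exact: CcOn_comb.
  - by move=> y _; rewrite /p; field; rewrite !gt_eqF.
have -> : (\int[lam u]_(x in Gf u) (rconv p G x)%:E =
    \int[lam u]_(x in Gf u) \int[lam u]_(y in Gf u) (p y * G (mul (inv y) x))%:E)%E.
  apply: eq_integral => x /set_mem ux; rewrite /rconv.
  have k2 := kernel_CcOn lcT hT hG x cp cG.
  by rewrite ux in k2 *; rewrite IgE.
rewrite (kernel_tonelli scT lcT hT hG hL (inv_continuous hG) (gd_inv hgr))//.
apply: (@le_trans _ _ (\int[lam u]_(y in Gf u) (p y)%:E)%E); last first.
  by rewrite -IgE// ?lee_fin//; exact: Cc_CcOn.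
have H y : Gf u y -> (\int[lam u]_(x in Gf u) (p y * G (mul (inv y) x))%:E <= (p y)%:E)%E.
  move=> uy; have ct := translate_CcOn lcT hT hG y cG; rewrite uy in ct.
  have -> : (\int[lam u]_(x in Gf u) (p y * G (mul (inv y) x))%:E =
      (p y * Ig u (fun x => G (mul (inv y) x)))%:E)%E.
    rewrite EFinM IgE// -ge0_integralZl_EFin//.
    - by move=> x _; rewrite lee_fin.
    - by apply/measurable_EFinP; exact: CcOn_measurable ct.
  have tE := translate_Ig y cG; rewrite uy in tE; rewrite tE lee_fin ler_piMr//.
  have := gb (d y) (GO_gd hgr y); rewrite /modular -IgE ?lee_fin//; first exact: GO_gd hgr y.
  exact: Cc_CcOn.
apply: nnintegral_le => // y uy; first by apply: integral_ge0 => x _; rewrite lee_fin mulr_ge0.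
Qed.


Lemma rconv_combl a b (f f' g : T -> R) x : Cc f -> Cc f' -> Cc g ->
  rconv (fun y => a * f y + b * f' y) g x = a * rconv f g x + b * rconv f' g x.
Proof.
move=> cf cf' cg; rewrite /rconv -IgD//;
  [|exact: GO_gr|exact: (kernel_CcOn lcT hT hG)|exact: (kernel_CcOn lcT hT hG)].
by apply: eq_Ig => y _; ring.
Qed.

Lemma rconv_combr a b (f g g' : T -> R) x : Cc f -> Cc g -> Cc g' ->
  rconv f (fun y => a * g y + b * g' y) x = a * rconv f g x + b * rconv f g' x.
Proof.
move=> cf cf' cg; rewrite /rconv -IgD//;
  [|exact: GO_gr|exact: (kernel_CcOn lcT hT hG)|exact: (kernel_CcOn lcT hT hG)].
by apply: eq_Ig => y _; ring.
Qed.

Lemma Cc_comb a b (f g : T -> R) : Cc f -> Cc g -> Cc (fun y => a * f y + b * g y).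
Proof. by move=> cf cg; apply: CcD; exact: CcZ. Qed.

Lemma cre_gconv (f g : T -> R[i]) x : CcC f -> CcC g ->
  cre (gconv f g x) = rconv (cre \o f) (cre \o g) x - rconv (cim \o f) (cim \o g) x.
Proof.
move=> [rf cf] [rg cg]; rewrite /= /rconv.
rewrite -[LHS]/(Ig (r x) (fun y => cre (f y * g (mul (inv y) x)))).
rewrite -[X in X - _]mul1r -mulN1r -IgD;
  [|exact: GO_gr|exact: (kernel_CcOn lcT hT hG)|exact: (kernel_CcOn lcT hT hG)].
by apply: eq_Ig => y _; rewrite creM /=; ring.
Qed.

Lemma cim_gconv (f g : T -> R[i]) x : CcC f -> CcC g ->
  cim (gconv f g x) = rconv (cre \o f) (cim \o g) x + rconv (cim \o f) (cre \o g) x.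
Proof.
move=> [rf cf] [rg cg]; rewrite /= /rconv.
rewrite -[LHS]/(Ig (r x) (fun y => cim (f y * g (mul (inv y) x)))).
rewrite -[X in X + _]mul1r -[X in _ + X]mul1r -IgD;
  [|exact: GO_gr|exact: (kernel_CcOn lcT hT hG)|exact: (kernel_CcOn lcT hT hG)].
by apply: eq_Ig => y _; rewrite cimM /=; ring.
Qed.

Lemma gconv_CcC f g : CcC f -> CcC g -> CcC (gconv f g).
Proof.
move=> Cf Cg; have [rf cf] := Cf; have [rg cg] := Cg; split.
  under eq_fun do rewrite cre_gconv//.
  by apply: CcB; exact: (rconv_Cc scT lcT hT hG hL).
under eq_fun do rewrite cim_gconv//.
by apply: CcD; exact: (rconv_Cc scT lcT hT hG hL).
Qed.

Lemma CcC_comb (a : R[i]) f g : CcC f -> CcC g -> CcC (fun x : T => a * f x + g x).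
Proof.
move=> [rf cf] [rg cg]; split.
  under eq_fun do rewrite creD creM.
  by apply: CcD => //; apply: CcB; exact: CcZ.
under eq_fun do rewrite cimD cimM.
by apply: CcD => //; apply: CcD; exact: CcZ.
Qed.

Lemma complex_eq (z w : R[i]) : cre z = cre w -> cim z = cim w -> z = w.
Proof. by case: z; case: w => a b c e /= -> ->. Qed.

Lemma gconv_linl (a : R[i]) f f' g x : CcC f -> CcC f' -> CcC g ->
  gconv (fun y => a * f y + f' y) g x = a * gconv f g x + gconv f' g x.
Proof.
move=> Cf Cf' Cg; have Cc := CcC_comb a Cf Cf'.
have [rf cf] := Cf; have [rf' cf'] := Cf'; have [rg cg] := Cg.
have reE : cre \o (fun y => a * f y + f' y) =
    fun y => 1 * (cre a * cre (f y) + (- cim a) * cim (f y)) + 1 * cre (f' y).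
  by apply/funext => y /=; rewrite creD creM; ring.
have imE : cim \o (fun y => a * f y + f' y) =
    fun y => 1 * (cre a * cim (f y) + cim a * cre (f y)) + 1 * cim (f' y).
  by apply/funext => y /=; rewrite cimD cimM; ring.
apply: complex_eq.
  rewrite creD creM !cre_gconv// cim_gconv// reE imE !rconv_combl//; try exact: Cc_comb.
  by rewrite /comp; ring.
rewrite cimD cimM !cim_gconv// cre_gconv// reE imE !rconv_combl//; try exact: Cc_comb.
by rewrite /comp; ring.
Qed.

Lemma gconv_linr (a : R[i]) f g g' x : CcC f -> CcC g -> CcC g' ->
  gconv f (fun y => a * g y + g' y) x = a * gconv f g x + gconv f g' x.
Proof.
move=> Cf Cg Cg'; have Cc := CcC_comb a Cg Cg'.
have [rf cf] := Cf; have [rg' cg'] := Cg'; have [rg cg] := Cg.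
have reE : cre \o (fun y => a * g y + g' y) =
    fun y => 1 * (cre a * cre (g y) + (- cim a) * cim (g y)) + 1 * cre (g' y).
  by apply/funext => y /=; rewrite creD creM; ring.
have imE : cim \o (fun y => a * g y + g' y) =
    fun y => 1 * (cre a * cim (g y) + cim a * cre (g y)) + 1 * cim (g' y).
  by apply/funext => y /=; rewrite cimD cimM; ring.
apply: complex_eq.
  rewrite creD creM !cre_gconv// cim_gconv// reE imE !rconv_combr//; try exact: Cc_comb.
  by rewrite /comp; ring.
rewrite cimD cimM !cim_gconv// cre_gconv// reE imE !rconv_combr//; try exact: Cc_comb.
by rewrite /comp; ring.
Qed.

Lemma CcC_normc f : CcC f -> Cc (fun x : T => normc (f x)).
Proof.
move=> [rf cf]; under eq_fun do rewrite normc_def2.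
apply: (Cc_comp2 (phi := fun a b => Num.sqrt (a ^+ 2 + b ^+ 2))) rf cf.
  move=> p; apply: continuous_cvg; first exact: sqrt_continuous.
  by apply: cvgD; apply: cvgM; try exact: cvg_fst; exact: cvg_snd.
by rewrite !expr0n/= addr0 sqrtr0.
Qed.

(** Rotate [z] onto the positive axis: with [c = Re z / |z|] and [s = Im z / |z|], the modulus [|z|]
    is the integral of [c * Re h + s * Im h], whose values are at most [|h|] by Cauchy-Schwarz since
    [c ^ 2 + s ^ 2 = 1]. *)
Lemma normc_gconv f g x : CcC f -> CcC g ->
  normc (gconv f g x) <= rconv (fun y => normc (f y)) (fun y => normc (g y)) x.
Proof.
move=> Cf Cg; have cF := CcC_normc Cf; have cG := CcC_normc Cg.
have rO := GO_gr mul inv x.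
have kF := kernel_CcOn lcT hT hG x cF cG.
set z := gconv f g x.
have [z0|z0] := eqVneq (normc z) 0.
  by rewrite z0 Rintegral_ge0// => y _; rewrite mulr_ge0 ?normc_ge0.
have zgt : 0 < normc z by rewrite lt_def z0 normc_ge0.
pose h y := f y * g (mul (inv y) x).
have kre : CcOn (r x) (fun y => cre (h y)).
  have [rf cf] := Cf; have [rg cg] := Cg.
  have := CcOn_comb 1 (-1) (kernel_CcOn lcT hT hG x rf rg) (kernel_CcOn lcT hT hG x cf cg).
  by congr CcOn; apply/funext => y; rewrite creM; ring.
have kim : CcOn (r x) (fun y => cim (h y)).
  have [rf cf] := Cf; have [rg cg] := Cg.
  have := CcOn_comb 1 1 (kernel_CcOn lcT hT hG x rf cg) (kernel_CcOn lcT hT hG x cf rg).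
  by congr CcOn; apply/funext => y; rewrite cimM; ring.
have sq (w : R[i]) : normc w ^+ 2 = cre w ^+ 2 + cim w ^+ 2.
  by rewrite normc_def2 sqr_sqrtr// addr_ge0 ?sqr_ge0.
have -> : normc z = (cre z / normc z) * Ig (r x) (fun y => cre (h y)) +
                    (cim z / normc z) * Ig (r x) (fun y => cim (h y)).
  rewrite -[Ig (r x) (fun y => cre (h y))]/(cre z) -[Ig (r x) (fun y => cim (h y))]/(cim z).
  by apply: (mulIf z0); rewrite -expr2 sq; field.
rewrite -IgD//; apply: Igle => //; first exact: CcOn_comb.
move=> y _; rewrite -Normc.normcM -/(h y).
have : (cre z / normc z) ^+ 2 + (cim z / normc z) ^+ 2 = 1.
  by rewrite !expr_div_n -mulrDl -sq divff// expf_neq0.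
have := sq (h y); have := normc_ge0 (h y).
move: (cre z / normc z) (cim z / normc z) (cre (h y)) (cim (h y)) (normc (h y)).
move=> c s a b n n0 nE cs.
have e : (c * a + s * b) ^+ 2 + (c * b - s * a) ^+ 2 = n ^+ 2.
  rewrite nE -[RHS]mul1r -cs; ring.
have le2 : (c * a + s * b) ^+ 2 <= n ^+ 2 by rewrite -e lerDl sqr_ge0.
by rewrite leNgt; apply/negP => lt; nra.
Qed.

Lemma CcC_cmeas u (f : T -> R[i]) : CcC f -> @cmeas R _ (Borel T) (Gf u) f.
Proof. by move=> [[rf _] [cf _]]; split; exact: continuous_Borel. Qed.

Lemma gconv_modular (f g : T -> R[i]) u a b : GO u -> CcC f -> CcC g -> 0 < a -> 0 < b ->
  Ig u (fun x => normc (f x)) <= a ->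
  (forall v, GO v -> modular Phi (lam v) (Gf v) (fun x => normc (g x)) b) ->
  modular Phi (lam u) (Gf u) (fun x => normc (gconv f g x)) (a * b).
Proof.
move=> uO Cf Cg a0 b0 fa gb; have cF := CcC_normc Cf; have cG := CcC_normc Cg.
have := rconv_modular uO cF cG (fun x => normc_ge0 _) (fun x => normc_ge0 _) a0 b0 fa gb.
apply: (modular_le hPhi (mGf u)).
- by have [cn _] := CcC_normc (gconv_CcC Cf Cg); exact: continuous_Borel.
- by have [cn _] := rconv_Cc scT lcT hT hG hL cF cG; exact: continuous_Borel.
- move=> x _; have ab := mulr_gt0 a0 b0; apply/andP; split.
    by apply: divr_ge0; [exact: normc_ge0|exact: ltW].
  by rewrite ler_wpM2r ?invr_ge0 ?(ltW ab)//; exact: normc_gconv.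
Qed.

(** * Commutativity in bundles of abelian groups *)

Section CommutativeBundle.
Hypothesis hB : comm_group_bundle mul inv.

Let rd x : r x = d x. Proof. by case: hB. Qed.
Let mulC x y : r x = r y -> mul x y = mul y x. Proof. by case: hB => _; exact. Qed.
Let r_inv x : r (inv x) = r x. Proof. by rewrite (gr_inv hgr) rd. Qed.

Let mul_invKx x y : r x = r y -> mul (inv (mul x y)) x = inv y.
Proof.
move=> xy; have dxy : d x = r y by rewrite -rd.
have dx : d (inv y) = r (inv x) by rewrite (gd_inv hgr) (gr_inv hgr).
rewrite (inv_mul hgr)// (grpd_mulA hgr)//; last by rewrite (gd_inv hgr).
by rewrite -/(d x) dxy -(gd_inv hgr) (mul_xgd hgr).
Qed.

Lemma Cc_inv (g : T -> R) : Cc g -> Cc (g \o inv).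
Proof.
move=> [cg [K cK gK]]; split.
  by move=> x; apply: continuous_comp; [exact: (inv_continuous hG)|exact: cg].
exists (inv @` K).
  by apply: continuous_compact => //; apply: continuous_subspaceT; exact: inv_continuous hG.
by move=> x nK /=; apply: gK => Kx; apply: nK; exists (inv x); rewrite ?(grpd_invK hgr).
Qed.

(* Both sides of [int f * int g^-1 = int g * int f] are iterated integrals of
   [f(xy) g(y)], because [int f * int g^-1] is the integral of the convolution
   of [f] with [g^-1]; cancel [int f > 0]. *)
Lemma haar_inversion_ge0 u (g : T -> R) : GO u -> Cc g -> (forall x, 0 <= g x) ->
  Ig u (g \o inv) = Ig u g.
Proof.
move=> uO cg g0; have ru : r u = u by exact: (GO_id hgr uO).
have [K cK uK] := lcT u.
have [f [cf f01 f1 _]] := Cc_bump R lcT hT cK (@openT T) (@subsetT _ _).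
have f0 x : 0 <= f x by case/andP: (f01 x).
have Ifgt0 : 0 < Ig u f.
  have [_ /(_ u uO) supp _ _] := hL.
  have : msupport (lam u) u by rewrite supp.
  move=> /(_ (K^°) (@open_interior _ _) uK) pos.
  rewrite -lte_fin (haar_RsetT scT hT hG hL)// /Rintegral fineK; last first.
    by apply: integrable_fin_num => //; exact: (Cc_integrable hT hL).
  apply: (lt_le_trans pos).
  have mK : @measurable _ (Borel T) K^° by apply: open_Borel; exact: open_interior.
  rewrite -[lam u K^°]mul1e -integral_cst// integral_mkcond.
  apply: nnintegral_le => x _; rewrite /patch; case: ifPn => //.
    by move=> /set_mem Kx; rewrite lee_fin f1//; exact: interior_subset.
  by move=> _; rewrite lee_fin.
have cgi := Cc_inv cg.
have g0i x : 0 <= (g \o inv) x by exact: g0.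
have hid (x : T) : continuous (@id T) by move=> y; exact: cvg_id.
(* As [r = d], the identity qualifies as [sigma]; it gives the kernel [g y * f (mul y x)]. *)
have rd' y : d (id y) = r y by rewrite rd.
apply: (mulfI (lt0r_neq0 Ifgt0)).
suff : ((Ig u f * Ig u (g \o inv))%:E = (Ig u f * Ig u g)%:E)%E by case.
have swap1 := kernel_tonelli scT lcT hT hG hL (inv_continuous hG) (gd_inv hgr) uO cf cgi f0 g0i.
have swap2 := kernel_tonelli scT lcT hT hG hL (hid u) rd' uO cg cf g0 f0.
have mulE c k : 0 <= c -> CcOn u k -> (forall x, 0 <= k x) ->
    (\int[lam u]_(x in Gf u) (c * k x)%:E = (c * Ig u k)%:E)%E.
  move=> c0 ck k0; rewrite EFinM IgE// -ge0_integralZl_EFin//.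
  - by move=> x _; rewrite lee_fin.
  - by apply/measurable_EFinP; exact: CcOn_measurable ck.
have -> : ((Ig u f * Ig u (g \o inv))%:E =
    \int[lam u]_(y in Gf u) \int[lam u]_(x in Gf u) (f y * (g \o inv) (mul (inv y) x))%:E)%E.
  rewrite mulrC -mulE//; first last.
  - exact: Cc_CcOn.
  - by apply: Rintegral_ge0 => x _; exact: g0i.
  apply: eq_integral => y /set_mem uy.
  have ct := translate_CcOn lcT hT hG y cgi; have tE := translate_Ig y cgi.
  rewrite -rd uy in tE; rewrite uy in ct.
  by rewrite mulE// tE mulrC.
rewrite -swap1.
have -> : ((Ig u f * Ig u g)%:E =
    \int[lam u]_(y in Gf u) \int[lam u]_(x in Gf u) (g y * f (mul y x))%:E)%E.
  rewrite -mulE//; first last.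
  - exact: Cc_CcOn.
  - by apply: Rintegral_ge0.
  apply: eq_integral => y /set_mem uy.
  have ct : CcOn u (fun x => f (mul y x)).
    have := translate_CcOn lcT hT hG (inv y) cf.
    by rewrite (grpd_invK hgr) r_inv uy.
  have := translate_Ig (inv y) cf; rewrite (grpd_invK hgr) -rd r_inv uy => tE.
  by rewrite mulE// tE mulrC.
rewrite -swap2; apply: eq_integral => x /set_mem ux.
have k1 := kernel_CcOn lcT hT hG x cf cgi; rewrite ux in k1.
have k2 : CcOn u (fun y => g y * f (mul y x)).
  have [H cH HE] := kernel_ext lcT hT hG (hid u) rd' cg cf.
  exists (fun y => H (x, y)); first exact: Cc_slice1.
  by move=> y uy; rewrite HE//; rewrite ux uy.
rewrite -(IgE uO k1) -(IgE uO k2); congr EFin.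
(* The substitution of [mul x y] for [y] turns [inv (mul (inv (mul x y)) x)] into [y], so the
   convolution at [x] becomes the integral of [f (mul x y) * g y]. *)
have := haar_invariant scT hT hG hL (x := x).
rewrite ux => /(_ _ k1) <-; rewrite -rd ux; apply: eq_Ig => y uy /=.
have xy : r x = r y by rewrite ux uy.
by rewrite (mul_invKx xy) (grpd_invK hgr) mulrC (mulC xy).
Qed.

Lemma haar_inversion u (k : T -> R) : GO u -> CcOn u k -> Ig u (k \o inv) = Ig u k.
Proof.
move=> uO [h ch hk].
have -> : Ig u k = Ig u h by apply: eq_Ig => y uy; rewrite hk.
have -> : Ig u (k \o inv) = Ig u (h \o inv).
  by apply: eq_Ig => y uy /=; rewrite hk// /Gu /= r_inv.
have cn := Cc_norm ch.
(* [|h| + h] and [|h| - h] are nonnegative functions of [Cc], and [h] is half their difference. *)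
pose h1 x := 1 * `|h x| + 1 * h x; pose h2 x := 1 * `|h x| + (-1) * h x.
have c1 : Cc h1 by exact: Cc_comb.
have c2 : Cc h2 by exact: Cc_comb.
have h10 x : 0 <= h1 x by rewrite /h1; have := ler_norm (- h x); rewrite normrN; lra.
have h20 x : 0 <= h2 x by rewrite /h2; have := ler_norm (h x); lra.
have E x : h x = 2^-1 * h1 x + (- 2^-1) * h2 x by rewrite /h1 /h2; field.
have -> : Ig u h = 2^-1 * Ig u h1 + (- 2^-1) * Ig u h2.
  by rewrite -IgD//; [apply: eq_Ig => y _; exact: E|exact: Cc_CcOn|exact: Cc_CcOn].
rewrite -(haar_inversion_ge0 uO c1 h10) -(haar_inversion_ge0 uO c2 h20) -IgD//.
- by apply: eq_Ig => y _; exact: E.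
- by apply: Cc_CcOn; exact: Cc_inv.
- by apply: Cc_CcOn; exact: Cc_inv.
Qed.

(** Inversion turns the left side into the integral of [f (inv y) * g (mul y x)], and translation by
    [x] turns the right side into that of [g (mul x y) * f (inv y)]; the fibres are abelian. *)
Lemma rconvC (f g : T -> R) x : Cc f -> Cc g -> rconv f g x = rconv g f x.
Proof.
move=> cf cg; have xO := GO_gr mul inv x.
rewrite /rconv -(haar_inversion xO (kernel_CcOn lcT hT hG x cf cg)).
rewrite -(haar_invariant scT hT hG hL (kernel_CcOn lcT hT hG x cg cf)) -rd.
apply: eq_Ig => y yx /=.
have xy : r x = r y by rewrite yx.
by rewrite (mul_invKx xy) (grpd_invK hgr) mulrC (mulC xy).
Qed.

Lemma gconvC (f g : T -> R[i]) : CcC f -> CcC g -> gconv f g = gconv g f.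
Proof.
move=> Cf Cg; have [rf cf] := Cf; have [rg cg] := Cg; apply/funext => x.
apply: complex_eq.
  by rewrite !cre_gconv// rconvC// [X in _ - X]rconvC.
by rewrite !cim_gconv// addrC rconvC// [X in _ + X]rconvC.
Qed.


End CommutativeBundle.

End ConvolutionBound.

(** * Continuous sections *)

(** Serves for norms of sections, of which only local bounds are at hand. The covering form of
    compactness is applied to the filter of large reals. *)
Lemma compact_locally_bounded (R : realType) (T : topologicalType) (K : set T)
    (nu : T -> R) : compact K ->
  (forall x, K x -> exists2 M, True & \forall y \near x, K y -> nu y <= M) ->
  exists M, forall y, K y -> nu y <= M.
Proof.
move=> /compact_near_coveringP/near_covering_withinP cK locM.
have [x Kx|M [_ hM]] := cK R (pinfty_nbhs R) (fun M y => nu y <= M) _.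
  have [M _ hM] := locM x Kx.
  exists ([set y | K y -> nu y <= M], [set N | M <= N]) => /=.
    by split => //; by apply: nbhs_pinfty_ge; exact: num_real.
  by move=> [y N] /= [h MN] Ky; exact: le_trans (h Ky) MN.
by exists (M + 1) => y; apply: hM; rewrite ltrDl.
Qed.

Section RealEstimates.
Variable R : realFieldType.
Implicit Types k e t a b x y p q : R.

Lemma le_perturbed_product x a b : 0 <= a -> 0 <= b ->
  (forall e, 0 < e -> x <= (a + e) * (b + e)) -> x <= a * b.
Proof.
move=> a0 b0 H; apply/ler_addgt0Pr => e e0.
have D0 : 0 < a + b + 1 by lra.
(* [(a + t) * (b + t) = a * b + t * (a + b + t)], at most [a * b + e] once [t <= 1] and
   [t * (a + b + 1) <= e]. *)
pose t := Num.min 1 (e / (a + b + 1)).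
have t0 : 0 < t by rewrite lt_min ltr01 divr_gt0.
have t1 : t <= 1 by rewrite ge_min lexx.
have te : t * (a + b + 1) <= e by rewrite -ler_pdivlMr// ge_min lexx orbT.
have := H t t0; nra.
Qed.

Lemma product_close k e x y a b p : 0 < k -> 0 <= e <= 1 -> a <= x + e -> b <= y + e ->
  p <= k * (2 * e) * b + k * a * (2 * e) -> p <= e * (2 * k * (x + y + 2)).
Proof.
move=> k0 /andP[e0 e1] ax bY h; apply: (le_trans h).
have ke : 0 <= k * e by rewrite mulr_ge0 ?(ltW k0).
have h1 : k * e * a <= k * e * (x + 1) by rewrite ler_wpM2l//; lra.
have h2 : k * e * b <= k * e * (y + 1) by rewrite ler_wpM2l//; lra.
lra.
Qed.

Lemma product_bound k t e x y a b p q : 0 < k -> 0 < t -> t <= 1 -> 0 <= x -> 0 <= y ->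
  k * (x + y + 1) * t <= e / 2 -> 0 <= a -> a <= x + t -> 0 <= b -> b <= y + t ->
  p <= e / 2 -> q <= k * a * b -> p + q <= k * x * y + e.
Proof.
move=> k0 t0 t1 x0 y0 te a0 ax b0 bY pe qk.
have h1 : a * b <= (x + t) * (y + t) by exact: ler_pM.
have h2 : (x + t) * (y + t) <= x * y + (x + y + 1) * t by nra.
have h3 : k * (a * b) <= k * (x * y + (x + y + 1) * t).
  by rewrite ler_pM2l//; exact: le_trans h2.
by rewrite -mulrA in qk; lra.
Qed.

End RealEstimates.

Section Sections.
Variables (R : realType) (T : ptopologicalType).
Variables (comp : T -> T -> Prop) (mul : T -> T -> T) (inv : T -> T).
Variable (lam : T -> {measure set (Borel T) -> \bar R}).
Variable Phi : R -> R.
Hypothesis scT : @second_countable T.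
Hypothesis lcT : locally_compact_space T.
Hypothesis hT : hausdorff_space T.
Hypothesis hG : is_topological_groupoid comp mul inv.
Hypothesis hL : left_haar_system mul inv lam.
Hypothesis hPhi : N_function Phi.
Local Notation r := (gr mul inv).
Local Notation d := (gd mul inv).
Local Notation GO := (G0 mul inv).
Local Notation Gf := (Gu mul inv).
Local Notation Ig u k := (Rintegral (lam u) (Gf u) k).
Local Notation normc := (@Normc.normc R).
Local Notation cre := (@complex.Re R).
Local Notation cim := (@complex.Im R).
Local Notation gconv := (gconv mul inv lam).
Local Notation ng u f := (gauge_norm mul inv lam Phi u f).
Local Notation Lp u f := (in_LPhi mul inv lam Phi u f).
Local Notation sN := (sec_norm mul inv lam Phi).
Local Notation E0 := (E0Phi mul inv lam Phi).
Local Notation E1 := (E1 mul inv lam).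
Local Notation hp n := ((2^-1 : R) ^+ n).

Let hgr : is_groupoid comp mul inv := proj1 hG.
Let mGf u : @measurable _ (Borel T) (Gf u) := Gu_measurable hT hG u.

Let ng_ge0 u f : 0 <= ng u f. Proof. exact: gauge_ge0. Qed.

Let ng_le u (f : T -> R[i]) k : 0 < k ->
  modular Phi (lam u) (Gf u) (fun x => normc (f x)) k -> ng u f <= k.
Proof. exact: gauge_le. Qed.

Let ng_lt u (f : T -> R[i]) k : Lp u f -> ng u f < k ->
  0 < k /\ modular Phi (lam u) (Gf u) (fun x => normc (f x)) k.
Proof. exact: (gauge_lt hPhi (mGf u)). Qed.

Let LpD u f g : Lp u f -> Lp u g -> Lp u (fun x => f x + g x).
Proof. exact: (inLPhiD hPhi (mGf u)). Qed.

Let LpZ u a f : Lp u f -> Lp u (fun x => a * f x).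
Proof. by move=> /(inLPhiZ hPhi (mGf u) a)[]. Qed.

Let LpB u f g : Lp u f -> Lp u g -> Lp u (fun x => f x - g x).
Proof. exact: (inLPhiB hPhi (mGf u)). Qed.

Let ngD u f g : Lp u f -> Lp u g -> ng u (fun x => f x + g x) <= ng u f + ng u g.
Proof. exact: (gaugeD hPhi (mGf u)). Qed.

Let ngB u f g : Lp u f -> Lp u g -> ng u (fun x => f x - g x) <= ng u f + ng u g.
Proof. exact: (gaugeB hPhi (mGf u)). Qed.

Let ngZ u a f : Lp u f -> ng u (fun x => a * f x) <= normc a * ng u f.
Proof. by move=> /(inLPhiZ hPhi (mGf u) a)[]. Qed.

Let ngBC u f g : ng u (fun x => f x - g x) = ng u (fun x => g x - f x).
Proof. exact: gaugeBC. Qed.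

Let ng_eq u f g : (forall x, Gf u x -> f x = g x) -> ng u f = ng u g.
Proof. exact: (@gauge_eq R Phi _ (Borel T) (lam u) (Gf u) f g). Qed.

Let ng_le0 u f k : Lp u f -> 0 <= k -> (forall x, Gf u x -> f x = 0) -> ng u f <= k.
Proof.
move=> fL k0 f0; apply: le_trans k0.
have := ngZ 0 fL; rewrite Normc.normc0 mul0r; apply: le_trans.
by rewrite (@ng_eq u f (fun x => 0 * f x))// => x /f0 ->; rewrite mul0r.
Qed.

Lemma CcC_modular (f : T -> R[i]) : CcC f -> exists2 k, 0 < k & forall u, GO u ->
  modular Phi (lam u) (Gf u) (fun x => normc (f x)) k.
Proof.
move=> Cf; have cn := CcC_normc Cf.
have [M M0 fM] := Cc_bounded cn.
have [_ [K cK fK]] := cn.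
have [B B0 hB] := haar_compact_bounded scT lcT hT hG hL cK.
(* With [|f| <= M] and a support of measure at most [B], the integral is at most [Phi (M / k) * B].
   As [M / k <= 1], convexity bounds this by [(M / k) * Phi 1 * B], which is
   [Phi 1 * B / (1 + Phi 1 * B)]. *)
pose k := M * (1 + Phi 1 * B).
have P1 : 0 <= Phi 1 * B by rewrite mulr_ge0 ?(Phi_ge0 hPhi) ?ltW.
have k0 : 0 < k by rewrite /k mulr_gt0//; lra.
exists k => // u uO; rewrite /modular (haar_setT scT hT hG hL)//.
have mK := compact_Borel hT cK.
have Mk : Phi (M / k) * B <= 1.
  have Mk0 : 0 <= M / k by rewrite divr_ge0 ?ltW.
  have Mk1 : M / k <= 1 by rewrite ler_pdivrMr// mul1r /k; nra.
  have := Phi_scale hPhi 1 (t := M / k); rewrite Mk0 Mk1 mulr1 => /(_ isT) h.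
  apply: (@le_trans _ _ (M / k * Phi 1 * B)); first by rewrite ler_wpM2r// ltW.
  have kn : 1 + Phi 1 * B != 0 by rewrite gt_eqF//; lra.
  have -> : M / k * Phi 1 * B = (Phi 1 * B) / (1 + Phi 1 * B).
    by rewrite /k; field; rewrite kn gt_eqF.
  by rewrite ler_pdivrMr; lra.
apply: (@le_trans _ _ (\int[lam u]_(x in K) (Phi (M / k))%:E)%E).
  rewrite [leRHS]integral_mkcond; apply: nnintegral_le => x _.
    by rewrite lee_fin (Phi_ge0 hPhi).
  rewrite /patch; case: ifPn => [_|/negP nK].
    rewrite lee_fin (Phi_mono hPhi)//; first by rewrite divr_ge0 ?normc_ge0 ?ltW.
    rewrite ler_wpM2r ?invr_ge0 ?(ltW k0)//.
    exact: le_trans (ler_norm _) (fM x).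
  by rewrite fK ?mul0r ?(Phi0 hPhi)// => Kx; apply: nK; rewrite inE.
rewrite integral_cst//; apply: (@le_trans _ _ ((Phi (M / k))%:E * B%:E)%E).
  by apply: lee_wpmul2l; [rewrite lee_fin (Phi_ge0 hPhi)|exact: hB].
by rewrite -EFinM lee_fin.
Qed.

Lemma CcC_Lp f u : CcC f -> GO u -> Lp u f.
Proof.
move=> Cf uO; rewrite -[Lp u f]/(@inLPhi R Phi _ (Borel T) (lam u) (Gf u) f).
apply: (proj2 (@inLPhiP R Phi hPhi _ (Borel T) (lam u) (Gf u) (mGf u) f)); split; first exact: CcC_cmeas.
by have [k k0 fk] := CcC_modular Cf; exists k => //; exact: fk.
Qed.

Lemma CcC_ng_bounded f : CcC f -> exists2 M, 0 < M & forall u, GO u -> ng u f <= M.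
Proof.
move=> Cf; have [k k0 fk] := CcC_modular Cf; exists k => // u uO.
by apply: ng_le => //; exact: fk.
Qed.

Lemma CcC_support (f : T -> R[i]) : CcC f -> exists2 K : set T, compact K /\ K `<=` GO &
  forall u, ~ K u -> forall x, Gf u x -> f x = 0.
Proof.
move=> [[_ [K cK fK]] [_ [L cL fL]]].
have [c1 c2] := gr_compact hG (compactU cK cL).
exists (r @` (K `|` L)) => // u nu x ux.
have nKL : ~ (K `|` L) x by move=> KLx; apply: nu; exists x.
apply: complex_eq; first by apply: fK => Kx; apply: nKL; left.
by apply: fL => Lx; apply: nKL; right.
Qed.

Lemma E0_of_Cc f : CcC f -> E0 (of_Cc f).
Proof.
move=> Cf; split.
- by move=> u uO; exact: CcC_Lp.
- move=> u uO e e0; exists f; split => //; exists setT; first exact: filterT.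
  move=> v vO _; apply: (@le_lt_trans _ _ 0) => //.
  by apply: (@ng_le0 v (fun x => f x - f x)) => //;
    [apply: LpB; exact: CcC_Lp|move=> x _; rewrite subrr].
- move=> e e0; have [K cK fK] := CcC_support Cf; exists K => // u uO nK.
  by apply: (@le_lt_trans _ _ 0) => //; apply: ng_le0; [exact: CcC_Lp| |exact: fK].
Qed.

(** Makes [sec_norm] a genuine supremum, as [sup] of an unbounded set is [0] by convention. Near a
    point of [K] the norm is at most that of a local approximant plus [1]; off [K] it is below
    [1]. *)
Lemma E0_bounded xi : E0 xi -> exists2 M, 0 < M & forall u, GO u -> ng u (xi u) <= M.
Proof.
move=> [xL xloc xv]; have [K [cK KO] hK] := xv 1 ltr01.
have [|M hM] := @compact_locally_bounded R T K (fun u => ng u (xi u)) cK.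
  move=> u Ku; have [f [Cf [V uV hV]]] := xloc u (KO u Ku) 1 ltr01.
  have [M M0 fM] := CcC_ng_bounded Cf.
  exists (1 + M) => //; apply: filterS uV => v Vv Kv; have vO := KO v Kv.
  have fL := CcC_Lp Cf vO; have := ngD (LpB (xL v vO) fL) fL.
  rewrite (@ng_eq v _ (xi v)); last by move=> x _; rewrite subrK.
  move=> h; apply: (le_trans h); apply: lerD; last exact: fM.
  exact: ltW (hV v vO Vv).
exists (`|M| + 1); first by rewrite ltr_pwDr.
move=> u uO; have [Ku|nK] := pselect (K u).
  by apply: (le_trans (hM u Ku)); rewrite (le_trans (ler_norm _))// lerDl.
by apply: (le_trans (ltW (hK u uO nK))); rewrite lerDr.
Qed.

Lemma sN_ub xi u : E0 xi -> GO u -> ng u (xi u) <= sN xi.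
Proof.
move=> /E0_bounded[M _ hM] uO; apply: ub_le_sup; last by exists u.
by exists M => _ [v vO <-]; exact: hM.
Qed.

Lemma sN_le xi c : (forall u, GO u -> ng u (xi u) <= c) -> sN xi <= c.
Proof.
move=> h; apply: ge_sup; last by move=> _ [v vO <-]; exact: h.
by exists (ng (r point) (xi (r point))); exists (r point) => //; exists point.
Qed.

Lemma sN_ge0 xi : E0 xi -> 0 <= sN xi.
Proof. by move=> /sN_ub h; apply: le_trans (h (r point) (GO_gr mul inv _)). Qed.

Lemma E0_comb a xi eta : E0 xi -> E0 eta -> E0 (fun u x => a * xi u x + eta u x).
Proof.
move=> [xL xloc xv] [yL yloc yv].
pose c := normc a + 1; have c1 : 1 <= c by rewrite lerDr normc_ge0.
have c0 : 0 < c by lra.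
have na : normc a <= c by rewrite lerDl.
have H e : 0 < e -> 0 < e / 2 / c by move=> e0; rewrite !divr_gt0.
have comb u e f g : 0 < e -> Lp u f -> Lp u g -> ng u f < e / 2 / c ->
    ng u g < e / 2 -> ng u (fun x => a * f x + g x) < e.
  move=> e0 fL gL fe ge; apply: (le_lt_trans (ngD (LpZ a fL) gL)).
  rewrite [ltRHS](splitr e); apply: ler_ltD => //; apply: (le_trans (ngZ a fL)).
  apply: (@le_trans _ _ (c * (e / 2 / c))); last by rewrite mulrC divfK// gt_eqF.
  by apply: ler_pM => //; [exact: normc_ge0|exact: ltW].
split.
- by move=> u uO; apply: LpD; [exact: LpZ (xL u uO)|exact: yL].
- move=> u uO e e0.
  have e2 : 0 < e / 2 by exact: divr_gt0.
  have [f [Cf [V uV hV]]] := xloc u uO _ (H e e0).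
  have [g [Cg [W uW hW]]] := yloc u uO _ e2.
  exists (fun x => a * f x + g x); split; first exact: CcC_comb.
  exists (V `&` W); first exact: filterI.
  move=> v vO [Vv Wv].
  have := comb v e _ _ e0 (LpB (xL v vO) (CcC_Lp Cf vO)) (LpB (yL v vO) (CcC_Lp Cg vO))
    (hV v vO Vv) (hW v vO Wv).
  rewrite (@ng_eq v _ ((fun x => a * xi v x + eta v x) - (fun x => a * f x + g x)))//.
  move=> x _; rewrite -[RHS]/(a * xi v x + eta v x - (a * f x + g x)); ring.
- move=> e e0; have e2 : 0 < e / 2 by exact: divr_gt0.
  have [K [cK KO] hK] := xv _ (H e e0); have [L [cL LO] hL'] := yv _ e2.
  exists (K `|` L); first by split; [exact: compactU|move=> u [/KO|/LO]].
  move=> u uO /not_orP[nK nL]; apply: comb => //; [exact: xL|exact: yL|exact: hK|exact: hL'].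
Qed.

(** * Density of compactly supported functions among continuous sections *)

Let Complex0 (c : R) : R[i] := Complex c 0.

Let normc_real c : normc (Complex0 c) = `|c|.
Proof. by rewrite normc_def2 /= expr0n/= addr0 sqrtr_sqr. Qed.

(** On the fibre over [u] the factor is the constant [phi u]: this is how a cut-off in the units
    acts on functions on the groupoid. *)
Lemma CcC_gr_mul (phi : T -> R) f : continuous phi -> CcC f ->
  CcC (fun x => Complex (phi (r x)) 0 * f x).
Proof.
move=> cphi [rf cf].
have cr : continuous (phi \o r).
  by move=> x; apply: continuous_comp; [exact: (gr_continuous hG)|exact: cphi].
split.
  under eq_fun do rewrite creM /= mul0r subr0.
  exact: (CcMl cr rf).
under eq_fun do rewrite cimM /= mul0r addr0.
exact: (CcMl cr cf).
Qed.

(* Local approximants are glued one open set at a time: if [f1], [f2] approximate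
   [phi1 xi], [phi2 xi], then [f1 + (1 - phi1 o r) f2] approximates
   [(1 - (1 - phi1)(1 - phi2)) xi]. *)
Let good xi e (A : set T) := exists f, CcC f /\ exists phi : T -> R,
  [/\ continuous phi, forall x, 0 <= phi x <= 1, forall x, A x -> phi x = 1 &
   forall v, GO v -> ng v (fun x => Complex0 (phi v) * xi v x - f x) <= phi v * e].

Let goodU xi e A B : E0 xi -> 0 < e -> good xi e A -> good xi e B -> good xi e (A `|` B).
Proof.
move=> [xL _ _] e0 [f [Cf [p [cp p01 pA pf]]]] [g [Cg [q [cq q01 qB qg]]]].
pose s x := 1 - p x.
have cs : continuous s by move=> x; apply: cvgB; [exact: cvg_cst|exact: cp].
exists (fun x => 1 * (Complex (s (r x)) 0 * g x) + f x); split.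
  by apply: CcC_comb => //; exact: CcC_gr_mul.
exists (fun x => p x + s x * q x); split.
- by move=> x; apply: cvgD; [exact: cp|apply: cvgM; [exact: cs|exact: cq]].
- by move=> x; have /andP[p0 p1] := p01 x; have /andP[q0 q1] := q01 x; rewrite /s; nra.
- by move=> x [/pA|/qB]; rewrite /s => ->; ring.
- move=> v vO; have xv := xL v vO; have fv := CcC_Lp Cf vO; have gv := CcC_Lp Cg vO.
  have L1 := LpB (LpZ (Complex0 (p v)) xv) fv.
  have L2 := LpB (LpZ (Complex0 (q v)) xv) gv.
  rewrite (@ng_eq v _ (fun x => (Complex0 (p v) * xi v x - f x) +
    Complex0 (s v) * (Complex0 (q v) * xi v x - g x))); last first.
    move=> x vx; rewrite vx.
    have -> : Complex0 (p v + s v * q v) = Complex0 (p v) + Complex0 (s v) * Complex0 (q v).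
      by apply: complex_eq; rewrite ?creD ?cimD ?creM ?cimM /=; ring.
    by rewrite /Complex0; ring.
  apply: (le_trans (ngD L1 (LpZ _ L2))).
  (* The errors [p v * e] and [s v * (q v * e)] add up to the new cut-off times [e], so the
     tolerance does not grow with the number of sets. *)
  rewrite mulrDl; apply: lerD; first exact: pf.
  apply: (le_trans (ngZ _ L2)); rewrite normc_real ger0_norm; last first.
    by rewrite /s subr_ge0; case/andP: (p01 v).
  rewrite -mulrA ler_wpM2l//; last exact: qg.
  by rewrite /s subr_ge0; case/andP: (p01 v).
Qed.

(** The cut-off must equal [1] on an open set, whereas [Cc_bump] gives the value [1] on compact
    ones; hence two bumps. The open set [h > 1 / 2] lies in the compact set [h >= 1 / 2], on which
    [p] is [1]. Outside the interior of [V], where nothing is known of [f], [p] vanishes. *)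
Let good_nbhd xi e u : E0 xi -> 0 < e -> GO u -> exists A, [/\ open A, A u & good xi e A].
Proof.
move=> [xL xloc _] e0 uO; have [f [Cf [V uV hV]]] := xloc u uO e e0.
have [h [ch h01 h1 h0]] := Cc_bump R lcT hT (@compact_set1 _ u) (@open_interior _ V)
  (fun x (xu : [set u] x) => eq_ind_r (fun x => V^° x) uV xu).
have [cth [C cC hC]] := ch.
pose K := [set x | 2^-1 <= h x].
have cK : compact K.
  apply: (subclosed_compact _ cC).
    by apply: (@closed_comp _ _ h [set y | 2^-1 <= y]); [move=> x _; exact: cth|exact: closed_ge].
  by move=> x Kx; apply: contrapT => /hC hx; move: Kx; rewrite /K /= hx; lra.
have KV : K `<=` V^°.
  by move=> x Kx; apply: contrapT => /h0 hx; move: Kx; rewrite /K /= hx; lra.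
have [p [cp p01 p1 p0]] := Cc_bump R lcT hT cK (@open_interior _ V) KV.
exists [set x | 2^-1 < h x]; split.
- by apply: (@open_comp _ _ h [set y | 2^-1 < y]); [move=> x _; exact: cth|exact: open_gt].
- by rewrite /= h1//; lra.
exists (fun x => Complex (p (r x)) 0 * f x).
have ctp : continuous p by case: cp.
split; first exact: CcC_gr_mul.
exists p; split => //.
  by move=> x /= hx; apply: p1; exact: ltW.
move=> v vO; have L := LpB (xL v vO) (CcC_Lp Cf vO).
rewrite (@ng_eq v _ (fun x => Complex0 (p v) * (xi v x - f x))); last first.
  by move=> x vx; rewrite vx /Complex0; ring.
apply: (le_trans (ngZ _ L)); rewrite normc_real ger0_norm; last by case/andP: (p01 v).
have [Vv|nV] := pselect (V^° v).
  by rewrite ler_wpM2l ?(ltW (hV v vO _))//; [case/andP: (p01 v)|exact: interior_subset].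
by rewrite p0// !mul0r.
Qed.

(** Finitely many [good] sets cover the compact [K] off which [xi] has norm below [e]. The error is
    at most [p u * e + (1 - p u) * ng u (xi u)]: on [K] the second term is absent, and off [K] this
    is a convex combination of numbers at most [e]. *)
Lemma E0_dense xi e : E0 xi -> 0 < e ->
  exists2 f, CcC f & forall u, GO u -> ng u (fun x => xi u x - f x) <= e.
Proof.
move=> xE e0; have [xL _ xv] := xE; have [K [cK KO] hK] := xv e e0.
have ex u : exists A, open A /\ (K u -> A u /\ good xi e A).
  have [/KO uO|nK] := pselect (K u); last by exists setT; split => //; exact: openT.
  by have [A [oA Au gA]] := good_nbhd xE e0 uO; exists A.
have [A hA] := choice ex.
have cvK : cover_compact K by rewrite -compact_cover.
have [|x Kx|D' D'K KD] := cvK T K A.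
- by move=> i _; exact: (hA i).1.
- by exists x => //; exact: ((hA x).2 Kx).1.
have : good xi e (\bigcup_(i in [set` D']) A i).
  rewrite bigcup_fset big_seq; elim/big_ind : _ => [|B C|i /D'K /set_mem Ki].
  - exists (fun=> 0); split; first by split; exact: Cc0.
    exists (fun=> 0); split => //; first exact: cst_continuous.
    + by move=> x; rewrite lexx ler01.
    + move=> v vO; rewrite mul0r; apply: ng_le0 => //.
        by apply: LpB; [apply: LpZ; exact: xL|apply: CcC_Lp => //; split; exact: Cc0].
      by move=> x _; rewrite subr0 /Complex0 (_ : Complex 0 0 = 0)// mul0r.
  - exact: goodU.
  - exact: ((hA i).2 Ki).2.
move=> [f [Cf [p [cp p01 p1 pf]]]]; exists f => // u uO.
have xu := xL u uO; have fu := CcC_Lp Cf uO; have /andP[p0 pl1] := p01 u.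
rewrite (@ng_eq u _ (fun x => (Complex0 (p u) * xi u x - f x) + Complex0 (1 - p u) * xi u x)); last first.
  move=> x _; have -> : Complex0 (1 - p u) = 1 - Complex0 (p u).
    by apply: complex_eq; rewrite ?creD ?cimD ?creN ?cimN /=; ring.
  by ring.
apply: (le_trans (ngD (LpB (LpZ _ xu) fu) (LpZ _ xu))).
have h1 := pf u uO; have h2 := ngZ (Complex0 (1 - p u)) xu.
rewrite normc_real ger0_norm ?subr_ge0// in h2.
apply: (le_trans (lerD h1 h2)).
have [Ku|nK] := pselect (K u).
  by rewrite p1 ?subrr ?mul0r ?mul1r ?addr0//; exact: KD.
by move: (ng u (xi u)) (hK u uO nK) => m me; nra.
Qed.

Let hp_gt0 n : 0 < hp n. Proof. by rewrite exprn_gt0// invr_gt0. Qed.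

Let hp_small e : 0 < e -> exists n, 2 * hp n < e.
Proof.
move=> e0; have /cvgrPdist_lt/(_ (e / 2)) : hp n @[n --> \oo] --> (0 : R).
  by apply: cvg_expr; rewrite ger0_norm ?invr_ge0// invf_lt1// ltr1n.
rewrite divr_gt0// => /(_ isT) [N _ /(_ N (leqnn N))].
rewrite /= sub0r normrN ger0_norm ?(ltW (hp_gt0 _))// => h.
by exists N; lra.
Qed.

(** Completeness is applied on each fibre and the limits are gathered by choice. The rate is the
    same on all fibres, so a single [F n] approximates the limit globally, and the limit is small at
    units whose fibres miss the support of [F n]. *)
Lemma E0_limit (F : nat -> T -> R[i]) : (forall n, CcC (F n)) ->
  (forall n u, GO u -> ng u (fun x => F n.+1 x - F n x) < hp n) ->
  exists2 xi, E0 xi &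
    forall n u, GO u -> ng u (fun x => xi u x - F n x) <= 2 * hp n.
Proof.
move=> CF hF.
have ex u : exists g, GO u -> Lp u g /\
    forall n, ng u (fun x => g x - F n x) <= 2 * hp n.
  have [uO|nu] := pselect (GO u); last by exists (fun=> 0).
  have FL n : Lp u (F n) := CcC_Lp (CF n) uO.
  have [n||g mg gF] := @gauge_complete R Phi hPhi _ (Borel T) (lam u) (Gf u) (mGf u) F.
  - exact: CcC_cmeas.
  - by move=> n; have [] := ng_lt (LpB (FL n.+1) (FL n)) (hF n u uO).
  exists g => _; split; last first.
    by move=> n; apply: ng_le; [rewrite mulr_gt0|exact: gF].
  have : Lp u (fun x => (g x - F 0%N x) + F 0%N x).
    apply: LpD => //.
    apply: (proj2 (@inLPhiP R Phi hPhi _ (Borel T) (lam u) (Gf u) (mGf u) _)).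
    split; first by apply: cmeasB => //; exact: CcC_cmeas.
    by exists (2 * hp 0); [rewrite mulr_gt0|exact: gF].
  by congr (Lp u _); apply/funext => x; rewrite subrK.
have [xi hxi] := choice ex.
have xL u : GO u -> Lp u (xi u) by move=> uO; case: (hxi u uO).
have xF n u : GO u -> ng u (fun x => xi u x - F n x) <= 2 * hp n.
  by move=> uO; have [_] := hxi u uO; exact.
exists xi => //; split => //.
- move=> u uO e e0; have [n ne] := hp_small e0.
  exists (F n); split => //; exists setT; first exact: filterT.
  by move=> v vO _; apply: le_lt_trans ne; exact: xF.
- move=> e e0; have [n ne] := hp_small e0.
  have [K cK hK] := CcC_support (CF n); exists K => // u uO nK.
  apply: le_lt_trans ne; apply: le_trans (xF n u uO).
  rewrite (@ng_eq u (xi u) (fun x => xi u x - F n x))// => x ux.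
  by rewrite (hK u nK x ux) subr0.
Qed.

Let ae_eq0 u f : Lp u f -> (forall e, 0 < e -> ng u f <= e) ->
  (lam u).-negligible [set x | Gf u x /\ f x <> 0].
Proof.
move=> fL f0; apply: (gauge_eq0 hPhi (mGf u)) => //.
by apply/ler_addgt0Pr => e e0; rewrite add0r; exact: f0.
Qed.

(** * Domination of the [L1]-norm by the gauge norm *)

Lemma CcC_L1_bounded (f : T -> R[i]) : CcC f ->
  exists2 M, 0 < M & forall u, GO u -> Ig u (fun x => normc (f x)) <= M.
Proof.
move=> Cf; have cn := CcC_normc Cf.
have [M M0 fM] := Cc_bounded cn.
have [_ [K cK fK]] := cn.
have [B B0 hB] := haar_compact_bounded scT lcT hT hG hL cK.
exists (M * B); first exact: mulr_gt0.
move=> u uO; rewrite -lee_fin (Ig_EFin hT hG hL uO (Cc_CcOn _ _ _ cn)).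
have mK := compact_Borel hT cK.
rewrite (haar_setT scT hT hG hL)//.
apply: (@le_trans _ _ (\int[lam u]_(x in K) M%:E)%E).
  rewrite [leRHS]integral_mkcond; apply: nnintegral_le => x _.
    by rewrite lee_fin normc_ge0.
  rewrite /patch; case: ifPn => [_|/negP nK].
    by rewrite lee_fin; exact: le_trans (ler_norm _) (fM x).
  by rewrite fK// => Kx; apply: nK; rewrite inE.
rewrite integral_cst// EFinM.
by apply: lee_wpmul2l; [rewrite lee_fin ltW|exact: hB].
Qed.

Lemma E1_bounded xi : E1 xi ->
  exists M, forall u, GO u -> L1_norm mul inv lam u (xi u) <= M.
Proof.
move=> [xL xloc xv]; have [K [cK KO] hK] := xv 1 ltr01.
have [|M hM] := @compact_locally_bounded R T K (fun u => L1_norm mul inv lam u (xi u)) cK.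
  move=> u Ku; have [f [Cf [V uV hV]]] := xloc u (KO u Ku) 1 ltr01.
  have [M M0 fM] := CcC_L1_bounded Cf.
  exists (1 + M) => //; apply: filterS uV => v Vv Kv; have vO := KO v Kv.
  have [mx Ix] := xL v vO.
  have mf : @cmeas R _ (Borel T) (Gf v) f := CcC_cmeas mul inv v Cf.
  have mxn := @cmeas_normc R _ (Borel T) (Gf v) _ mx.
  have mfn := @cmeas_normc R _ (Borel T) (Gf v) _ mf.
  have mxf := @cmeas_normc R _ (Borel T) (Gf v) _ (@cmeasB R _ (Borel T) (Gf v) _ _ mx mf).
  have If := Ig_EFin hT hG hL vO (Cc_CcOn mul inv v (CcC_normc Cf)).
  have tri (p q : T -> R[i]) : @measurable_fun _ _ (Borel T) R (Gf v) (normc \o p) ->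
      @measurable_fun _ _ (Borel T) R (Gf v) (normc \o q) ->
      (\int[lam v]_(x in Gf v) (normc (p x + q x))%:E <=
       \int[lam v]_(x in Gf v) (normc (p x))%:E + \int[lam v]_(x in Gf v) (normc (q x))%:E)%E.
    move=> mp mq; rewrite -ge0_integralD//; try exact/measurable_EFinP;
      try by move=> x _; rewrite lee_fin normc_ge0.
    apply: nnintegral_le => x _; first by rewrite lee_fin normc_ge0.
    by rewrite -EFinD lee_fin normcD.
  have Ixf : (\int[lam v]_(x in Gf v) (normc (xi v x - f x))%:E < +oo)%E.
    apply: le_lt_trans (tri (xi v) (fun x => - f x) mxn _) _.
      by rewrite (_ : _ \o _ = normc \o f)//; apply/funext => x /=; rewrite normcN.
    by under [X in (_ + X)%E]eq_integral do rewrite normcN; rewrite -If lte_add_pinfty// ltry.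
  have := hV v vO Vv; rewrite /L1_norm => h.
  rewrite -lee_fin fineK; last first.
    by rewrite ge0_fin_numE//; apply: integral_ge0 => x _; rewrite lee_fin normc_ge0.
  have -> : (\int[lam v]_(x in Gf v) (normc (xi v x))%:E =
      \int[lam v]_(x in Gf v) (normc ((xi v x - f x) + f x))%:E)%E.
    by apply: eq_integral => x _; rewrite subrK.
  apply: (le_trans (tri (fun x => xi v x - f x) f mxf mfn)); rewrite EFinD.
  apply: leeD; last by rewrite -If lee_fin; exact: fM.
  rewrite -(@fineK _ (\int[lam v]_(x in Gf v) (normc (xi v x - f x))%:E)%E).
    by rewrite lee_fin ltW.
  by rewrite ge0_fin_numE//; apply: integral_ge0 => x _; rewrite lee_fin normc_ge0.
exists (`|M| + 1) => u uO; have [Ku|nK] := pselect (K u).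
  by apply: (le_trans (hM u Ku)); rewrite (le_trans (ler_norm _))// lerDl.
by apply: (le_trans (ltW (hK u uO nK))); rewrite lerDr.
Qed.

Let Complex0D (a b : R) : Complex0 (a + b) = Complex0 a + Complex0 b.
Proof. by apply: complex_eq; rewrite ?creD ?cimD /= ?addr0. Qed.

(* Otherwise there are [f n] with [L1]-norm at some [w n] more than [4 ^ n] times
   the gauge norm; rescale so that [xi = sum_n c n * |f n|] converges in [E0],
   while its [L1]-norm at [w n] is at least [2 ^ n]. *)
Lemma gauge_dominates_L1 : (forall xi, E0 xi -> E1 xi) ->
  exists2 k, 0 < k & forall f, CcC f -> forall u, GO u ->
    Ig u (fun x => normc (f x)) <= k * sN (of_Cc f).
Proof.
move=> hE; apply: contrapT => nk.
have ex n : exists p : (T -> R[i]) * T, [/\ CcC p.1, GO p.2 &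
    (4 ^+ n) * sN (of_Cc p.1) < Ig p.2 (fun x => normc (p.1 x))].
  apply: contrapT => np; apply: nk; exists (4 ^+ n); first by rewrite exprn_gt0.
  move=> f Cf u uO; rewrite leNgt; apply/negP => lt; apply: np.
  by exists (f, u).
have [p hp'] := choice ex.
pose f n := (p n).1; pose w n := (p n).2.
have Cf n : CcC (f n) by case: (hp' n).
have wO n : GO (w n) by case: (hp' n).
pose a n := Ig (w n) (fun x => normc (f n x)).
have sf n : (4 ^+ n) * sN (of_Cc (f n)) < a n by case: (hp' n).
have s0 n : 0 <= sN (of_Cc (f n)) by apply: sN_ge0; exact: E0_of_Cc.
have a0 n : 0 < a n by apply: le_lt_trans (sf n); rewrite mulr_ge0// exprn_ge0.
(* With this factor [c n * |f n|] has integral [2 ^ n] over the fibre of [w n], while its gauge norm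
   on every fibre is below [2 ^ n / 4 ^ n = 2 ^- n], the rate asked for by [E0_limit]. *)
pose c n := 2 ^+ n / a n.
have c0 n : 0 < c n by rewrite divr_gt0// exprn_gt0.
pose S n x : R := \sum_(i < n) c i * normc (f i x).
have S0 n x : 0 <= S n x by apply: sumr_ge0 => i _; rewrite mulr_ge0 ?normc_ge0 ?ltW.
pose F n x := Complex0 (S n x).
have CF n : CcC (F n).
  split; last exact: Cc0.
  rewrite -[fun x => _]/(S n); elim: n => [|n IH].
    by rewrite (_ : S 0%N = fun=> 0); [exact: Cc0|apply/funext => x; rewrite /S big_ord0].
  rewrite (_ : S n.+1 = fun x => S n x + c n * normc (f n x)).
    by apply: CcD => //; apply: CcZ; exact: CcC_normc.
  by apply/funext => x; rewrite /S big_ord_recr.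
have hF n u : GO u -> ng u (fun x => F n.+1 x - F n x) < hp n.
  move=> uO; have fL := CcC_Lp (Cf n) uO.
  have mF : @cmeas R _ (Borel T) (Gf u) (fun x => F n.+1 x - F n x).
    by apply: cmeasB; exact: CcC_cmeas.
  have [x _|_ h] := @inLPhi_le R Phi hPhi _ (Borel T) (lam u) (Gf u) (mGf u) _ _ (c n) (ltW (c0 n)) mF fL.
    rewrite /F /S big_ord_recr Complex0D addrAC subrr add0r normc_real.
    by rewrite ger0_norm// mulr_ge0 ?normc_ge0// ltW.
  apply: (le_lt_trans h); apply: (@le_lt_trans _ _ (c n * sN (of_Cc (f n)))).
    by rewrite ler_wpM2l ?(ltW (c0 n))//; exact: (sN_ub (E0_of_Cc (Cf n)) uO).
  rewrite /c mulrAC ltr_pdivrMr//.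
  have e4 : (4 : R) ^+ n = 2 ^+ n * 2 ^+ n by rewrite -exprMn; congr (_ ^+ _); ring.
  have P0 : 0 < (2 : R) ^+ n by rewrite exprn_gt0.
  by rewrite -(ltr_pM2l P0) !mulrA exprVn divff ?gt_eqF// mul1r -e4; exact: sf.
have [xi xiE xiF] := E0_limit CF hF.
have [M hM] := E1_bounded (hE xi xiE).
(* That is, [2 ^ n > 2 * (|M| + 1)], which exceeds the supposed bound [M]. *)
have [n nM] : exists n, 2 * hp n < (`|M| + 1)^-1.
  by apply: hp_small; rewrite invr_gt0 ltr_pwDr.
have uO := wO n; set u := w n in uO.
have [xL _ _] := xiE; have xu := xL u uO; have [mx _] := xu.
have mxn := @cmeas_normc R _ (Borel T) (Gf u) _ mx.
have cfn := CcZ (c n) (CcC_normc (Cf n)).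
have mfn : @measurable_fun _ _ (Borel T) R (Gf u) (fun x => c n * normc (f n x)).
  by have [cc _] := cfn; exact: continuous_Borel.
(* The positive part of [c n * |f n| - |xi|]. For [m > n] the sum [F m] contains the summand
   [c n * |f n|], so [e] is at most [|xi - F m|]. As [m] grows its gauge is seen to be zero, whence
   [c n * |f n| <= |xi|] almost everywhere. *)
pose e x := Complex0 (Num.max 0 (c n * normc (f n x) - normc (xi u x))).
have me : @cmeas R _ (Borel T) (Gf u) e.
  split; last exact: measurable_cst.
  apply: (@measurable_maxr _ (Borel T) R (Gf u) (cst 0)); first exact: measurable_cst.
  exact: (@measurable_funB _ (Borel T) R (Gf u) _ _ mfn mxn).
have eF m : (n < m)%N -> Lp u e /\ ng u e <= 2 * hp m.
  move=> nm; have dL := LpB xu (CcC_Lp (CF m) uO).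
  have [x _|eL h] := @inLPhi_le R Phi hPhi _ (Borel T) (lam u) (Gf u) (mGf u) _ _ 1 ler01 me dL.
    rewrite mul1r normc_real ger0_norm ?le_max ?lexx// ge_max normc_ge0/= lerBlDr.
    apply: (@le_trans _ _ (normc (F m x))).
      rewrite normc_real ger0_norm// /S (bigD1 (Ordinal nm))//= lerDl sumr_ge0//.
      by move=> i _; rewrite mulr_ge0 ?normc_ge0 ?ltW.
    by have := normcD (F m x - xi u x) (xi u x); rewrite subrK normcB_sym.
  by split => //; apply: (le_trans h); rewrite mul1r; exact: xiF.
have eL : Lp u e by case: (eF n.+1 (ltnSn n)).
have e0 : (lam u).-negligible [set x | Gf u x /\ e x <> 0].
  apply: ae_eq0 => // eps eps0; have [m hm] := hp_small eps0.
  have [|_ h] := eF (maxn n.+1 m); first exact: leq_maxl.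
  apply: (le_trans h); apply: le_trans (ltW hm); rewrite ler_pM2l//.
  by apply: ler_wiXn2l; [rewrite invr_ge0|rewrite invf_le1// ler1n|exact: leq_maxr].
have [/(_ u uO)[_ Ix] _ _] := hE xi xiE.
have le1 : ((Ig u (fun x => c n * normc (f n x)))%:E <=
    \int[lam u]_(x in Gf u) (normc (xi u x))%:E)%E.
  rewrite (Ig_EFin hT hG hL uO (Cc_CcOn _ _ _ cfn)).
  apply: ae_ge0_le_integral => //.
  - by move=> x _; rewrite lee_fin mulr_ge0 ?normc_ge0 ?ltW.
  - exact/measurable_EFinP.
  - by move=> x _; rewrite lee_fin normc_ge0.
  - exact/measurable_EFinP.
  apply: negligibleS e0 => x /= /not_implyP[ux nle]; split => // ex0; apply: nle.
  rewrite lee_fin -subr_le0.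
  have := congr1 cre ex0 => /= h; rewrite -[leRHS]h le_max lexx orbT//.
have E2 : Ig u (fun x => c n * normc (f n x)) = 2 ^+ n.
  have h := @Ig_comb R T comp mul inv lam hT hG hL u (c n) 0 _ _ uO
    (Cc_CcOn _ _ _ (CcC_normc (Cf n))) (Cc_CcOn _ _ _ (CcC_normc (Cf n))).
  rewrite mul0r addr0 -/(a n) in h.
  transitivity (c n * a n); last by rewrite /c divfK// gt_eqF.
  by rewrite -h; apply: eq_Ig => y _; rewrite mul0r addr0.
have := hM u uO; rewrite /L1_norm -lee_fin fineK; last first.
  by rewrite ge0_fin_numE//; apply: integral_ge0 => x _; rewrite lee_fin normc_ge0.
move=> /(le_trans le1); rewrite lee_fin E2 => h2.
move: nM; rewrite exprVn ltr_pdivrMr ?exprn_gt0// mulrC ltr_pdivlMr ?ltr_pwDr//.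
have := ler_norm M; have := normr_ge0 M; lra.
Qed.

(** [gconv_modular] takes positive admissible constants, whereas the norms may be [0] and
    admissibility is known only strictly above the infimum. Both factors are raised by [e], which
    [le_perturbed_product] then removes. *)
Lemma gconv_gauge_le k : 0 < k ->
  (forall f, CcC f -> forall u, GO u -> Ig u (fun x => normc (f x)) <= k * sN (of_Cc f)) ->
  forall f g, CcC f -> CcC g -> forall u, GO u ->
    ng u (gconv f g) <= k * sN (of_Cc f) * sN (of_Cc g).
Proof.
move=> k0 hk f g Cf Cg u uO.
have A0 : 0 <= k * sN (of_Cc f) by rewrite mulr_ge0 ?sN_ge0 ?ltW//; exact: E0_of_Cc.
have B0 : 0 <= sN (of_Cc g) by rewrite sN_ge0//; exact: E0_of_Cc.
have fA := hk f Cf u uO.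
move: (k * sN (of_Cc f)) A0 fA => A A0 fA.
have gB v : GO v -> ng v g <= sN (of_Cc g) by move=> vO; exact: (sN_ub (E0_of_Cc Cg) vO).
move: (sN (of_Cc g)) B0 gB => B B0 gB.
apply: le_perturbed_product => // e e0.
have a0 : 0 < A + e by rewrite ltr_wpDl.
have b0 : 0 < B + e by rewrite ltr_wpDl.
apply: ng_le; first exact: mulr_gt0.
apply: (gconv_modular scT lcT hT hG hL hPhi uO Cf Cg a0 b0).
  by apply: le_trans fA _; rewrite lerDl ltW.
move=> v vO; apply: (proj2 (ng_lt (CcC_Lp Cg vO) _)).
by apply: le_lt_trans (gB v vO) _; rewrite ltrDl.
Qed.

Let ng_triangle u f g h : Lp u f -> Lp u g -> Lp u h ->
  ng u (fun x => f x - h x) <= ng u (fun x => f x - g x) + ng u (fun x => g x - h x).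
Proof. exact: (gauge_triangle hPhi (mGf u)). Qed.

(** * Extension of the convolution to continuous sections *)

Section Extension.
Variable k : R.
Hypothesis k0 : 0 < k.
Hypothesis hk : forall f g : T -> R[i], CcC f -> CcC g -> forall u, GO u ->
    ng u (gconv f g) <= k * sN (of_Cc f) * sN (of_Cc g).

Let approx (e : R) (xi : gsection R T) (f : T -> R[i]) :=
  CcC f /\ forall u, GO u -> ng u (fun x => xi u x - f x) <= e.

Let gconv_C (f g : T -> R[i]) : CcC f -> CcC g -> CcC (gconv f g).
Proof. exact: (gconv_CcC scT lcT hT hG hL). Qed.

Let approxW e e' xi f : e <= e' -> approx e xi f -> approx e' xi f.
Proof. by move=> ee' [Cf h]; split => // u uO; apply: le_trans ee'; exact: h. Qed.

Let approx_of_Cc e f : 0 <= e -> CcC f -> approx e (of_Cc f) f.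
Proof.
move=> e0 Cf; split => // u uO; apply: ng_le0 => //.
  by apply: LpB; exact: CcC_Lp.
by move=> x _; rewrite subrr.
Qed.

Let approx_sN e xi f : E0 xi -> approx e xi f -> sN (of_Cc f) <= sN xi + e.
Proof.
move=> xE [Cf h]; have [xL _ _] := xE; apply: sN_le => u uO.
have xu := xL u uO; have fu := CcC_Lp Cf uO.
rewrite (@ng_eq u _ (fun x => xi u x - (xi u x - f x))); last first.
  by move=> x _; rewrite /of_Cc opprB addrC subrK.
apply: (le_trans (ngB xu (LpB xu fu))); apply: lerD; last exact: h.
exact: sN_ub.
Qed.

Let approx_sub e xi f f' u : E0 xi -> approx e xi f -> approx e xi f' -> GO u ->
  ng u (fun x => f x - f' x) <= 2 * e.
Proof.
move=> [xL _ _] [Cf h] [Cf' h'] uO.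
have xu := xL u uO; have fu := CcC_Lp Cf uO; have fu' := CcC_Lp Cf' uO.
have := ng_triangle fu xu fu'.
move=> H; apply: (le_trans H); rewrite mulr_natl mulr2n; apply: lerD; last exact: h'.
by have := h u uO; rewrite ngBC.
Qed.

Let approx_comb e a xi eta f g : E0 xi -> E0 eta -> approx e xi f -> approx e eta g ->
  approx ((normc a + 1) * e) (fun u x => a * xi u x + eta u x) (fun x => a * f x + g x).
Proof.
move=> [xL _ _] [yL _ _] [Cf hf] [Cg hg]; split; first exact: CcC_comb.
move=> u uO; have fu := LpB (xL u uO) (CcC_Lp Cf uO); have gu := LpB (yL u uO) (CcC_Lp Cg uO).
rewrite (@ng_eq u _ (fun x => a * (xi u x - f x) + (eta u x - g x))); last first.
  by move=> x _; ring.
apply: (le_trans (ngD (LpZ a fu) gu)); rewrite mulrDl mul1r.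
apply: lerD; last exact: hg.
by apply: (le_trans (ngZ a fu)); rewrite ler_wpM2l ?normc_ge0//; exact: hf.
Qed.

(** By bilinearity the difference is the convolution of [f - f'] with [g] plus that of [f'] with
    [g - g']; hence the mixture of [g] and [f'] in the bound. *)
Let gconv_sub f f' g g' u : CcC f -> CcC f' -> CcC g -> CcC g' -> GO u ->
  forall A B, (forall v, GO v -> ng v (fun x => f x - f' x) <= A) ->
   (forall v, GO v -> ng v (fun x => g x - g' x) <= B) ->
  ng u (fun x => gconv f g x - gconv f' g' x) <=
    k * A * sN (of_Cc g) + k * sN (of_Cc f') * B.
Proof.
move=> Cf Cf' Cg Cg' uO A B hA hB.
pose df x := (-1) * f' x + f x; pose dg x := (-1) * g' x + g x.
have Cdf : CcC df by exact: CcC_comb.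
have Cdg : CcC dg by exact: CcC_comb.
rewrite (@ng_eq u _ (fun x => gconv df g x + gconv f' dg x)); last first.
  by move=> x _; rewrite (gconv_linl lcT hT hG hL)// (gconv_linr lcT hT hG hL)//; ring.
have L1 := CcC_Lp (gconv_C Cdf Cg) uO; have L2 := CcC_Lp (gconv_C Cf' Cdg) uO.
apply: (le_trans (ngD L1 L2)); apply: lerD.
  apply: (le_trans (hk Cdf Cg uO)); rewrite ler_wpM2r ?sN_ge0//; first exact: E0_of_Cc.
  rewrite ler_pM2l//; apply: sN_le => v vO; apply: le_trans (hA v vO).
  by rewrite (@ng_eq v _ (fun x => f x - f' x))// => x _; rewrite /of_Cc /df; ring.
apply: (le_trans (hk Cf' Cdg uO)); rewrite ler_wpM2l ?mulr_ge0 ?(ltW k0) ?sN_ge0//.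
  exact: E0_of_Cc.
apply: sN_le => v vO; apply: le_trans (hB v vO).
by rewrite (@ng_eq v _ (fun x => g x - g' x))// => x _; rewrite /of_Cc /dg; ring.
Qed.

Let gconv_close e xi eta f f' g g' u : E0 xi -> E0 eta -> 0 <= e <= 1 ->
  approx e xi f -> approx e xi f' -> approx e eta g -> approx e eta g' -> GO u ->
  ng u (fun x => gconv f g x - gconv f' g' x) <= e * (2 * k * (sN xi + sN eta + 2)).
Proof.
move=> xE yE e01 af af' ag ag' uO.
have [Cf _] := af; have [Cf' _] := af'; have [Cg _] := ag; have [Cg' _] := ag'.
have := @gconv_sub f f' g g' u Cf Cf' Cg Cg' uO (2 * e) (2 * e)
  (fun v vO => approx_sub xE af af' vO) (fun v vO => approx_sub yE ag ag' vO).
exact: (product_close k0 e01 (approx_sN xE af') (approx_sN yE ag)).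
Qed.

(** Quantifying over all approximants, with one [dl] for all units, rather than over one sequence,
    determines [zeta] up to null sets and lets each law be checked with approximants chosen for the
    occasion. *)
Let is_prod (xi eta zeta : gsection R T) := E0 zeta /\
  forall e, 0 < e -> exists2 dl, 0 < dl & forall f g, approx dl xi f -> approx dl eta g ->
    forall u, GO u -> ng u (fun x => zeta u x - gconv f g x) <= e.

Let prod_exists xi eta : E0 xi -> E0 eta -> exists zeta, is_prod xi eta zeta.
Proof.
move=> xE yE; pose L := 2 * k * (sN xi + sN eta + 2).
have sx := sN_ge0 xE; have sy := sN_ge0 yE.
have L0 : 0 <= L.
  apply: mulr_ge0; first by rewrite mulr_ge0 ?(ltW k0).
  apply: addr_ge0; last by [].
  by apply: addr_ge0; [exact: sx|exact: sy].
have close e f f' g g' u : 0 <= e <= 1 ->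
  approx e xi f -> approx e xi f' -> approx e eta g -> approx e eta g' -> GO u ->
  ng u (fun x => gconv f g x - gconv f' g' x) <= e * L := gconv_close xE yE.
clearbody L; clear sx sy.
(* This makes [dl n <= 1], as [close] requires, and [dl n * L < 2 ^- n], so that consecutive
   products differ by less than [2 ^- n]. *)
pose dl n := hp n / (L + 1).
have L1 : 0 < L + 1 by rewrite ltr_wpDl.
have dl0 n : 0 < dl n by exact: divr_gt0.
have hp1 n : hp n <= 1 by rewrite exprn_ile1 ?invr_ge0 ?invf_le1 ?ler1n.
have hpS n : hp n.+1 <= hp n by rewrite exprS ler_piMl ?(ltW (hp_gt0 n))// invf_le1 ?ler1n.
have dlS n : dl n.+1 <= dl n by rewrite /dl ler_wpM2r ?invr_ge0 ?(ltW L1).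
have dl1 n : dl n <= 1.
  by rewrite ler_pdivrMr// mul1r; apply: (le_trans (hp1 n)); rewrite lerDr.
have dlL n : dl n * L < hp n.
  by rewrite mulrAC ltr_pdivrMr// ltr_pM2l ?hp_gt0// ltrDl.
have exf n : exists f, approx (dl n) xi f.
  by have [f Cf hf] := E0_dense xE (dl0 n); exists f.
have exg n : exists g, approx (dl n) eta g.
  by have [g Cg hg] := E0_dense yE (dl0 n); exists g.
have [f hf] := choice exf; have [g hg] := choice exg.
have dl01 n : 0 <= dl n <= 1 by rewrite dl1 ltW.
have CF n : CcC (gconv (f n) (g n)) by apply: gconv_C; [case: (hf n)|case: (hg n)].
have [|zeta zE zF] := @E0_limit (fun n => gconv (f n) (g n)) CF.
  move=> n u uO; apply: le_lt_trans (dlL n).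
  by apply: (close _ _ _ _ _ _ (dl01 n));
    [exact: approxW (dlS n) (hf n.+1)|exact: hf|exact: approxW (dlS n) (hg n.+1)|exact: hg|exact: uO].
exists zeta; split => // e e0; have e2 : 0 < e / 2 by exact: divr_gt0.
have [n ne] := hp_small e2; exists (dl n) => // f' g' af ag u uO.
have [zL _ _] := zE; have [Cf' _] := af; have [Cg' _] := ag.
have := ng_triangle (zL u uO) (CcC_Lp (CF n) uO) (CcC_Lp (gconv_C Cf' Cg') uO).
move=> H; apply: (le_trans H).
have h1 := zF n u uO.
have h2 := close _ _ _ _ _ _ (dl01 n) (hf n) af (hg n) ag uO.
rewrite [leRHS](splitr e); apply: lerD; first exact: le_trans h1 (ltW ne).
apply: (le_trans h2); apply: (le_trans (ltW (dlL n))); apply: le_trans (ltW ne).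
by rewrite ler_peMl ?(ltW (hp_gt0 n))// ler1n.
Qed.

Let sec_eqI xi eta : E0 xi -> E0 eta ->
  (forall e, 0 < e -> forall u, GO u -> ng u (fun x => xi u x - eta u x) <= e) ->
  sec_eq mul inv lam xi eta.
Proof.
move=> [xL _ _] [yL _ _] h u uO.
have := ae_eq0 (LpB (xL u uO) (yL u uO)) (fun e e0 => h e e0 u uO).
apply: negligibleS => x [ux ne]; split => // /eqP; rewrite subr_eq0 => /eqP.
exact: ne.
Qed.

(** [B] picks any section satisfying [is_prod], with default [0] outside [E0]. Each algebraic law is
    an identity between convolutions of approximants carried to the limit. *)
Lemma convolution_extension :
  exists B : gsection R T -> gsection R T -> gsection R T,
     (forall xi eta, E0 xi -> E0 eta -> E0 (B xi eta)) /\
     (forall (a : R[i]) xi xi' eta, E0 xi -> E0 xi' -> E0 eta ->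
        sec_eq mul inv lam (B (sec_add (sec_scale a xi) xi') eta)
          (sec_add (sec_scale a (B xi eta)) (B xi' eta))) /\
     (forall (a : R[i]) xi eta eta', E0 xi -> E0 eta -> E0 eta' ->
        sec_eq mul inv lam (B xi (sec_add (sec_scale a eta) eta'))
          (sec_add (sec_scale a (B xi eta)) (B xi eta'))) /\
     (forall f g : T -> R[i], CcC f -> CcC g ->
        sec_eq mul inv lam (B (of_Cc f) (of_Cc g)) (of_Cc (gconv f g))) /\
     (exists2 C : R, 0 < C &
        forall xi eta, E0 xi -> E0 eta -> sN (B xi eta) <= C * sN xi * sN eta) /\
     (comm_group_bundle mul inv ->
        forall xi eta, E0 xi -> E0 eta -> sec_eq mul inv lam (B xi eta) (B eta xi)).
Proof.
have ex (p : gsection R T * gsection R T) : exists zeta, E0 p.1 -> E0 p.2 -> is_prod p.1 p.2 zeta.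
  have [[xE yE]|h] := pselect (E0 p.1 /\ E0 p.2).
    by have [z hz] := prod_exists xE yE; exists z.
  by exists (fun _ _ => 0) => xE yE; exfalso; apply: h.
have [B0 hB0] := choice ex.
pose B xi eta := B0 (xi, eta).
have hB xi eta : E0 xi -> E0 eta -> is_prod xi eta (B xi eta) := hB0 (xi, eta).
have BE xi eta : E0 xi -> E0 eta -> E0 (B xi eta).
  by move=> xE yE; case: (hB xi eta xE yE).
(* Covers linearity in either argument. The errors of [b], of [a] times [b1] and of [b2] amount to
   [1 + normc a + 1] tolerances, hence the divisor [normc a + 2]. *)
have lin a (b b1 b2 : gsection R T) : E0 b -> E0 b1 -> E0 b2 ->
  (forall e, 0 < e -> exists h1 h2, [/\ CcC h1, CcC h2 & forall u, GO u ->
     [/\ ng u (fun x => b1 u x - h1 x) <= e, ng u (fun x => b2 u x - h2 x) <= e &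
         ng u (fun x => b u x - (a * h1 x + h2 x)) <= e]]) ->
  sec_eq mul inv lam b (sec_add (sec_scale a b1) b2).
  move=> bE b1E b2E H; apply: (sec_eqI bE (E0_comb a b1E b2E)) => e e0 u uO.
  have c0 : 0 < normc a + 2 by have := normc_ge0 a; lra.
  have [h1 [h2 [C1 C2 hh]]] := H (e / (normc a + 2)) (divr_gt0 e0 c0).
  have [k1 k2 k3] := hh u uO.
  have [bL _ _] := bE; have [b1L _ _] := b1E; have [b2L _ _] := b2E.
  have D1 := LpB (b1L u uO) (CcC_Lp C1 uO); have D2 := LpB (b2L u uO) (CcC_Lp C2 uO).
  have D := LpB (bL u uO) (CcC_Lp (CcC_comb a C1 C2) uO).
  rewrite (@ng_eq u _ (fun x => (b u x - (a * h1 x + h2 x)) -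
     (a * (b1 u x - h1 x) + (b2 u x - h2 x)))); last first.
    by move=> x _; rewrite /sec_add /sec_scale; ring.
  apply: (le_trans (ngB D (LpD (LpZ a D1) D2))).
  have q := ngD (LpZ a D1) D2; have q1 := ngZ a D1.
  have q2 : normc a * ng u (fun x => b1 u x - h1 x) <= normc a * (e / (normc a + 2)).
    exact: (ler_wpM2l (normc_ge0 a) k1).
  have <- : e / (normc a + 2) + (normc a * (e / (normc a + 2)) + e / (normc a + 2)) = e.
    by field; rewrite gt_eqF.
  apply: lerD; first exact: k3.
  apply: (le_trans q); apply: lerD; [exact: le_trans q2|exact: k2].
have pick xi e : E0 xi -> 0 < e -> exists f, approx e xi f.
  by move=> xE e0; have [f Cf hf] := E0_dense xE e0; exists f.
(* A common precision for several moduli. The condition on [c * t] serves for a combination of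
   approximants, whose error is multiplied by [normc a + 1], and for the excess of the product of
   two perturbed norms in the norm bound. *)
have prec (d1 d2 d3 c : R) : 0 < d1 -> 0 < d2 -> 0 < d3 -> 0 < c -> exists t, [/\ 0 < t,
    t <= d1, t <= d2, t <= d3 & c * t <= d3].
  move=> p1 p2 p3 pc; exists (Num.min (Num.min d1 d2) (Num.min d3 (d3 / c))); split.
  - by rewrite !lt_min p1 p2 p3 divr_gt0.
  - by rewrite !ge_min lexx.
  - by rewrite !ge_min lexx !orbT.
  - by rewrite !ge_min lexx !orbT.
  - by rewrite mulrC -ler_pdivlMr// !ge_min lexx !orbT.
exists B; split; [exact: BE|split; [|split; [|split; [|split]]]].
- move=> a xi xi' eta xE xE' yE.
  have sE : E0 (sec_add (sec_scale a xi) xi') by exact: E0_comb.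
  apply: lin; [exact: BE|exact: BE|exact: BE|] => e e0.
  have [_ /(_ e e0)[d1 d10 h1]] := hB _ _ xE yE.
  have [_ /(_ e e0)[d2 d20 h2]] := hB _ _ xE' yE.
  have [_ /(_ e e0)[d3 d30 h3]] := hB _ _ sE yE.
  have c0 : 0 < normc a + 1 by have := normc_ge0 a; lra.
  have [t [t0 t1 t2 t3 tc]] := prec _ _ _ _ d10 d20 d30 c0.
  have [f af] := pick xi t xE t0; have [f' af'] := pick xi' t xE' t0.
  have [g ag] := pick eta t yE t0.
  have [Cf _] := af; have [Cf' _] := af'; have [Cg _] := ag.
  exists (gconv f g), (gconv f' g); split; [exact: gconv_C|exact: gconv_C|] => u uO; split.
  + exact: (h1 f g (approxW t1 af) (approxW t1 ag) u uO).
  + exact: (h2 f' g (approxW t2 af') (approxW t2 ag) u uO).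
  + have := h3 _ g (approxW tc (approx_comb a xE xE' af af')) (approxW t3 ag) u uO.
    rewrite (@ng_eq u _ (fun x => B (sec_add (sec_scale a xi) xi') eta u x -
      (a * gconv f g x + gconv f' g x)))// => x _.
    by rewrite (gconv_linl lcT hT hG hL).
- move=> a xi eta eta' xE yE yE'.
  have sE : E0 (sec_add (sec_scale a eta) eta') by exact: E0_comb.
  apply: lin; [exact: BE|exact: BE|exact: BE|] => e e0.
  have [_ /(_ e e0)[d1 d10 h1]] := hB _ _ xE yE.
  have [_ /(_ e e0)[d2 d20 h2]] := hB _ _ xE yE'.
  have [_ /(_ e e0)[d3 d30 h3]] := hB _ _ xE sE.
  have c0 : 0 < normc a + 1 by have := normc_ge0 a; lra.
  have [t [t0 t1 t2 t3 tc]] := prec _ _ _ _ d10 d20 d30 c0.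
  have [f af] := pick xi t xE t0; have [g ag] := pick eta t yE t0.
  have [g' ag'] := pick eta' t yE' t0.
  have [Cf _] := af; have [Cg' _] := ag'; have [Cg _] := ag.
  exists (gconv f g), (gconv f g'); split; [exact: gconv_C|exact: gconv_C|] => u uO; split.
  + exact: (h1 f g (approxW t1 af) (approxW t1 ag) u uO).
  + exact: (h2 f g' (approxW t2 af) (approxW t2 ag') u uO).
  + have := h3 f _ (approxW t3 af) (approxW tc (approx_comb a yE yE' ag ag')) u uO.
    rewrite (@ng_eq u _ (fun x => B xi (sec_add (sec_scale a eta) eta') u x -
      (a * gconv f g x + gconv f g' x)))// => x _.
    by rewrite (gconv_linr lcT hT hG hL).
- move=> f g Cf Cg; have fE := E0_of_Cc Cf; have gE := E0_of_Cc Cg.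
  apply: sec_eqI; [exact: BE|by apply: E0_of_Cc; exact: gconv_C|] => e e0 u uO.
  have [_ /(_ e e0)[d1 d10 h1]] := hB _ _ fE gE.
  by apply: h1 => //; apply: approx_of_Cc => //; exact: ltW.
- exists k => // xi eta xE yE; apply: sN_le => u uO.
  have sx := sN_ge0 xE; have sy := sN_ge0 yE.
  apply/ler_addgt0Pr => e e0; have e2 : 0 < e / 2 by exact: divr_gt0.
  have D0 : 0 < k * (sN xi + sN eta + 1) by apply: mulr_gt0 k0 (ltr_wpDl (addr_ge0 sx sy) ltr01).
  have [_ /(_ (e / 2) e2)[d1 d10 h1]] := hB _ _ xE yE.
  have [t [t0 t1 t2 _ tc]] := prec _ _ _ _ d10 ltr01 e2 D0.
  have [f af] := pick xi t xE t0; have [g ag] := pick eta t yE t0.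
  have [Cf _] := af; have [Cg _] := ag.
  have [bL _ _] := BE _ _ xE yE; have hu := CcC_Lp (gconv_C Cf Cg) uO.
  have q := ngD (LpB (bL u uO) hu) hu.
  rewrite (@ng_eq u _ (B xi eta u)) in q; last by move=> x _; rewrite subrK.
  apply: (le_trans q).
  have q1 := h1 f g (approxW t1 af) (approxW t1 ag) u uO.
  have q2 := hk Cf Cg uO.
  have X := approx_sN xE af; have Y := approx_sN yE ag.
  have X0 := sN_ge0 (E0_of_Cc Cf); have Y0 := sN_ge0 (E0_of_Cc Cg).
  exact: (product_bound k0 t0 t2 sx sy tc X0 X Y0 Y q1 q2).
- move=> hB' xi eta xE yE; apply: sec_eqI; [exact: BE|exact: BE|] => e e0 u uO.
  have e2 : 0 < e / 2 by exact: divr_gt0.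
  have [_ /(_ (e / 2) e2)[d1 d10 h1]] := hB _ _ xE yE.
  have [_ /(_ (e / 2) e2)[d2 d20 h2]] := hB _ _ yE xE.
  have [t [t0 t1 t2 _ _]] := prec _ _ _ _ d10 d20 ltr01 ltr01.
  have [f af] := pick xi t xE t0; have [g ag] := pick eta t yE t0.
  have [Cf _] := af; have [Cg _] := ag.
  have [bL _ _] := BE _ _ xE yE; have [bL' _ _] := BE _ _ yE xE.
  have q1 := h1 f g (approxW t1 af) (approxW t1 ag) u uO.
  have q2 := h2 g f (approxW t2 ag) (approxW t2 af) u uO.
  rewrite -(gconvC scT lcT hT hG hL hB' Cf Cg) in q2.
  have := ng_triangle (bL u uO) (CcC_Lp (gconv_C Cf Cg) uO) (bL' u uO).
  move=> H; apply: (le_trans H); rewrite [leRHS](splitr e); apply: lerD; first exact: q1.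
  by rewrite ngBC; exact: q2.
Qed.

End Extension.

End Sections.

Theorem theorem3p12 (R : realType) (T : ptopologicalType)
    (comp : T -> T -> Prop) (mul : T -> T -> T) (inv : T -> T)
    (lam : T -> {measure set (g_sigma_algebraType (@open T)) -> \bar R})
    (Phi Psi : R -> R) :
  @second_countable T -> locally_compact_space T -> hausdorff_space T ->
  is_topological_groupoid comp mul inv ->
  left_haar_system mul inv lam ->
  N_function Phi -> N_function Psi -> Psi = complementary Phi ->
  Delta2 T Phi ->
  (forall xi, E0Phi mul inv lam Phi xi -> E1 mul inv lam xi) ->
  (exists2 C : R, 0 < C &
     forall f g : T -> R[i], CcC f -> CcC g ->
       CcC (gconv mul inv lam f g) /\
       sec_norm mul inv lam Phi (of_Cc (gconv mul inv lam f g)) <=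
         C * sec_norm mul inv lam Phi (of_Cc f) *
             sec_norm mul inv lam Phi (of_Cc g)) /\
  (exists B : gsection R T -> gsection R T -> gsection R T,
     (forall xi eta, E0Phi mul inv lam Phi xi -> E0Phi mul inv lam Phi eta ->
            E0Phi mul inv lam Phi (B xi eta)) /\
         (forall (a : R[i]) xi xi' eta,
            E0Phi mul inv lam Phi xi -> E0Phi mul inv lam Phi xi' ->
            E0Phi mul inv lam Phi eta ->
            sec_eq mul inv lam (B (sec_add (sec_scale a xi) xi') eta)
              (sec_add (sec_scale a (B xi eta)) (B xi' eta))) /\
         (forall (a : R[i]) xi eta eta',
            E0Phi mul inv lam Phi xi -> E0Phi mul inv lam Phi eta ->
            E0Phi mul inv lam Phi eta' ->
            sec_eq mul inv lam (B xi (sec_add (sec_scale a eta) eta'))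
              (sec_add (sec_scale a (B xi eta)) (B xi eta'))) /\
         (forall f g : T -> R[i], CcC f -> CcC g ->
            sec_eq mul inv lam (B (of_Cc f) (of_Cc g))
              (of_Cc (gconv mul inv lam f g))) /\
         (exists2 C : R, 0 < C &
            forall xi eta, E0Phi mul inv lam Phi xi -> E0Phi mul inv lam Phi eta ->
              sec_norm mul inv lam Phi (B xi eta) <=
                C * sec_norm mul inv lam Phi xi * sec_norm mul inv lam Phi eta) /\
         (comm_group_bundle mul inv ->
            forall xi eta, E0Phi mul inv lam Phi xi -> E0Phi mul inv lam Phi eta ->
              sec_eq mul inv lam (B xi eta) (B eta xi))).
Proof.
move=> scT lcT hT hG hL hPhi _ _ _ hE.
have [k k0 hk] := gauge_dominates_L1 scT lcT hT hG hL hPhi hE.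
have bound := gconv_gauge_le scT lcT hT hG hL hPhi k0 hk.
split; last exact: (convolution_extension scT lcT hT hG hL hPhi k0 bound).
exists k => // f g Cf Cg; split; first exact: (gconv_CcC scT lcT hT hG hL).
by apply: sN_le => u uO; exact: bound.
Qed.
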